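(* Let $c\in\mathbb{C}$ with $\operatorname{Re}(c)>0$ and $\operatorname{Im}(c)>0$, and let $H_c$ be the complex harmonic oscillator on $L^2(\mathbb{R})$. For all $0<\delta<1$ there exists an $\varepsilon>0$ such that $$\operatorname{Spec}_\varepsilon(H_c)\subset S(0,\arg(c))+\delta c^{1/2}.$$
   Context: For $c\in\mathbb{C}$ with $\operatorname{Re}(c)>0$, the complex harmonic oscillator $H_c f(x)=-f''(x)+c\,x^2f(x)$ is the m-sectorial operator on $L^2(\mathbb{R})$ associated with the closed m-sectorial form $$Q_c(f,g)=\int_{\mathbb{R}} f'\overline{g'}\,dx + c\int_{\mathbb{R}}x^2 f\overline{g}\,dx$$ with form domain $W^{1,2}(\mathbb{R})\cap\{f\in L^2(\mathbb{R}):\int x^2|f(x)|^2dx<\infty\}$. The root $c^{1/2}$ is principal. For $\varepsilon>0$ the $\varepsilon$-pseudospectrum is $$\operatorname{Spec}_\varepsilon(H_c)=\operatorname{Spec}(H_c)\cup\{z\in\mathbb{C}:\|(H_c-z)^{-1}\|\ge 1/\varepsilon\}.$$ Also $S(0,\arg(c))=\{z\in\mathbb{C}:0<\arg z<\arg(c)\}$, and $S+w$ denotes the translate of the set $S$ by $w\in\mathbb{C}$. *)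

(* Defs.v *)
From HB Require Import structures.
From mathcomp Require Import all_boot all_order all_algebra.
From mathcomp Require Import complex.
From mathcomp Require Import all_classical all_reals all_analysis.

Set Implicit Arguments.
Unset Strict Implicit.
Unset Printing Implicit Defensive.

Import Order.TTheory GRing.Theory Num.Theory.
Import numFieldNormedType.Exports.

Local Open Scope classical_set_scope.
Local Open Scope ring_scope.
Local Open Scope complex_scope.

(* Elements of L^2(R) = L^2(R; C) are
   represented by functions R -> R[i], identified when they agree almost
   everywhere for [lebesgue_measure].  Since such classes are not quotiented,
   operators are given by their graphs, which relate all representatives. *)

Section L2.
Context {R : realType}.
Implicit Types (f g u h : R -> R[i]) (phi : R -> R).

Local Notation mu := (@lebesgue_measure R).

Definition cmeasurable f : Prop :=
  measurable_fun [set: R] (fun x => complex.Re (f x)) /\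
  measurable_fun [set: R] (fun x => complex.Im (f x)).

Definition L2norm f : \bar R := Lnorm mu 2%:E (fun x => (Normc.normc (f x))%:E).

Definition L2 f : Prop := cmeasurable f /\ (L2norm f < +oo)%E.

Definition Cintegral f : R[i] :=
  (\int[mu]_x complex.Re (f x)) +i* (\int[mu]_x complex.Im (f x)).

(* Linear in the first argument. *)
Definition L2inner f g : R[i] := Cintegral (fun x => f x * conjc (g x)).

Definition test_function phi : Prop :=
  (forall n x, derivable (derive1n n phi) x 1) /\
  compact (closure [set x | phi x != 0]).

Definition is_weak_derivative f g : Prop :=
  forall phi, test_function phi ->
    Cintegral (fun x => f x * (derive1 phi x)%:C) =
    - Cintegral (fun x => g x * (phi x)%:C).

Definition W12 f : Prop :=
  L2 f /\ exists g, L2 g /\ is_weak_derivative f g.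

(* A representative of f' when f is in W^{1,2}(R), and 0 otherwise. *)
Definition weak_derivative f : R -> R[i] :=
  xget (cst 0) [set g | L2 g /\ is_weak_derivative f g].

End L2.

Section Operators.
Context {R : realType}.
Implicit Types (A : (R -> R[i]) -> (R -> R[i]) -> Prop).
Implicit Types (f g u v h : R -> R[i]) (z : R[i]).

Local Notation mu := (@lebesgue_measure R).

(* [form_operator D Q u h] means u \in Dom(A) and A u = h, where A is the
   operator associated with the form Q with domain D. *)
Definition form_operator (D : (R -> R[i]) -> Prop)
    (Q : (R -> R[i]) -> (R -> R[i]) -> R[i]) u h : Prop :=
  [/\ D u, L2 h & forall g, D g -> Q u g = L2inner h g].

(* (A - z) u = h *)
Definition resolvent A z h u : Prop := A u (fun x => h x + z * u x).

(* A - z is a bijection from its domain onto L^2(R) with bounded inverse. *)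
Definition resolvent_set A : set R[i] := [set z |
  [/\ forall h, L2 h -> exists u, resolvent A z h u,
      forall h u v, L2 h -> resolvent A z h u -> resolvent A z h v ->
        {ae mu, forall x, u x = v x}
    & exists M : R, forall h u, L2 h -> resolvent A z h u ->
        (L2norm u <= M%:E * L2norm h)%E]].

Definition Spec A : set R[i] := ~` resolvent_set A.

(* The norm of (A - z)^-1; meaningful for z in [resolvent_set A]. *)
Definition resolvent_norm A z : \bar R :=
  ereal_sup [set y | exists h u,
    [/\ L2 h, (L2norm h <= 1)%E, resolvent A z h u & y = L2norm u]].

Definition Spec_eps (eps : R) A : set R[i] :=
  Spec A `|` [set z | resolvent_set A z /\ ((1 / eps)%:E <= resolvent_norm A z)%E].

Definition HO_dom f : Prop :=
  W12 f /\ (\int[mu]_x (x ^+ 2 * Normc.normc (f x) ^+ 2)%:E < +oo)%E.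

Definition HO_form (c : R[i]) f g : R[i] :=
  L2inner (weak_derivative f) (weak_derivative g) +
  c * Cintegral (fun x => (x ^+ 2)%:C * f x * conjc (g x)).

Definition HO (c : R[i]) : (R -> R[i]) -> (R -> R[i]) -> Prop :=
  form_operator HO_dom (HO_form c).

End Operators.

Section Sector.
Context {R : realType}.

(* Principal argument, with values in (-pi, pi], for z != 0. *)
Definition carg (z : R[i]) : R :=
  if 0 <= complex.Im z then acos (complex.Re z / Normc.normc z)
  else - acos (complex.Re z / Normc.normc z).

Definition sector (a b : R) : set R[i] :=
  [set z | z != 0 /\ a < carg z < b].

Definition translate (S : set R[i]) (w : R[i]) : set R[i] :=
  [set z + w | z in S].

End Sector.

(* Main.v *)
Require Import Defs.
From mathcomp Require Import all_boot all_order all_algebra.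
From mathcomp Require Import complex.
From mathcomp Require Import all_classical all_reals all_analysis.
From mathcomp Require Import measurable_realfun.
From mathcomp Require Import ring lra.

Set Implicit Arguments.
Unset Strict Implicit.
Unset Printing Implicit Defensive.

Import Order.TTheory GRing.Theory Num.Theory.
Import numFieldNormedType.Exports.

Local Open Scope classical_set_scope.
Local Open Scope ring_scope.
Local Open Scope complex_scope.

(* Write [c = k^2] with [Re k, Im k > 0].  The complement of the translated sector
   is the union of the half-planes [Im z <= delta Im k] and
   [Im (conj (k^2) z) >= delta Im (conj (k^2) k)], on which the resolvent has to be
   bounded uniformly; the numerical range of [H] is too large for this.
   The factorization [H = B A + k], [A B = H + k] with [A = d/dx + k x] and
   [B = - d/dx + k x] gives [A (H - z) = (H + 2 k - z) A], so that [(H - z) u = h]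
   amounts to [(H + 2 k - z) v = A h] for [v = A u], with
   [u = (h - B v) / (k - z)].  The shift by [2 k] moves [z] to a half-plane where
   [H] is coercive: Lax-Milgram yields [v], and testing its equation against [v]
   gives [|B v| <= C (1 + |2 k - z|) |h|] with [C] independent of [z].  The division
   by [k - z], whose modulus is at least [(1 - delta) Im k], absorbs the factor
   [1 + |2 k - z|]. *)

(** The point [k] is the ground state eigenvalue of [H], with eigenfunction [exp (- k x^2 / 2)]
    killed by [A]. It lies on both boundary lines when [delta = 1]; coercivity of the shifted
    problem persists up to [delta = 2], so the bound [delta < 1] enters only through the division by
    [k - z]. [B v] is controlled through the energy [S = |v'|^2 + |k|^2 |x v|^2]. Testing the
    equation of [v] against [v] gives a complex number [E] with [|E|^2 <= 4 |h|^2 S], and the real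
    and imaginary parts of [E] give [S <= L |E|] with [L] affine in [|2 k - z|]. Eliminating [|E|]
    leaves [S <= 4 |h|^2 L^2]. [A h] is only a functional on the form domain, and [u] is a priori
    only in [L^2]. Placing [u] in the form domain is a regularity argument: its weak equation
    [A u = v] is read on an absolutely continuous representative, for which [x u] is shown to be
    square integrable. Injectivity does not come from the factorization: it follows from
    solvability, because the form is symmetric under [(f, g) -> (conj g, conj f)]. *)

(** * Riesz and Lax-Milgram theorems in a semi-inner product space *)

Section SemiInnerProduct.
Context {R : realType} {T : Type}.
(* [comb a u v] plays the role of [a * u + v]. *)
Context (D : T -> Prop) (comb : R -> T -> T -> T).

Definition semilinear_on (l : T -> R) : Prop :=
  forall a u v, D u -> D v -> l (comb a u v) = a * l u + l v.

(** Definiteness is not asked for: functions are not quotiented by almost everywhere equality, so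
    nonzero vectors may have length zero. *)
Definition semi_inner (ip : T -> T -> R) : Prop :=
  [/\ forall u v, D u -> D v -> ip u v = ip v u,
      forall g, D g -> semilinear_on (ip^~ g)
    & forall u, D u -> 0 <= ip u u].

Definition sqdist (ip : T -> T -> R) u v := ip (comb (-1) v u) (comb (-1) v u).

(** Only sequences with a geometric rate are considered. Minimizing sequences can be chosen with
    such a rate, and it makes differences of successive terms summable in the Riesz-Fischer
    argument. *)
Definition rapidly_complete (ip : T -> T -> R) : Prop :=
  forall (u : nat -> T) (C : R), (forall n, D (u n)) ->
    (forall n m, (n <= m)%N -> sqdist ip (u n) (u m) <= C * (1 / 2) ^+ n) ->
    exists v C', D v /\ forall n, sqdist ip (u n) v <= C' * (1 / 2) ^+ n.

Hypothesis combD : forall a u v, D u -> D v -> D (comb a u v).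

Section Theory.
Variable ip : T -> T -> R.
Hypothesis ipP : semi_inner ip.

Lemma ip_linear_r u : D u -> semilinear_on (ip u).
Proof.
case: ipP => ipC ipl _ Du a v w Dv Dw.
rewrite ipC// ?ipl// ?(ipC u)//; exact: combD.
Qed.

Lemma ip_comb a u v : D u -> D v ->
  ip (comb a u v) (comb a u v) = a ^+ 2 * ip u u + 2 * a * ip u v + ip v v.
Proof.
case: (ipP) => ipC ipl _ Du Dv; rewrite ipl ?ip_linear_r//; last exact: combD.
by rewrite (ipC v u)//; ring.
Qed.

Lemma cauchy_schwarz u v : D u -> D v -> ip u v ^+ 2 <= ip u u * ip v v.
Proof.
move=> Du Dv; case: (ipP) => ipC ipl ip0.
have key a : 0 <= a ^+ 2 * ip u u + 2 * a * ip u v + ip v v.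
  by rewrite -ip_comb//; apply/ip0/combD.
have := ip0 _ Du; rewrite le_eqVlt => /orP[/eqP u0|u0].
  rewrite -u0 mul0r; have [->|nz] := eqVneq (ip u v) 0; first by rewrite expr0n.
  (* When [ip u u = 0] the quadratic is affine in [a]; this value of [a] makes it equal to [-1]. *)
  have := key (- (ip v v + 1) / (2 * ip u v)); rewrite -u0 mulr0 add0r.
  have -> : 2 * (- (ip v v + 1) / (2 * ip u v)) * ip u v = - (ip v v + 1).
    by field.
  lra.
have := key (- ip u v / ip u u).
have -> : (- ip u v / ip u u) ^+ 2 * ip u u + 2 * (- ip u v / ip u u) * ip u v
  + ip v v = (ip u u * ip v v - ip u v ^+ 2) / ip u u.
  by field; rewrite gt_eqF.
by rewrite pmulr_lge0 ?invr_gt0// subr_ge0.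
Qed.

Hypothesis ip_complete : rapidly_complete ip.

(** The representing vector is the limit of a minimizing sequence of [J v = ip v v - 2 l v]; the
    equation is the first-order condition for the minimum. *)
Lemma riesz (u0 : T) (Du0 : D u0) (l : T -> R) (K : R) : 0 <= K ->
  semilinear_on l -> (forall g, D g -> l g ^+ 2 <= K * ip g g) ->
  exists2 v, D v & forall g, D g -> ip v g = l g.
Proof.
move=> K0 ll lK; case: (ipP) => ipC ipl ip0.
pose J v := ip v v - 2 * l v.
have J_ge v : D v -> - K <= J v.
  move=> Dv; rewrite /J.
  have : 2 * l v <= K + ip v v.
    have := lK _ Dv; have := ip0 _ Dv.
    move: (l v) (ip v v) => a b b0 ab.
    have [a0|a0] := leP a 0; first by lra.
    rewrite leNgt; apply/negP => ab'.
    have : (K + b) ^+ 2 < (2 * a) ^+ 2 by rewrite ltr_pXn2r// ?nnegrE; lra.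
    have : 0 <= (K - b) ^+ 2 by exact: sqr_ge0.
    by nra.
  lra.
pose S := [set J v | v in D].
have hS : has_inf S.
  split; first by exists (J u0), u0.
  by exists (- K) => _ [v Dv <-]; exact: J_ge.
pose d := inf S.
have J_d v : D v -> d <= J v by move=> Dv; apply: ge_inf => //; [exact: hS.2|exists v].
have /choice [u uP] : forall n, exists v, D v /\ J v < d + (1 / 2) ^+ n.
  move=> n; have e0 : 0 < (1 / 2 : R) ^+ n by rewrite exprn_gt0//; lra.
  by have [_ [v Dv <-] vP] := inf_adherent e0 hS; exists v.
have Du n : D (u n) by have [] := uP n.
have mono n m : (n <= m)%N -> (1 / 2 : R) ^+ m <= (1 / 2) ^+ n.
  by move=> nm; apply: ler_wiXn2l => //; lra.
have [|v [C' [Dv vP]]] := ip_complete (C := 4) Du.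
  (* [w] is the midpoint of [u n] and [u m]. By the parallelogram law the squared distance is
     [2 J (u n) + 2 J (u m) - 4 J w], at most [2 (1/2)^n + 2 (1/2)^m], whence the constant 4. *)
  move=> n m /mono nm; pose w := comb (1 / 2) (comb (-1) (u n) (u m)) (u n).
  have Dd : D (comb (-1) (u n) (u m)) by exact: combD.
  have Jw : d <= J w by apply: J_d; exact: combD.
  have q : sqdist ip (u n) (u m) = sqdist ip (u m) (u n).
    by rewrite /sqdist !ip_comb// (ipC (u n) (u m))//; ring.
  move: Jw; rewrite q /J /w ip_comb// ip_comb// !ll// ipl// (ipC (u m) (u n))//.
  have [_] := uP n; have [_] := uP m.
  by rewrite /J /sqdist !ip_comb//; lra.
exists v => // g Dg.
have C'0 : 0 <= C'.
  have := vP 0%N; rewrite expr0 mulr1; apply: le_trans.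
  by apply: ip0; exact: combD.
(* The variation is performed at [u N], where [J] is within [(1/2)^N] of its infimum; Cauchy-Schwarz
   then replaces [u N] by [v] in the cross term. The error [e] is removed in [key]. *)
have small t e : 0 < e -> - e <= 2 * t * (ip v g - l g) + t ^+ 2 * ip g g.
  move=> e0.
  have cvg : (C' * ip g g * 4 * t ^+ 2 + e + 1) * (1 / 2 : R) ^+ n @[n --> \oo] --> (0 : R).
    rewrite -(mulr0 (C' * ip g g * 4 * t ^+ 2 + e + 1)); apply: cvgMr.
    by apply: cvg_expr; rewrite ger0_norm; lra.
  have e20 : 0 < Num.min (e / 2) ((e / 2) ^+ 2).
    by rewrite lt_min exprn_gt0 ?andbT; lra.
  have /cvgrPdist_lt /(_ _ e20) [N _ /(_ N (leqnn N))] := cvg.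
  have gg := ip0 _ Dg.
  have h0 : 0 < (1 / 2 : R) ^+ N by rewrite exprn_gt0//; lra.
  have t0 : 0 <= C' * ip g g * t ^+ 2 by apply: mulr_ge0; [exact: mulr_ge0|exact: sqr_ge0].
  rewrite sub0r normrN ger0_norm; last by apply: mulr_ge0; lra.
  rewrite lt_min => /andP[hN1 hN2].
  have J_N : d <= J (comb t g (u N)) by apply/J_d/combD.
  have [_ uN] := uP N.
  move: J_N; rewrite /J ip_comb// ll// (ipC g (u N))// => J_N.
  have CS : ip (comb (-1) v (u N)) g ^+ 2 <= C' * (1 / 2) ^+ N * ip g g.
    apply: (le_trans (cauchy_schwarz _ Dg)); first exact: combD.
    by apply: ler_wpM2r => //; exact: vP.
  move: CS; rewrite ipl// => CS.
  have : 2 * t * (- (ip v g) + ip (u N) g) <= e / 2.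
    rewrite leNgt; apply/negP => h.
    have : (e / 2) ^+ 2 < (2 * t * (- (ip v g) + ip (u N) g)) ^+ 2.
      by rewrite ltr_pXn2r// ?nnegrE; lra.
    have : t ^+ 2 * (-1 * ip v g + ip (u N) g) ^+ 2 <= t ^+ 2 * (C' * (1 / 2) ^+ N * ip g g).
      by apply: ler_wpM2l => //; exact: sqr_ge0.
    have : 0 <= (e + 1) * (1 / 2 : R) ^+ N by apply: mulr_ge0; lra.
    move: hN2; move: ((1 / 2) ^+ N) => hh.
    by move: (ip v g) (ip (u N) g) => x1 x2; nra.
  have : (1 / 2 : R) ^+ N <= e / 2.
    apply: ltW; apply: le_lt_trans hN1; rewrite -[leLHS]mul1r.
    by apply: ler_wpM2r; lra.
  move: uN; rewrite /J; lra.
have key t : 0 <= 2 * t * (ip v g - l g) + t ^+ 2 * ip g g.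
  rewrite leNgt; apply/negP => h.
  have := small t (- (2 * t * (ip v g - l g) + t ^+ 2 * ip g g) / 2); lra.
apply/eqP; rewrite -subr_eq0; apply/eqP.
have gg := ip0 _ Dg.
move: (ip v g - l g) key => x key.
have k1 : 0 < ip g g + 1 by lra.
(* Nearly the optimal [t]; adding 1 to the denominator covers the case [ip g g = 0]. *)
have := key (- x / (ip g g + 1)).
have -> : 2 * (- x / (ip g g + 1)) * x + (- x / (ip g g + 1)) ^+ 2 * ip g g =
   - x ^+ 2 * ((ip g g + 2) / (ip g g + 1) ^+ 2) by field; rewrite gt_eqF.
rewrite mulNr oppr_ge0 pmulr_lle0 ?divr_gt0 ?exprn_gt0//; last lra.
by move=> x0; apply/eqP; rewrite -sqrf_eq0 eq_le x0 sqr_ge0.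
Qed.

End Theory.

(* With [ip (Tr u) g = b u g], Riesz for the equivalent inner product
   [ip (Tr u) (Tr v)] solves the least-squares problem for [Tr v = f]; its
   residual is orthogonal to the range of [Tr], hence null by coercivity. *)
Lemma lax_milgram (ip b : T -> T -> R) (l : T -> R) (K M alpha : R) (u0 : T) :
  semi_inner ip -> rapidly_complete ip -> D u0 ->
  0 < alpha -> 0 <= K -> 0 <= M ->
  (forall u, D u -> semilinear_on (b u)) ->
  (forall g, D g -> semilinear_on (b^~ g)) ->
  (forall u g, D u -> D g -> b u g ^+ 2 <= M * (ip u u * ip g g)) ->
  (forall u, D u -> alpha * ip u u <= b u u) ->
  semilinear_on l -> (forall g, D g -> l g ^+ 2 <= K * ip g g) ->
  exists2 v, D v & forall g, D g -> b v g = l g.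
Proof.
move=> ipP ipcmpl Du0 a0 K0 M0 br bl bM coer ll lK.
have [ipC ipl ip0] := ipP.
(* The default [u0] outside [D] makes the relation total, as [choice] requires. *)
have TrP u : exists w, D w /\ (D u -> forall g, D g -> ip w g = b u g).
  have [Du|nDu] := pselect (D u); last by exists u0; split.
  have [||g Dg|w Dw wP] := riesz ipP ipcmpl Du0 (l := b u) (K := M * ip u u).
  - by rewrite mulr_ge0// ip0.
  - exact: br.
  - by rewrite -mulrA; exact: bM.
  - by exists w.
have /choice [Tr TrE] := TrP.
have DT u : D (Tr u) by have [] := TrE u.
have TE u g : D u -> D g -> ip (Tr u) g = b u g.
  by move=> Du Dg; have [_ /(_ Du)] := TrE u; apply.
have [f Df fP] := riesz ipP ipcmpl Du0 K0 ll lK.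
pose s u v := ip (Tr u) (Tr v).
(* [Tr] is chosen pointwise and is linear only up to null vectors; [s] inherits its linearity from
   [b]. *)
have sE u v : D u -> D v -> s u v = b u (Tr v) by move=> Du Dv; rewrite /s TE.
have sP : semi_inner s.
  split.
  - by move=> u v Du Dv; rewrite /s ipC.
  - by move=> g Dg a u v Du Dv; rewrite !sE//; [exact: bl|exact: combD].
  - by move=> u Du; exact: ip0.
have s_ge u : D u -> alpha ^+ 2 * ip u u <= s u u.
  move=> Du; have CS := cauchy_schwarz ipP (DT u) Du.
  rewrite TE// -/(s u u) in CS.
  have [->|nz] := eqVneq (ip u u) 0; first by rewrite mulr0; apply: ip0.
  have pos : 0 < ip u u by rewrite lt_neqAle eq_sym nz ip0.
  rewrite -(ler_pM2r pos); apply: le_trans CS.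
  rewrite -mulrA -expr2 -exprMn ler_pXn2r ?nnegrE//; first exact: coer.
    by rewrite mulr_ge0// ltW.
  by apply: le_trans (coer _ Du); rewrite mulr_ge0// ltW.
have s_le u : D u -> s u u <= M * ip u u.
  move=> Du; have := bM u (Tr u) Du (DT u); rewrite -sE// -/(s u u).
  have [->|nz] := eqVneq (s u u) 0; first by rewrite mulr_ge0// ip0.
  have pos : 0 < s u u by rewrite lt_neqAle eq_sym nz; have [_ _ ->] := sP.
  by rewrite expr2 mulrA ler_pM2r.
have scmpl : rapidly_complete s.
  move=> u C Du uC; have [|v [C' [Dv vP]]] := ipcmpl u (C / alpha ^+ 2) Du.
    move=> n m /uC sC; rewrite (mulrAC C) ler_pdivlMr ?exprn_gt0// mulrC.
    by apply: (le_trans (s_ge (comb (-1) (u m) (u n)) _)) => //; exact: combD.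
  exists v, (M * C'); split => // n.
  apply: (le_trans (s_le (comb (-1) v (u n)) _)); first exact: combD.
  by rewrite -mulrA; apply: ler_wpM2l => //; exact: vP.
have [|||v Dv vP] := @riesz s sP scmpl u0 Du0 (fun g => ip f (Tr g)) (ip f f).
- exact: ip0.
- by move=> a u v Du Dv; rewrite !(ipC f)// !TE//; [exact: bl|exact: combD].
- by move=> g Dg; exact: cauchy_schwarz.
exists v => // g Dg; pose w := comb (-1) f (Tr v).
have Dw : D w by exact: combD.
have wT k : D k -> ip w (Tr k) = 0.
  by move=> Dk; rewrite ipl// -vP// /s; lra.
have w0 : ip w w = 0.
  apply: le_anti; rewrite ip0// andbT -(ler_pM2l a0) mulr0.
  by apply: (le_trans (coer _ Dw)); rewrite -TE// ipC// wT.
rewrite -TE// -fP//; apply/eqP; rewrite -subr_eq0 -sqrf_eq0 eq_le sqr_ge0 andbT.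
have := cauchy_schwarz ipP Dw Dg; rewrite w0 mul0r ipl//.
by congr (_ ^+ 2 <= 0); lra.
Qed.
End SemiInnerProduct.

(** * A smooth step function *)

Section SmoothFunctions.
Context {R : realType}.
Implicit Types (f g h : R -> R) (x a b : R) (n k : nat).

Definition has_derivative f g : Prop := forall x, is_derive x 1 f (g x).

Lemma has_derivative_derive1 f g : has_derivative f g -> derive1 f = g.
Proof. by move=> fg; apply/funext => x; rewrite derive1E; case: (fg x). Qed.

Lemma has_derivative_continuous f g : has_derivative f g -> continuous f.
Proof.
move=> fg x; apply/differentiable_continuous/derivable1_diffP.
by case: (fg x).
Qed.

Lemma has_derivative_comp f g df dg : has_derivative f df ->
  has_derivative g dg -> has_derivative (g \o f) (fun x => dg (f x) * df x).
Proof.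
move=> fP gP x; have dfx : derivable f x 1 by case: (fP x).
have dgx : derivable g (f x) 1 by case: (gP (f x)).
apply: DeriveDef.
  by apply/derivable1_diffP/differentiable_comp; exact/derivable1_diffP.
by rewrite -derive1E derive1_comp// (has_derivative_derive1 fP)
  (has_derivative_derive1 gP).
Qed.

(** Derivatives are carried as witnesses, so that closure under products and inverses is an
    induction with no computation of [derive1n]; [smoothP] converts at the end. *)
Fixpoint differentiable_n n f : Prop :=
  if n is n'.+1 then exists g, has_derivative f g /\ differentiable_n n' g
  else True.

Definition smooth f : Prop := forall n, differentiable_n n f.

Lemma differentiable_nW n f : differentiable_n n.+1 f -> differentiable_n n f.
Proof.
elim: n f => [//|n ih] f [g [fg gn]].
by exists g; split => //; exact: ih.
Qed.

Lemma differentiable_n_cst n a : differentiable_n n (cst a).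
Proof.
elim: n a => //= n ih a; exists (cst 0); split; last exact: ih.
by move=> x; exact: is_derive_cst.
Qed.

Lemma differentiable_nD n f g : differentiable_n n f -> differentiable_n n g ->
  differentiable_n n (f \+ g).
Proof.
elim: n f g => //= n ih f g [df [fdf dfn]] [dg [gdg dgn]].
by exists (df \+ dg); split; [move=> x; exact: is_deriveD|exact: ih].
Qed.

Lemma differentiable_nM n f g : differentiable_n n f -> differentiable_n n g ->
  differentiable_n n (f \* g).
Proof.
elim: n f g => // n ih f g fn gn.
have fn' := differentiable_nW fn; have gn' := differentiable_nW gn.
case: fn => df [fdf dfn]; case: gn => dg [gdg dgn].
exists ((f \* dg) \+ (g \* df)); split.
  move=> x; have fx := fdf x; have gx := gdg x.
  by apply: is_derive_eq; rewrite /= /GRing.scale /=.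
by apply: differentiable_nD; exact: ih.
Qed.

Lemma differentiable_nV n f : (forall x, f x != 0) -> differentiable_n n f ->
  differentiable_n n (fun x => (f x)^-1).
Proof.
move=> f0; elim: n => // n ih fn.
have fn' := ih (differentiable_nW fn); case: fn => df [fdf dfn].
exists ((cst (-1) \* df) \* ((fun x => (f x)^-1) \* (fun x => (f x)^-1))); split.
  move=> x; have [dfx dfE] := fdf x; apply: DeriveDef; first exact: derivableV.
  by rewrite deriveV// dfE /GRing.scale /= expr2 invfM; ring.
by do ![apply: differentiable_nM => //]; exact: differentiable_n_cst.
Qed.

Lemma differentiable_n_affine n f a b : differentiable_n n f ->
  differentiable_n n (fun x => f (a * x + b)).
Proof.
elim: n f => //= n ih f [df [fdf dfn]].
exists ((fun x => df (a * x + b)) \* cst a); split; last first.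
  by apply: differentiable_nM; [exact: ih|exact: differentiable_n_cst].
apply: (has_derivative_comp _ fdf) => x.
have -> : (fun x => a * x + b) = (a \*: idfun) \+ cst b by apply/funext.
apply: is_derive_eq; rewrite addr0 /GRing.scale /=; exact: mulr1.
Qed.

Lemma smoothP f : smooth f -> forall n x, derivable (derive1n n f) x 1.
Proof.
move=> sf n x; have := sf n.+1; elim: n f {sf} => [|n ih] f [g [fg gn]].
  by rewrite derive1n0; case: (fg x).
by rewrite derive1Sn (has_derivative_derive1 fg); exact: ih.
Qed.

(** The powers of [x^-1] in front of [exp (- 1 / x)] make the family closed under differentiation,
    so that smoothness of all its members is one induction. *)
Definition flat k x : R := if 0 < x then x^-1 ^+ k * expR (- x^-1) else 0.

(** One term of the exponential series at [x^-1] suffices. The quadratic bound makes the difference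
    quotient at 0 tend to 0. *)
Lemma flat_le k x : `|flat k x| <= (k.+2)`!%:R * x ^+ 2.
Proof.
rewrite /flat; case: ifPn => [x0|_]; last first.
  by rewrite normr0 mulr_ge0// ?sqr_ge0// ler0n.
have xv0 : 0 < x^-1 by rewrite invr_gt0.
rewrite ger0_norm; last by rewrite mulr_ge0 ?expR_ge0// exprn_ge0// ltW.
rewrite expRN ler_pdivrMr ?expR_gt0//.
have := expR_ge1Dxn k.+1 (ltW xv0) => h.
have F0 : 0 < (k.+2)`!%:R :> R by rewrite ltr0n fact_gt0.
have : x^-1 ^+ k.+2 / (k.+2)`!%:R <= expR x^-1 by apply: le_trans h; rewrite lerDr.
rewrite ler_pdivrMr// => h2.
have -> : x^-1 ^+ k = x ^+ 2 * x^-1 ^+ k.+2.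
  by rewrite -(addn2 k) exprD mulrCA -exprMn mulfV ?gt_eqF// expr1n mulr1.
by rewrite [leRHS]mulrAC mulrC ler_pM2r ?exprn_gt0// mulrC.
Qed.

Lemma flat_deriv k : has_derivative (flat k) (fun x => flat k.+2 x - k%:R * flat k.+1 x).
Proof.
move=> x; have [x0|x0|->] := ltgtP x 0.
- rewrite /flat ltNge (ltW x0)/= mulr0 subr0.
  apply: (near_eq_is_derive (f := cst 0)).
  near=> y; rewrite ltNge ltW//=; near: y; exact: lt_nbhsl.
- rewrite /flat x0.
  apply: (near_eq_is_derive (f := fun x => x^-1 ^+ k * expR (- x^-1))).
    near=> y; suff -> : 0 < y by []. near: y; exact: lt_nbhsr.
  have dV : is_derive x 1 (fun y : R => y^-1) (- x^-1 ^+ 2).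
    apply: DeriveDef; first by apply: derivableV => //=; exact: lt0r_neq0.
    rewrite (@deriveV R R id)// ?gt_eqF// derive_id /GRing.scale /=.
    by rewrite mulr1 exprVn.
  have dN : is_derive x 1 (fun y : R => - y^-1) (x^-1 ^+ 2).
    by rewrite -[_ ^+ 2]opprK; exact: is_deriveN.
  have dE : is_derive x 1 (fun y : R => expR (- y^-1)) (expR (- x^-1) * x^-1 ^+ 2).
    have dx : derivable (fun y : R => - y^-1) x 1 by case: dN.
    apply: DeriveDef.
      apply/derivable1_diffP.
      apply: (@differentiable_comp _ _ _ _ (fun y : R => - y^-1) expR).
        exact/derivable1_diffP.
      exact/derivable1_diffP/derivable_expR.
    rewrite -derive1E (@derive1_comp _ (fun y : R => - y^-1) expR)//.
    by rewrite !derive1E; case: dN => _ ->; case: (is_derive_expR (- x^-1)) => _ ->.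
  have dP := is_deriveX k dV.
  have := is_deriveM dP dE.
  rewrite !exprfctE /GRing.scale /= => h; apply: (is_derive_eq h).
  rewrite -mulr_natl; case: (k) => [|j] /=; first by rewrite !expr0 !exprS; ring.
  by rewrite !exprS; ring.
- rewrite {2 3}/flat ltxx mulr0 subr0.
  have cv : h^-1 *: ((flat k \o shift 0) (h *: 1) - flat k 0) @[h --> 0^'] --> (0 : R).
    rewrite {2}/flat ltxx.
    apply/cvgrPdist_le => /= e e0; near=> t.
    rewrite sub0r normrN subr0 /GRing.scale /= mulr1 addr0 normrM normfV.
    have t0 : t != 0 by near: t; exact: nbhs_dnbhs_neq.
    rewrite ler_pdivrMl ?normr_gt0//; apply: (le_trans (flat_le _ _)).
    rewrite -real_normK ?num_real// expr2 mulrA mulrC ler_pM2l ?normr_gt0//.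
    rewrite mulrC -ler_pdivlMr ?ltr0n ?fact_gt0//.
    near: t; apply: dnbhs0_le; rewrite divr_gt0// ltr0n fact_gt0//.
  apply: DeriveDef; first by apply/cvg_ex; exists 0.
  exact/cvg_lim.
Unshelve. all: by end_near. Qed.

Lemma flat_smooth k : smooth (flat k).
Proof.
move=> n; elim: n k => // n ih k.
exists (flat k.+2 \+ (cst (- k%:R) \* flat k.+1)); split.
  by move=> x; have := flat_deriv k x; rewrite -mulNr.
by apply: differentiable_nD => //; apply: differentiable_nM => //;
  exact: differentiable_n_cst.
Qed.

(** The denominator never vanishes, since [x] and [1 - x] cannot both be nonpositive. *)
Definition smooth_step x : R := flat 0 x / (flat 0 x + flat 0 (1 - x)).

Lemma flat_ge0 x : 0 <= flat 0 x.
Proof. by rewrite /flat; case: ifP => // _; rewrite mul1r expR_ge0. Qed.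

Lemma smooth_step_den_gt0 x : 0 < flat 0 x + flat 0 (1 - x).
Proof.
have [x0|x0] := ltP 0 x.
  apply: ltr_wpDr; first exact: flat_ge0.
  by rewrite /flat x0 mul1r expR_gt0.
apply: ltr_wpDl; first exact: flat_ge0.
by rewrite /flat ifT ?mul1r ?expR_gt0//; lra.
Qed.

Lemma smooth_step_smooth : smooth smooth_step.
Proof.
move=> n; apply: (@differentiable_nM n (flat 0)); first exact: flat_smooth.
apply: differentiable_nV => [x|]; first by rewrite gt_eqF// smooth_step_den_gt0.
apply: differentiable_nD; first exact: flat_smooth.
have -> : (fun x => flat 0 (1 - x)) = (fun x => flat 0 (-1 * x + 1)).
  by apply/funext => x; rewrite mulN1r addrC.
exact/differentiable_n_affine/flat_smooth.
Qed.

Lemma smooth_step_ge0 x : 0 <= smooth_step x.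
Proof. by rewrite divr_ge0 ?flat_ge0 ?ltW ?smooth_step_den_gt0. Qed.

Lemma smooth_step_le1 x : smooth_step x <= 1.
Proof. by rewrite ler_pdivrMr ?smooth_step_den_gt0// mul1r lerDl flat_ge0. Qed.

Lemma smooth_step_eq0 x : x <= 0 -> smooth_step x = 0.
Proof. by move=> x0; rewrite /smooth_step {1}/flat ltNge x0 /= mul0r. Qed.

Lemma smooth_step_eq1 x : 1 <= x -> smooth_step x = 1.
Proof.
move=> x1; have := smooth_step_den_gt0 x; rewrite /smooth_step.
have -> : flat 0 (1 - x) = 0 by rewrite /flat ifF//; apply/negbTE; rewrite -leNgt; lra.
by rewrite addr0 => x0; rewrite mulfV// gt_eqF.
Qed.

End SmoothFunctions.

(** * Absolutely continuous functions *)

Section RealValuedIntegrable.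
Context d (T : measurableType d) (R : realType) (mu : {measure set T -> \bar R}).
Context (D : set T) (mD : measurable D).
Implicit Types (f g : T -> R).

Lemma rintegrableD f g : mu.-integrable D (EFin \o f) ->
  mu.-integrable D (EFin \o g) -> mu.-integrable D (EFin \o (fun x => f x + g x)).
Proof. by move=> fi gi; exact: (integrableD mD fi gi). Qed.

Lemma rintegrableZ f k : mu.-integrable D (EFin \o f) ->
  mu.-integrable D (EFin \o (fun x => k * f x)).
Proof. by move=> fi; exact: (integrableZl mD k fi). Qed.

Lemma rintegrableB f g : mu.-integrable D (EFin \o f) ->
  mu.-integrable D (EFin \o g) -> mu.-integrable D (EFin \o (fun x => f x - g x)).
Proof. by move=> fi gi; exact: (integrableB mD fi gi). Qed.

Lemma rintegrable_le f g : measurable_fun D f ->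
  mu.-integrable D (EFin \o g) -> (forall x, D x -> `|f x| <= g x) ->
  mu.-integrable D (EFin \o f).
Proof.
move=> mf gi fg; apply: (le_integrable mD _ _ gi).
  exact/measurable_EFinP.
by move=> x Dx; rewrite /= lee_fin; apply: (le_trans (fg _ Dx)); exact: ler_norm.
Qed.

End RealValuedIntegrable.

Section AbsoluteContinuity.
Context {R : realType}.
Local Notation mu := (@lebesgue_measure R).
Implicit Types (f g h : R -> R) (a b c x y : R).

Lemma Rintegral_itv_cat f a b c : a <= b -> b <= c ->
  mu.-integrable `[a, c] (EFin \o f) ->
  \int[mu]_(x in `[a, c]) f x = \int[mu]_(x in `[a, b]) f x + \int[mu]_(x in `[b, c]) f x.
Proof.
move=> ab bc fi; have := @Rintegral_itvB _ f (BLeft a) (BRight c) b fi.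
rewrite !bnd_simp => /(_ ab bc) /eqP; rewrite subr_eq addrC => /eqP ->.
congr (_ + _); apply: Rintegral_itv_obnd_cbnd.
by apply: integrableS fi => //; apply: subset_itvr; rewrite bnd_simp.
Qed.

Definition locally_summable g : Prop :=
  measurable_fun setT g /\ forall a b, mu.-integrable `[a, b] (EFin \o g).

Lemma locally_summableD f g : locally_summable f -> locally_summable g ->
  locally_summable (fun x => f x + g x).
Proof.
move=> [mf fi] [mg gi]; split; first exact: measurable_funD.
by move=> a b; exact: rintegrableD.
Qed.

Lemma locally_summableZ k f : locally_summable f ->
  locally_summable (fun x => k * f x).
Proof.
move=> [mf fi]; split; first exact: measurable_funM.
by move=> a b; exact: rintegrableZ.
Qed.

Lemma locally_summable_abs f : locally_summable f ->
  locally_summable (fun x => `|f x|).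
Proof.
move=> [mf fi]; split; first exact: measurableT_comp.
by move=> a b; exact: integrable_norm.
Qed.

Lemma continuous_bounded_itv f a b : continuous f ->
  exists M, forall x, x \in `[a, b] -> `|f x| <= M.
Proof.
move=> cf; have [ab|ab] := leP a b; last first.
  exists 0 => x; rewrite in_itv/= => /andP[ax xb]; lra.
have cn : {within `[a, b], continuous (fun x => `|f x|)}.
  apply: continuous_subspaceT => x.
  by apply: (@continuous_comp _ _ _ f Num.norm); [exact: cf|exact: norm_continuous].
by have [c cab cM] := EVT_max ab cn; exists `|f c|.
Qed.

Lemma locally_summableM f g : continuous f -> locally_summable g ->
  locally_summable (fun x => f x * g x).
Proof.
move=> cf [mg gi]; have mf : measurable_fun setT f by exact: continuous_measurable_fun.
split; first exact: measurable_funM.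
move=> a b; have [M MP] := continuous_bounded_itv a b cf.
apply: (@rintegrable_le _ _ _ mu `[a, b] (measurable_itv _) _ (fun x => M * `|g x|)).
- by apply: measurable_funTS; exact: measurable_funM.
- by apply: rintegrableZ => //; exact: integrable_norm.
- by move=> x /MP fM; rewrite normrM ler_wpM2r.
Qed.

Lemma continuous_locally_summable f : continuous f -> locally_summable f.
Proof.
move=> cf; split; first exact: continuous_measurable_fun.
move=> a b; apply: continuous_compact_integrable; first exact: segment_compact.
exact: continuous_subspaceT.
Qed.

(* Absolute continuity with almost everywhere derivative [g]. *)
Definition AC f g : Prop := locally_summable g /\
  forall a b, a <= b -> f b - f a = \int[mu]_(x in `[a, b]) g x.

Lemma AC_continuous f g : AC f g -> continuous f.
Proof.
move=> [[mg gi] fg] x.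
have lt1 : x - 1 <= x + 1 by lra.
have := parameterized_integral_continuous lt1 (gi (x - 1) (x + 1)).
have xin : x \in `]x - 1, x + 1[ by rewrite in_itv/=; apply/andP; split; lra.
rewrite (@continuous_within_itvP) => [[cx _ _]|]; last by lra.
have : {for x, continuous (fun y => f (x - 1) + parameterized_integral mu (x - 1) y g)}.
  by apply: continuousD; [exact: cst_continuous|exact: cx].
rewrite /continuous_at /prop_for /=.
have E y : x - 1 <= y -> f (x - 1) + parameterized_integral mu (x - 1) y g = f y.
  by move=> xy; rewrite /parameterized_integral -fg// addrC subrK.
rewrite E; last by lra.
apply: cvg_trans; apply: near_eq_cvg; near=> y; rewrite ?E//=;
by near: y; apply: lt_le_nbhsr; lra.
Unshelve. all: by end_near. Qed.

Definition primitive g a x : R :=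
  if a <= x then \int[mu]_(t in `[a, x]) g t else - \int[mu]_(t in `[x, a]) g t.

Lemma AC_primitive g a : locally_summable g -> AC (primitive g a) g.
Proof.
move=> lg; split => // x y xy; have [mg gi] := lg; rewrite /primitive.
case: (leP a x) => ax; case: (leP a y) => ay.
- by rewrite (@Rintegral_itv_cat g a x y)//; lra.
- lra.
- by rewrite (@Rintegral_itv_cat g x a y)//; lra.
- by rewrite (@Rintegral_itv_cat g x y a)//; lra.
Qed.

Lemma AC_le_abs f g a b : AC f g -> a <= b ->
  `|f b - f a| <= \int[mu]_(x in `[a, b]) `|g x|.
Proof. by move=> [[mg gi] fg] ab; rewrite fg//; exact: le_normr_Rintegral. Qed.

Lemma Rintegral_itvS_ge0 g a b c d : locally_summable g -> (forall x, 0 <= g x) ->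
  a <= c -> c <= d -> d <= b ->
  \int[mu]_(x in `[c, d]) g x <= \int[mu]_(x in `[a, b]) g x.
Proof.
move=> [mg gi] g0 ac cd db.
rewrite (@Rintegral_itv_cat g a c b)//; last lra.
rewrite (@Rintegral_itv_cat g c d b)//.
have := @Rintegral_ge0 _ _ _ mu `[a, c] g (fun x _ => g0 x).
have := @Rintegral_ge0 _ _ _ mu `[d, b] g (fun x _ => g0 x).
lra.
Qed.

(* With [k = |f'| + |g'|], the defect of the product rule over [[x, y]] is at
   most [(\int_[x, y] k) ^ 2]: halving the integral of [k] repeatedly shows
   that it vanishes. *)
Lemma ACM f f' g g' : AC f f' -> AC g g' ->
  AC (fun x => f x * g x) (fun x => f' x * g x + f x * g' x).
Proof.
move=> acf acg; have cf := AC_continuous acf; have cg := AC_continuous acg.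
have [lf ff'] := acf; have [lg gg'] := acg.
have lp : locally_summable (fun x => f' x * g x + f x * g' x).
  apply: locally_summableD; last exact: locally_summableM.
  have -> : (fun x => f' x * g x) = (fun x => g x * f' x).
    by apply/funext => x; rewrite mulrC.
  exact: locally_summableM.
split => // a b ab.
pose k x := `|f' x| + `|g' x|.
have lk : locally_summable k.
  by apply: locally_summableD; exact: locally_summable_abs.
have k0 x : 0 <= k x by rewrite addr_ge0.
pose psi := primitive k a.
have acpsi : AC psi k by exact: AC_primitive.
have cpsi := AC_continuous acpsi.
pose defect x y := f y * g y - f x * g x -
  \int[mu]_(t in `[x, y]) (f' t * g t + f t * g' t).
have ip x y := lp.2 x y.
have defect_cat x y z : x <= y -> y <= z -> defect x z = defect x y + defect y z.
  by move=> xy yz; rewrite /defect (@Rintegral_itv_cat _ x y z)//; ring.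
have small n : forall x y, x <= y -> `|defect x y| <= (psi y - psi x) ^+ 2 / 2 ^+ n.
  elim: n => [|n ih] x y xy.
    rewrite expr0 divr1 (acpsi.2 _ _ xy); set w := \int[mu]_(_ in _) _.
    have i1 : mu.-integrable `[x, y] (EFin \o (fun t => f' t * g y)).
      have := rintegrableZ (mu := mu) (measurable_itv _) (g y) (lf.2 x y).
      by congr (_.-integrable _ _); apply/funext => t /=; rewrite mulrC.
    have i2 := rintegrableZ (mu := mu) (measurable_itv _) (f x) (lg.2 x y).
    (* The constants [g y] and [f x] absorb the boundary terms, since [f y g y - f x g x = (f y - f
       x) g y + f x (g y - g x)]. The integrand is then a product of derivatives and increments,
       each increment being at most [w]. *)
    have -> : defect x y = \int[mu]_(t in `[x, y]) (f' t * (g y - g t) + g' t * (f x - f t)).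
      have -> : (fun t => f' t * (g y - g t) + g' t * (f x - f t)) =
        (fun t => (f' t * g y + f x * g' t) - (f' t * g t + f t * g' t)).
        by apply/funext => t; ring.
      rewrite RintegralB//; last exact: rintegrableD.
      rewrite RintegralD// RintegralZl//; last exact: lg.2.
      rewrite RintegralZr//; last exact: lf.2.
      by rewrite -ff'// -gg'// /defect; ring.
    have i3 : mu.-integrable `[x, y] (EFin \o (fun t => f' t * (g y - g t) + g' t * (f x - f t))).
      have := rintegrableB (mu := mu) (measurable_itv _)
        (rintegrableD (mu := mu) (measurable_itv _) i1 i2) (ip x y).
      by congr (_.-integrable _ _); apply/funext => t /=; congr EFin; ring.
    apply: (le_trans (le_normr_Rintegral _ _)) => //.
    have -> : w ^+ 2 = \int[mu]_(t in `[x, y]) (w * k t).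
      by rewrite RintegralZl//; exact: lk.2.
    apply: le_Rintegral => //.
    - exact: integrable_norm.
    - by apply: rintegrableZ => //; exact: lk.2.
    move=> t /=; rewrite in_itv/= => /andP[xt ty].
    apply: (le_trans (ler_normD _ _)); rewrite !normrM mulrDr.
    have w0 : 0 <= w by apply: Rintegral_ge0.
    have sub z1 z2 h h' : AC h h' -> (forall s, `|h' s| <= k s) ->
        x <= z1 -> z1 <= z2 -> z2 <= y -> `|h z2 - h z1| <= w.
      move=> ach hk xz1 z12 z2y; apply: (le_trans (AC_le_abs ach z12)).
      apply: (@le_trans _ _ (\int[mu]_(s in `[z1, z2]) k s)).
        apply: le_Rintegral => //; [|exact: lk.2].
        by apply: integrable_norm => //; exact: ach.1.2.
      exact: Rintegral_itvS_ge0.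
    apply: lerD; rewrite mulrC ler_wpM2r//.
      by apply: (sub t y g g') => // s; rewrite /k lerDr.
    by rewrite distrC; apply: (sub x t f f') => // s; rewrite /k lerDl.
  have psi_le : psi x <= psi y.
    by rewrite -subr_ge0 (acpsi.2 _ _ xy); apply: Rintegral_ge0.
  have [||z] := @IVT _ psi x y ((psi x + psi y) / 2) xy.
  - exact: continuous_subspaceT.
  - by rewrite ge_min le_max; apply/andP; split; apply/orP; [left|right]; lra.
  rewrite in_itv/= => /andP[xz zy] psiz.
  rewrite (defect_cat _ z)//; apply: (le_trans (ler_normD _ _)).
  apply: (le_trans (lerD (ih _ _ xz) (ih _ _ zy))).
  rewrite psiz (exprS 2 n) le_eqVlt; apply/orP; left; apply/eqP.
  by field; rewrite expf_neq0.
suff d0 : defect a b = 0.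
  by apply/eqP; rewrite -subr_eq0 -/(defect a b) d0.
apply/normr0_eq0/eqP; rewrite eq_le normr_ge0 andbT.
set P := (psi b - psi a) ^+ 2.
have cvg : P * (1 / 2 : R) ^+ n @[n --> \oo] --> (0 : R).
  rewrite -(mulr0 P); apply: cvgMr; apply: cvg_expr; rewrite ger0_norm; lra.
rewrite -(cvg_lim (@Rhausdorff R) cvg); apply: limr_ge; first by apply/cvg_ex; exists 0.
near=> n; apply: (le_trans (small n _ _ ab)).
by rewrite div1r exprVn.
Unshelve. all: by end_near. Qed.

End AbsoluteContinuity.

(** * Almost everywhere equality and dominated convergence for real integrals *)

Section RealDominatedConvergence.
Context d (T : measurableType d) (R : realType) (mu : {measure set T -> \bar R}).
Context (D : set T) (mD : measurable D).
Implicit Types (f g : T -> R).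

Lemma rintegrable_ae f g : measurable_fun D f -> measurable_fun D g ->
  {ae mu, forall x, f x = g x} ->
  mu.-integrable D (EFin \o f) -> mu.-integrable D (EFin \o g).
Proof.
move=> mf mg fg /integrableP[_ fi]; apply/integrableP; split.
  exact/measurable_EFinP.
apply: le_lt_trans fi; rewrite le_eqVlt; apply/orP; left; apply/eqP.
apply: ge0_ae_eq_integral => //.
- by apply: measurableT_comp => //; exact/measurable_EFinP.
- by apply: measurableT_comp => //; exact/measurable_EFinP.
- by apply: filterS fg => x /= -> _.
Qed.

Lemma Rintegral_ae f g : measurable_fun D f -> measurable_fun D g ->
  {ae mu, forall x, f x = g x} ->
  \int[mu]_(x in D) f x = \int[mu]_(x in D) g x.
Proof.
move=> mf mg fg; congr fine; apply: ae_eq_integral => //.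
- exact/measurable_EFinP.
- exact/measurable_EFinP.
- by apply: filterS fg => x /= -> _.
Qed.

Lemma Rdominated_cvg (f_ : nat -> T -> R) f g :
  (forall n, measurable_fun D (f_ n)) -> measurable_fun D f ->
  (forall x, D x -> f_ n x @[n --> \oo] --> f x) ->
  mu.-integrable D (EFin \o g) -> (forall n x, D x -> `|f_ n x| <= g x) ->
  mu.-integrable D (EFin \o f) /\
  \int[mu]_(x in D) f_ n x @[n --> \oo] --> \int[mu]_(x in D) f x.
Proof.
move=> mf_ mf cf gi fg.
have [||||fi _ cvg] := @dominated_convergence _ _ _ mu D mD
  (fun n => EFin \o f_ n) (EFin \o f) (EFin \o g) _ _ _ gi.
- by move=> n; exact/measurable_EFinP.
- exact/measurable_EFinP.
- by apply: aeW => x Dx; apply: cvg_EFin; [exact: nearW|exact: cf].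
- by apply: aeW => x n Dx; rewrite /= lee_fin; exact: fg.
split => //; apply: fine_cvg; rewrite fineK//.
exact: integrable_fin_num.
Qed.

Lemma rintegrable_patch f : mu.-integrable D (EFin \o f) ->
  mu.-integrable setT (EFin \o (f \_ D)).
Proof. by move=> fi; rewrite -restrict_EFin; exact: (integrable_mkcond _ mD).1. Qed.

Lemma rintegrable_restrict f : mu.-integrable setT (EFin \o f) ->
  mu.-integrable setT (EFin \o (f \_ D)).
Proof.
move=> fi; apply: rintegrable_patch.
exact: (integrableS measurableT mD (@subsetT _ D) fi).
Qed.

End RealDominatedConvergence.

(** * Calculus of absolutely continuous functions and integration by parts on the line *)

Section AbsoluteContinuityTheory.
Context {R : realType}.
Local Notation mu := (@lebesgue_measure R).
Implicit Types (f g h : R -> R) (a b c x y : R).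

Lemma ACD f f' g g' : AC f f' -> AC g g' ->
  AC (fun x => f x + g x) (fun x => f' x + g' x).
Proof.
move=> [lf ff'] [lg gg']; split; first exact: locally_summableD.
move=> a b ab; rewrite RintegralD//; [|exact: lf.2|exact: lg.2].
by rewrite -ff'// -gg'//; ring.
Qed.

Lemma ACZ k f f' : AC f f' -> AC (fun x => k * f x) (fun x => k * f' x).
Proof.
move=> [lf ff']; split; first exact: locally_summableZ.
move=> a b ab; rewrite RintegralZl//; last exact: lf.2.
by rewrite -ff'// mulrBr.
Qed.

Lemma AC_id : AC (fun x : R => x) (cst 1).
Proof.
split; first by apply: continuous_locally_summable => x; exact: cvg_cst.
move=> a b ab; rewrite Rintegral_cst//= lebesgue_measure_itv/= lte_fin.
case: ltP => h; first by rewrite mul1r.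
by rewrite mulr0; lra.
Qed.

Lemma AC_ae f g g' : AC f g -> measurable_fun setT g' ->
  {ae mu, forall x, g x = g' x} -> AC f g'.
Proof.
move=> [[mg gi] fg] mg' gg'; split; first split => //.
  move=> a b; apply: rintegrable_ae gg' (gi a b) => //; exact: measurable_funTS.
move=> a b ab; rewrite fg//.
by apply: Rintegral_ae gg' => //; exact: measurable_funTS.
Qed.

Lemma has_derivative_AC f g : has_derivative f g -> continuous g -> AC f g.
Proof.
move=> fg cg; split; first exact: continuous_locally_summable.
move=> a b; rewrite le_eqVlt => /predU1P[->|ab].
  by rewrite subrr set_itv1 Rintegral_set1.
have cf := has_derivative_continuous fg.
rewrite /Rintegral (continuous_FTC2 ab (F := f)).
- by [].
- exact: continuous_subspaceT.
- split; first by move=> x _; case: (fg x).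
  + exact/cvg_at_right_filter/cf.
  + exact/cvg_at_left_filter/cf.
- by move=> x _; rewrite (has_derivative_derive1 fg).
Qed.

Lemma Rintegral_itv_cvg g : mu.-integrable setT (EFin \o g) ->
  \int[mu]_(x in `[- n%:R, n%:R]) g x @[n --> \oo] --> \int[mu]_x g x.
Proof.
move=> gi; have mg : measurable_fun setT g.
  by apply/measurable_EFinP; exact: measurable_int gi.
have [|||||_ +] := @Rdominated_cvg _ _ _ mu setT (@measurableT _ _)
   (fun n => g \_ `[- n%:R, n%:R]) g (fun x => `|g x|).
- move=> n; apply/(measurable_restrictT _ (measurable_itv _)).
  exact: measurable_funTS.
- exact: mg.
- move=> x _; apply: cvg_near_cst; near=> n; rewrite patchE ifT// inE/= in_itv/=.
  rewrite -ler_norml; near: n; exact: nbhs_infty_ger.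
- exact: integrable_norm.
- by move=> n x _; rewrite patchE; case: ifP => // _; rewrite normr0.
by under eq_fun do rewrite -Rintegral_mkcond.
Unshelve. all: by end_near. Qed.

(** Otherwise intervals of length [k] beyond [N] would contribute at least [e k] to the integral of
    [|g|], for every [k]. The boolean selects the end of the line, [+oo] or [-oo]. *)
Lemma integrable_not_bounded_below g (e N : R) (s : bool) : mu.-integrable setT (EFin \o g) ->
  0 < e -> exists x, N <= (if s then x else - x) /\ `|g x| < e.
Proof.
move=> gi e0; apply: contrapT => /forallNP h.
have {}h x : N <= (if s then x else - x) -> e <= `|g x|.
  by move=> Nx; rewrite leNgt; apply/negP => gx; apply: (h x).
have ag : mu.-integrable setT (EFin \o (fun x => `|g x|)) by exact: integrable_norm.
pose I := \int[mu]_x `|g x|.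
have bound k : 0 <= k -> e * k <= I.
  move=> k0.
  pose a := if s then N else - N - k.
  have -> : e * k = \int[mu]_(x in `[a, a + k]) e.
    rewrite Rintegral_cst//= lebesgue_measure_itv/= lte_fin.
    case: ltP => hk /=; first by congr (_ * _); ring.
    by have -> : k = 0 by lra.
  apply: (@le_trans _ _ (\int[mu]_(x in `[a, a + k]) `|g x|)).
    apply: le_Rintegral => //.
    - apply: continuous_compact_integrable; first exact: segment_compact.
      by apply: continuous_subspaceT => x; exact: cvg_cst.
    - exact: integrableS ag.
    - move=> x /=; rewrite in_itv/= /a => /andP[ax xk]; apply: h.
      by move: ax xk; case: (s); lra.
  rewrite Rintegral_mkcond; apply: le_Rintegral => //.
    exact: rintegrable_restrict.
  by move=> x _; rewrite patchE; case: ifP => _; [exact: lexx|exact: normr_ge0].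
have I0 : 0 <= I by apply: Rintegral_ge0.
have I1 : 0 <= (I + 1) / e by apply: divr_ge0; lra.
by have := bound _ I1; rewrite mulrCA mulfV ?gt_eqF//; lra.
Qed.

(** [f] need not be known to vanish at infinity: it is small at some far points [x] and [y] on
    either side, so the integral of [g] over [[x, y]], which is [f y - f x], is small, and the tails
    are small by integrability. *)
Lemma AC_Rintegral_eq0 f g : AC f g -> mu.-integrable setT (EFin \o f) ->
  mu.-integrable setT (EFin \o g) -> \int[mu]_x g x = 0.
Proof.
move=> [lg fg] fi gi; set I := \int[mu]_x g x; apply/eqP/contraT => I0.
have e0 : 0 < `|I| by rewrite normr_gt0.
have ag : mu.-integrable setT (EFin \o (fun x => `|g x|)) by exact: integrable_norm.
have e4 : 0 < `|I| / 4 by lra.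
have /cvgrPdist_lt /(_ _ e4) [N _ /(_ N (leqnn N))] := Rintegral_itv_cvg ag.
have [y [Ny fy]] := integrable_not_bounded_below N%:R true fi e4.
have [x [Nx fx]] := integrable_not_bounded_below N%:R false fi e4.
have N0 : 0 <= N%:R :> R by rewrite ler0n.
have xy : x <= y by lra.
have := fg _ _ xy; set J := \int[mu]_(_ in _) _ => fJ.
set A := \int[mu]_x `|g x|; set B := \int[mu]_(_ in _) _ => AB.
suff : `|I - J| <= A - B.
  have : `|f y - f x| <= `|f y| + `|f x| by exact: ler_normB.
  rewrite fJ; have := ler_norm (A - B).
  have : `|I| <= `|I - J| + `|J| by rewrite -{1}(subrK J I); exact: ler_normD.
  by lra.
have iR : mu.-integrable setT (EFin \o (g \_ `[x, y])).
  exact: rintegrable_restrict.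
have iRa : mu.-integrable setT (EFin \o ((fun x => `|g x|) \_ `[- N%:R, N%:R])).
  exact: rintegrable_restrict.
rewrite /I /J [X in `|_ - X|]Rintegral_mkcond -RintegralB//.
rewrite /A /B [X in _ <= _ - X]Rintegral_mkcond -[leRHS]RintegralB//.
apply: (le_trans (le_normr_Rintegral _ _)) => //; first exact: rintegrableB.
apply: le_Rintegral => //.
- by apply: integrable_norm => //; exact: rintegrableB.
- exact: rintegrableB.
- move=> t _; rewrite !patchE.
  case: ifPn => [_|tx]; first by rewrite subrr normr0; case: ifP => _; rewrite ?subrr ?subr0.
  rewrite subr0 ifF ?subr0//; apply/negbTE; apply: contra tx.
  by rewrite !inE/= !in_itv/= => /andP[t1 t2]; apply/andP; split; lra.
Qed.

End AbsoluteContinuityTheory.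

(** * Weak derivatives *)

Section WeakDerivatives.
Context {R : realType}.
Local Notation mu := (@lebesgue_measure R).
Implicit Types (f g h phi : R -> R) (a b c x y : R).

Lemma supported_integrable h a b : locally_summable h ->
  (forall x, x \notin `[a, b] -> h x = 0) -> mu.-integrable setT (EFin \o h).
Proof.
move=> [mh hi] h0.
have -> : h = h \_ `[a, b].
  apply/funext => x; rewrite patchE; case: ifPn => //.
  by rewrite notin_setE/= => /negP; exact: h0.
apply: rintegrable_patch => //; exact: hi.
Qed.

Lemma supported_Rintegral h a b : (forall x, x \notin `[a, b] -> h x = 0) ->
  \int[mu]_x h x = \int[mu]_(x in `[a, b]) h x.
Proof.
move=> h0; rewrite [RHS]Rintegral_mkcond; apply: eq_Rintegral => x _.
rewrite patchE; case: ifPn => //.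
by rewrite notin_setE/= => /negP; exact: h0.
Qed.

Lemma has_derivative_locally_cst f g a b c : has_derivative f g ->
  (forall x, a < x -> x < b -> f x = c) -> forall x, a < x -> x < b -> g x = 0.
Proof.
move=> fg fc x ax xb; have [dx <-] := fg x.
rewrite -(@near_eq_derive _ R R (cst c)) ?derive_cst//.
near=> y; rewrite fc//; near: y; [exact: lt_nbhsr|exact: lt_nbhsl].
Unshelve. all: by end_near. Qed.

Lemma test_functionP phi : test_function phi -> exists N,
  [/\ has_derivative phi (derive1 phi), continuous (derive1 phi),
   forall x, x \notin `[- N, N] -> phi x = 0
   & forall x, x \notin `[- N, N] -> derive1 phi x = 0].
Proof.
move=> [sphi cphi].
have d0 : has_derivative phi (derive1 phi).
  by move=> x; apply: DeriveDef; [exact: (sphi 0%N)|rewrite derive1E].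
have d1 : continuous (derive1 phi).
  move=> x; apply/differentiable_continuous/derivable1_diffP.
  exact: (sphi 1%N).
have [M [_ MP]] := compact_bounded cphi.
have p0 x : M + 1 < `|x| -> phi x = 0.
  move=> Mx; apply/eqP/contraT => px.
  have M1 : M < M + 1 by rewrite ltrDl.
  have := MP (M + 1) M1 x; rewrite /= => h.
  have cx : closure [set x | phi x != 0] x by apply: subset_closure.
  by have := lt_le_trans Mx (h cx); rewrite ltxx.
(* The additional unit leaves a neighbourhood of [x] on which [phi] vanishes, so that its derivative
   vanishes at [x] too. *)
exists (M + 2); split => // x.
  rewrite in_itv/= -ler_norml -ltNge => h; apply: p0; lra.
rewrite in_itv/= -ler_norml -ltNge => h.
have [x0|x0] := leP 0 x.
  apply: (has_derivative_locally_cst (a := M + 1) (b := x + 1) (c := 0) d0) => [y y1 _||].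
  - by apply: p0; apply: (lt_le_trans y1); exact: ler_norm.
  - by rewrite ger0_norm// in h; lra.
  - lra.
apply: (has_derivative_locally_cst (a := x - 1) (b := - (M + 1)) (c := 0) d0) => [y _ y1||].
- by apply: p0; rewrite -normrN; apply: (@lt_le_trans _ _ (- y)); [lra|exact: ler_norm].
- lra.
- by rewrite ltr0_norm// in h; lra.
Qed.

Definition ldist f a (r : R) : R := \int[mu]_(x in ball a r) `|f x - f a|.

(** The averaged oscillation tends to 0 at a Lebesgue point; multiplying by the length [2 r] of the
    ball explains the [e / 2] in the proof. *)
Lemma lebesgue_pt_ldist f a (e : R) : locally_summable f -> lebesgue_pt f a -> 0 < e ->
  exists2 d, 0 < d & forall r, 0 < r -> r < d -> ldist f a r <= e * r.
Proof.
move=> [mf fi] lfa e0.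
have e20 : 0 < e / 2 by lra.
have h0 : fine (davg f a r) @[r --> (0 : R)^'+] --> (0 : R) by exact: fine_cvg lfa.
have /cvgrPdist_lt /(_ _ e20) [d /= d0 dP] := h0.
exists d => // r r0 rd.
have := dP r; rewrite /= sub0r normrN gtr0_norm// => /(_ rd r0).
rewrite sub0r normrN => h.
have i : mu.-integrable (ball a r) (EFin \o (fun x => `|f x - f a|)).
  have : mu.-integrable `[a - r, a + r] (EFin \o (fun x => `|f x - f a|)).
    apply: (@integrable_norm _ _ _ mu) => //.
    apply: rintegrableB => //.
    by apply: (continuous_locally_summable _).2 => x; exact: cvg_cst.
  apply: integrableS => //; first exact: measurable_ball.
  by move=> x; rewrite ball_itv/= !in_itv/= => /andP[/ltW -> /ltW ->].
have E : davg f a r = (ldist f a r / (r * 2))%:E.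
  rewrite /davg /iavg lebesgue_measure_ball ?ltW// inver ?mulf_neq0 ?gt_eqF//.
  rewrite [RHS]EFinM muleC; congr (_ * _)%E.
    rewrite /ldist /Rintegral fineK//.
    by apply: (integrable_fin_num _ i); exact: measurable_ball.
  by rewrite mulr_natr.
  by rewrite pmulrn_lgt0.
have l0 : 0 <= ldist f a r by rewrite /ldist; apply: Rintegral_ge0.
move: h; rewrite E /= ger0_norm; last first.
  by apply: divr_ge0 => //; rewrite mulr_ge0// ltW.
rewrite ltr_pdivrMr ?mulr_gt0//; lra.
Qed.

(** With [g] the derivative of [smooth_step], the second factor is a one-sided approximate identity
    of mass 1, supported in [[a, a + 1 / (n + 1)]]. *)
Definition bump f (g : R -> R) a (n : nat) : R -> R :=
  fun x => f x * (n.+1%:R * g (n.+1%:R * (x - a))).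

Lemma has_derivative_scaled f df k a : has_derivative f df ->
  has_derivative (fun x => f (k * (x - a))) (fun x => k * df (k * (x - a))).
Proof.
move=> fdf; have kd : has_derivative (fun x => k * (x - a)) (cst k).
  move=> x; have -> : (fun x => k * (x - a)) = k \*: (fun x => x - a) by [].
  by apply: is_derive_eq; rewrite subr0 /GRing.scale /= mulr1.
by move=> x; rewrite mulrC; exact: (has_derivative_comp kd fdf).
Qed.

(** The kernel is at most [(n + 1) M] on an interval of length [1 / (n + 1)], so the error is
    controlled by the mean oscillation of [f] near [a], which is small at a Lebesgue point. *)
Lemma mollify_cvg f dsig a : locally_summable f -> lebesgue_pt f a ->
  has_derivative smooth_step dsig -> continuous dsig ->
  (forall n, mu.-integrable setT (EFin \o bump f dsig a n)) /\
  \int[mu]_x bump f dsig a n x @[n --> \oo] --> f a.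
Proof.
move=> lf lfa sd cd.
have cds n : continuous (fun x => n.+1%:R * dsig (n.+1%:R * (x - a))).
  move=> x; apply: cvgM; first exact: cvg_cst.
  apply: (@continuous_comp _ _ _ (fun x => n.+1%:R * (x - a)) dsig); last exact: cd.
  by apply: cvgM; [exact: cvg_cst|apply: cvgB; [exact: cvg_id|exact: cvg_cst]].
have n0 n : 0 < n.+1%:R :> R by rewrite ltr0n.
have supp n x : x \notin `[a, a + n.+1%:R^-1] -> dsig (n.+1%:R * (x - a)) = 0.
  move=> xn.
  have : (n.+1%:R * (x - a) < 0) || (1 < n.+1%:R * (x - a)).
    rewrite pmulr_rlt0// subr_lt0 mulrC -ltr_pdivrMr// div1r ltrBrDl.
    by move: xn; rewrite in_itv/= negb_and -!ltNge.
  case/orP => h.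
    apply: (has_derivative_locally_cst (a := n.+1%:R * (x - a) - 1) (b := 0)
      (c := 0) sd) => //; last by lra.
    by move=> y _ y0; rewrite smooth_step_eq0// ltW.
  apply: (has_derivative_locally_cst (a := 1) (b := n.+1%:R * (x - a) + 1)
    (c := 1) sd) => //; last by lra.
  by move=> y y0 _; rewrite smooth_step_eq1// ltW.
have lb n : locally_summable (bump f dsig a n).
  have -> : bump f dsig a n = (fun x => (n.+1%:R * dsig (n.+1%:R * (x - a))) * f x).
    by apply/funext => x; rewrite mulrC.
  exact: locally_summableM.
have suppb n x : x \notin `[a, a + n.+1%:R^-1] -> bump f dsig a n x = 0.
  by move=> xn; rewrite /bump supp// !mulr0.
split; first by move=> n; exact: (supported_integrable (lb n) (suppb n)).
have [M MP] := continuous_bounded_itv 0 1 cd.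
have M0 : 0 <= M by apply: le_trans (MP 0 _); rewrite ?normr_ge0// in_itv/= lexx ler01.
apply/cvgrPdist_le => e e0.
(* The final error is [(n + 1) M] times this constant times the radius [2 r], that is
   [e M / (M + 1)]. *)
have e1 : 0 < e / (2 * (M + 1)) by rewrite divr_gt0//; lra.
have [d d0 dP] := lebesgue_pt_ldist lf lfa e1.
near=> n.
set r := n.+1%:R^-1 : R.
have r0 : 0 < r by rewrite invr_gt0.
have mass : \int[mu]_(x in `[a, a + r]) (n.+1%:R * dsig (n.+1%:R * (x - a))) = 1.
  have := has_derivative_AC (has_derivative_scaled n.+1%:R a sd) (cds n).
  move=> -[_ <-]; last by lra.
  rewrite subrr mulr0 (smooth_step_eq0 (lexx 0)) addrAC subrr add0r mulfV ?gt_eqF//.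
  by rewrite smooth_step_eq1// subr0.
have ic : mu.-integrable `[a, a + r] (EFin \o (fun x => n.+1%:R * dsig (n.+1%:R * (x - a)))).
  exact: (continuous_locally_summable (cds n)).2.
have ib := (lb n).2 a (a + r).
rewrite (supported_Rintegral (suppb n)) -/r -[X in `|X - _|]mulr1 -[X in f a * X]mass.
rewrite -RintegralZl//.
have ic' := rintegrableZ (mu := mu) (measurable_itv _) (f a) ic.
rewrite -RintegralB//.
have ilf : mu.-integrable `[a - 2 * r, a + 2 * r] (EFin \o (fun x => `|f x - f a|)).
  apply: (@integrable_norm _ _ _ mu) => //.
  apply: rintegrableB => //; first exact: lf.2.
  by apply: (continuous_locally_summable _).2 => x; exact: cvg_cst.
have sub1 : `[a, a + r] `<=` `[a - 2 * r, a + 2 * r].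
  by move=> x /=; rewrite !in_itv/= => /andP[? ?]; apply/andP; split; lra.
have sub2 : ball a (2 * r) `<=` `[a - 2 * r, a + 2 * r].
  by move=> x; rewrite ball_itv/= !in_itv/= => /andP[/ltW -> /ltW ->].
(* The radius is doubled because the balls are open and the support of the kernel is closed. *)
have sub3 : `[a, a + r] `<=` ball a (2 * r).
  by move=> x; rewrite ball_itv/= !in_itv/= => /andP[? ?]; apply/andP; split; lra.
have ilf1 : mu.-integrable `[a, a + r] (EFin \o (fun x => `|f x - f a|)).
  exact: integrableS ilf.
apply: (le_trans (le_normr_Rintegral _ _)) => //; first exact: rintegrableB.
apply: (@le_trans _ _ (\int[mu]_(x in `[a, a + r]) (n.+1%:R * M * `|f x - f a|))).
  apply: le_Rintegral => //.
  - by apply: integrable_norm => //; exact: rintegrableB.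
  - exact: rintegrableZ.
  - move=> x /=; rewrite in_itv/= => /andP[ax xr].
    rewrite /bump -mulrBl normrM distrC normrM (ger0_norm (ltW (n0 n))).
    rewrite mulrC ler_wpM2r//.
    rewrite ler_wpM2l ?(ltW (n0 n))//; apply: MP; rewrite in_itv/=; apply/andP; split.
      by rewrite mulr_ge0 ?(ltW (n0 n))// subr_ge0.
    by rewrite mulrC -ler_pdivlMr// div1r lerBlDl.
rewrite RintegralZl//.
have le2 : \int[mu]_(x in `[a, a + r]) `|f x - f a| <= ldist f a (2 * r).
  rewrite /ldist Rintegral_mkcond [leRHS]Rintegral_mkcond.
  have ir := integrableS (mu := mu) (measurable_itv _) (measurable_ball a (2 * r)) sub2 ilf.
  apply: le_Rintegral => //.
  - exact: rintegrable_patch.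
  - exact: (rintegrable_patch (mu := mu) (measurable_ball a (2 * r))).
  - move=> x _; rewrite !patchE; case: ifPn => [xa|_].
      by rewrite ifT//; move: xa; rewrite !inE; exact: sub3.
    by case: ifP => _; [exact: normr_ge0|exact: lexx].
have rd : 2 * r < d.
  rewrite /r -ltr_pdivlMl// mulrC; near: n.
  exact: near_infty_natSinv_lt (PosNum (divr_gt0 d0 (ltr0n _ 2))).
have := dP (2 * r); rewrite mulr_gt0// => /(_ isT rd) le3.
apply: (@le_trans _ _ (n.+1%:R * M * (e / (2 * (M + 1)) * (2 * r)))).
  by apply: ler_wpM2l; [apply: mulr_ge0 => //; exact: ltW|exact: le_trans le2 le3].
have -> : n.+1%:R * M * (e / (2 * (M + 1)) * (2 * r)) = e * (M / (M + 1)).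
  by rewrite /r; field; rewrite gt_eqF//=; lra.
rewrite -[leRHS]mulr1 ler_wpM2l ?(ltW e0)// ler_pdivrMr; lra.
Unshelve. all: by end_near. Qed.

End WeakDerivatives.

(** * Weak derivatives and absolutely continuous representatives *)

Section WeakAC.
Context {R : realType}.
Local Notation mu := (@lebesgue_measure R).
Implicit Types (f g h phi : R -> R) (a b c x y : R).

Lemma aeS (P Q : R -> Prop) : (forall x, P x -> Q x) ->
  {ae mu, forall x, P x} -> {ae mu, forall x, Q x}.
Proof. by move=> PQ; apply: filterS => //; exact: (ae_filter_ringOfSetsType mu). Qed.

Lemma aeI (P Q : R -> Prop) : {ae mu, forall x, P x} ->
  {ae mu, forall x, Q x} -> {ae mu, forall x, P x /\ Q x}.
Proof.
move=> aeP aeQ; apply: filterS2 aeP aeQ => //.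
exact: (ae_filter_ringOfSetsType mu).
Qed.

Lemma ae_exists (P : R -> Prop) : {ae mu, forall x, P x} -> exists x, P x.
Proof.
move=> [N [mN N0 PN]]; apply: contrapT => /forallNP h.
have sN : `[0, 1] `<=` N by move=> x _; apply: PN; exact: h.
have : (mu `[0%R, 1%R] <= mu N)%E.
  by apply: le_measure => //; rewrite inE; [exact: measurable_itv|exact: mN].
by rewrite N0 lebesgue_measure_itv/= lte_fin ltr01 sube0 lee_fin ler10.
Qed.

Lemma locally_summable_lebesgue_pt f : locally_summable f ->
  {ae mu, forall x, lebesgue_pt f x}.
Proof.
move=> [mf fi]; apply: lebesgue_differentiation; split => //; first exact: openT.
move=> K _ cK; have [M [_ MP]] := compact_bounded cK.
have M1 : M < M + 1 by rewrite ltrDl.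
have sK : K `<=` `[- (M + 1), M + 1].
  by move=> x Kx; have := MP _ M1 x Kx; rewrite /= in_itv/= ler_norml.
have /integrableP[_] := fi (- (M + 1)) (M + 1).
apply: le_lt_trans; apply: ge0_subset_integral => //.
- exact: compact_measurable.
- by apply: measurable_funTS; apply/measurable_EFinP; exact: measurableT_comp.
Qed.

(** A smooth approximation of the indicator of []a, b]]. Its derivative is the difference of the
    approximate identities at [a] and [b], so that testing a weak derivative against it produces
    [f b - f a] in the limit. *)
Definition plateau a b (n : nat) x : R :=
  smooth_step (n.+1%:R * (x - a)) - smooth_step (n.+1%:R * (x - b)).

Lemma plateau_supp a b n x : a < b -> x \notin `[a, b + 1] -> plateau a b n x = 0.
Proof.
move=> ab; rewrite in_itv/= negb_and -!ltNge /plateau => /orP[xa|xb].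
  rewrite !smooth_step_eq0 ?subrr// pmulr_rle0 ?ltr0n//; lra.
have n1 : 1 <= n.+1%:R :> R by rewrite ler1n.
rewrite !smooth_step_eq1 ?subrr//; apply: (@le_trans _ _ (1 * 1)); rewrite ?mulr1//.
  by apply: (@le_trans _ _ (n.+1%:R * 1)); [lra|rewrite ler_wpM2l; lra].
by apply: (@le_trans _ _ (n.+1%:R * 1)); [lra|rewrite ler_wpM2l; lra].
Qed.

Lemma plateau_test a b n : a < b -> test_function (plateau a b n).
Proof.
move=> ab; split.
  apply: smoothP => m.
  have sc c : differentiable_n m (fun x => smooth_step (n.+1%:R * (x - c))).
    have -> : (fun x => smooth_step (n.+1%:R * (x - c))) =
      (fun x => smooth_step (n.+1%:R * x + (- (n.+1%:R * c)))).
      by apply/funext => x; rewrite mulrBr.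
    exact/differentiable_n_affine/smooth_step_smooth.
  have -> : plateau a b n = (fun x => smooth_step (n.+1%:R * (x - a))) \+
     (cst (-1) \* (fun x => smooth_step (n.+1%:R * (x - b)))).
    by apply/funext => x; rewrite /= mulN1r.
  apply: differentiable_nD; first exact: sc.
  by apply: differentiable_nM; [exact: differentiable_n_cst|exact: sc].
apply: (subclosed_compact _ (@segment_compact _ a (b + 1))).
  exact: closed_closure.
rewrite [X in _ `<=` X](closure_id _).1; last exact: interval_closed.
apply: closure_subset.
by move=> x /=; apply: contra_neqP => /negP; exact: plateau_supp.
Qed.

Lemma plateau_norm_le1 a b n x : `|plateau a b n x| <= 1.
Proof.
rewrite /plateau ler_norml.
have := smooth_step_ge0 (n.+1%:R * (x - a)); have := smooth_step_le1 (n.+1%:R * (x - a)).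
have := smooth_step_ge0 (n.+1%:R * (x - b)); have := smooth_step_le1 (n.+1%:R * (x - b)).
by move=> ? ? ? ?; apply/andP; split; lra.
Qed.

Lemma smooth_step_cvg a x : a < x ->
  smooth_step (n.+1%:R * (x - a)) @[n --> \oo] --> (1 : R).
Proof.
move=> ax; apply: cvg_near_cst; near=> n; apply: smooth_step_eq1.
rewrite -ler_pdivrMr ?subr_gt0// div1r.
apply: (@le_trans _ _ n%:R); last by rewrite ler_nat.
by near: n; exact: nbhs_infty_ger.
Unshelve. all: by end_near. Qed.

Lemma weak_FTC f g : locally_summable f -> locally_summable g ->
  (forall phi, test_function phi ->
    \int[mu]_x (f x * derive1 phi x) = - \int[mu]_x (g x * phi x)) ->
  forall a b, a < b -> lebesgue_pt f a -> lebesgue_pt f b ->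
  f b - f a = \int[mu]_(x in `[a, b]) g x.
Proof.
move=> lf lg fg a b ab fa fb.
have [dsig [sd [dd [ddP _]]]] := @smooth_step_smooth R 2.
have cd := has_derivative_continuous ddP.
have [ia ca] := mollify_cvg lf fa sd cd.
have [ib cb] := mollify_cvg lf fb sd cd.
have E n : \int[mu]_x bump f dsig a n x - \int[mu]_x bump f dsig b n x =
    - \int[mu]_x (g x * plateau a b n x).
  rewrite -fg; last exact: plateau_test.
  rewrite -RintegralB//; apply: eq_Rintegral => x _.
  have dp : has_derivative (plateau a b n) (fun x => n.+1%:R * dsig (n.+1%:R * (x - a))
      - n.+1%:R * dsig (n.+1%:R * (x - b))).
    by move=> y; apply: is_deriveB; exact: has_derivative_scaled.
  by rewrite (has_derivative_derive1 dp) /bump -mulrBr.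
have mg := lg.1.
(* The limit is the indicator of the half-open interval because [smooth_step 0 = 0]: the plateau
   vanishes at [a] and tends to 1 at [b]. *)
have [|||||_ cg] := @Rdominated_cvg _ _ _ mu setT (@measurableT _ _)
   (fun n x => g x * plateau a b n x) (g \_ `]a, b]) ((fun x => `|g x|) \_ `[a, b + 1]).
- move=> n; apply: measurable_funM => //.
  have [N [dp _ _ _]] := test_functionP (plateau_test n ab).
  by apply: continuous_measurable_fun; exact: has_derivative_continuous dp.
- apply/(measurable_restrictT _ (measurable_itv _)); exact: measurable_funTS.
- move=> x _; rewrite patchE; case: ifPn.
    rewrite inE/= in_itv/= => /andP[ax xb].
    rewrite -[X in _ --> X]mulr1; apply: cvgMr.
    apply: cvg_trans (smooth_step_cvg ax); apply: near_eq_cvg; near=> n.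
    rewrite /plateau (_ : smooth_step (_ * (x - b)) = 0) ?subr0//.
    by rewrite smooth_step_eq0// pmulr_rle0// subr_le0.
  rewrite notin_setE/= in_itv/= => /negP; rewrite negb_and -ltNge -leNgt => xab.
  have [xa|xa] := leP x a.
    apply: cvg_near_cst; near=> n; rewrite /plateau !smooth_step_eq0 ?subrr ?mulr0//.
      by rewrite pmulr_rle0// subr_le0 (le_trans xa)// ltW.
    by rewrite pmulr_rle0// subr_le0.
  have xb : b < x by move: xab; rewrite leNgt xa.
  have p0 : plateau a b n x @[n --> \oo] --> (1 - 1 : R).
    by apply: cvgB; exact: smooth_step_cvg.
  have : g x * plateau a b n x @[n --> \oo] --> g x * (1 - 1 : R) by exact: cvgMr.
  by rewrite subrr mulr0.
- apply: rintegrable_patch => //; apply: integrable_norm => //; exact: lg.2.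
- move=> n x _; rewrite patchE normrM; case: ifPn => [_|].
    by rewrite -[leRHS]mulr1 ler_wpM2l// plateau_norm_le1.
  by rewrite notin_setE/= => /negP xab; rewrite plateau_supp// normr0 mulr0.
have c1 : (- \int[mu]_x (g x * plateau a b n x)) @[n --> \oo] --> f a - f b.
  by under eq_fun do rewrite -E; exact: cvgB.
have := cvg_unique _ c1 (cvgN cg); rewrite -Rintegral_mkcond.
rewrite Rintegral_itv_obnd_cbnd; last first.
  apply: integrableS (lg.2 a b) => //; apply: subset_itvr; by rewrite bnd_simp.
by move=> /(_ (@Rhausdorff R)) h; rewrite -[LHS]opprB h opprK.
Unshelve. all: by end_near. Qed.

Definition weakly_derives f g : Prop := forall phi, test_function phi ->
  \int[mu]_x (f x * derive1 phi x) = - \int[mu]_x (g x * phi x).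

(** The representative is the primitive of [g] started at one Lebesgue point [a] of [f]; [weak_FTC]
    makes it agree with [f] at every other Lebesgue point. *)
Lemma weakly_derives_AC f g : locally_summable f -> locally_summable g ->
  weakly_derives f g -> exists f0, AC f0 g /\ {ae mu, forall x, f x = f0 x}.
Proof.
move=> lf lg fg; have lpt := locally_summable_lebesgue_pt lf.
have [a fa] := ae_exists lpt.
have ftc := weak_FTC lf lg fg.
have acp := AC_primitive a lg.
have p0 : primitive g a a = 0 by rewrite /primitive lexx set_itv1 Rintegral_set1.
exists (fun x => f a + primitive g a x); split.
  split => // x y xy; rewrite -acp.2//; ring.
apply: aeS lpt => x fx.
have [xa|ax|->] := ltgtP x a.
- by have := ftc _ _ xa fx fa; rewrite -acp.2 ?ltW// p0; lra.
- by have := ftc _ _ ax fa fx; rewrite -acp.2 ?ltW// p0; lra.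
- by rewrite p0 addr0.
Qed.

Lemma test_product_integrable f phi : locally_summable f -> test_function phi ->
  mu.-integrable setT (EFin \o (fun x => f x * phi x)) /\
  mu.-integrable setT (EFin \o (fun x => f x * derive1 phi x)).
Proof.
move=> lf tphi; have [N [dp cdp s0 s1]] := test_functionP tphi.
have cp := has_derivative_continuous dp.
have comm h k : (fun x : R => h x * k x) = (fun x => k x * h x :> R).
  by apply/funext => x; rewrite mulrC.
split; rewrite comm; apply: (@supported_integrable _ _ (- N) N).
- exact: locally_summableM.
- by move=> x /s0 ->; rewrite mul0r.
- exact: locally_summableM.
- by move=> x /s1 ->; rewrite mul0r.
Qed.

Lemma AC_weakly_derives f g : AC f g -> weakly_derives f g.
Proof.
move=> acf phi tphi; have [N [dp cdp s0 s1]] := test_functionP tphi.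
have lf := continuous_locally_summable (AC_continuous acf).
have [i1 i2] := test_product_integrable lf tphi.
have [i3 i4] := test_product_integrable acf.1 tphi.
apply/eqP; rewrite -addr_eq0 addrC -RintegralD//.
have acp := ACM acf (has_derivative_AC dp cdp).
by rewrite (AC_Rintegral_eq0 acp)//; exact: rintegrableD.
Qed.

Lemma AC_cst_derivative c g : AC (cst c) g -> {ae mu, forall x, g x = 0}.
Proof.
move=> [lg gE]; apply: aeS (locally_summable_lebesgue_pt lg) => x gx.
have x1 : x < x + 1 by rewrite ltrDl.
have x0 : (BLeft (x - 1)%R < BRight x)%E by rewrite /Order.lt/=; lra.
have [dF <-] := FTC1_lebesgue_pt x1 (lg.2 (x - 1) (x + 1)) x0 gx.
rewrite derive1E -(@near_eq_derive _ R R (cst 0)) ?derive_cst//.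
near=> y; rewrite /= -gE ?subrr//.
near: y; apply: lt_le_nbhsr; lra.
Unshelve. all: by end_near. Qed.

(** The difference [k] is a weak derivative of 0. Every point is a Lebesgue point of 0, so all
    integrals of [k] over intervals vanish, and so does [k] almost everywhere. *)
Lemma weakly_derives_unique f g1 g2 : locally_summable f ->
  locally_summable g1 -> locally_summable g2 ->
  weakly_derives f g1 -> weakly_derives f g2 -> {ae mu, forall x, g1 x = g2 x}.
Proof.
move=> lf l1 l2 w1 w2; pose k x := g1 x + (-1) * g2 x.
have lk : locally_summable k by exact/locally_summableD/locally_summableZ.
have c0 : continuous (cst 0 : R -> R) by move=> x; exact: cvg_cst.
have l0 := continuous_locally_summable c0.
suff ack : AC (cst 0) k.
  by apply: aeS (AC_cst_derivative ack) => x; rewrite /k; lra.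
split => // a b; rewrite le_eqVlt => /predU1P[->|ab].
  by rewrite subrr set_itv1 Rintegral_set1.
have l0x x : lebesgue_pt (cst 0 : R -> R) x.
  apply: (@continuous_lebesgue_pt R (cst 0) x setT) => //.
    by split => //; exact: openT.
  exact: c0.
apply: (@weak_FTC (cst 0) k) => //.
move=> phi tphi; have [i1 _] := test_product_integrable l1 tphi.
have [i2 _] := test_product_integrable l2 tphi.
have -> : (fun x => k x * phi x) = (fun x => g1 x * phi x - g2 x * phi x).
  by apply/funext => x; rewrite /k; ring.
rewrite RintegralB//; have := w1 _ tphi; rewrite w2// => /oppr_inj ->.
rewrite subrr oppr0 -[RHS](mul0r (fine (mu setT))) -Rintegral_cst//.
by apply: eq_Rintegral => x _; rewrite mul0r.
Qed.

End WeakAC.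

(** * Square integrable functions *)

Section SquareIntegrable.
Context d (T : measurableType d) (R : realType) (mu : {measure set T -> \bar R}).
Implicit Types (f g h : T -> R).

Definition square_integrable f : Prop :=
  measurable_fun setT f /\ mu.-integrable setT (EFin \o (fun x => f x ^+ 2)).

Lemma square_integrableZ k f : square_integrable f -> square_integrable (fun x => k * f x).
Proof.
move=> [mf fi]; split; first exact: measurable_funM.
have -> : (fun x => (k * f x) ^+ 2) = (fun x => k ^+ 2 * f x ^+ 2).
  by apply/funext => x; rewrite exprMn.
exact: rintegrableZ.
Qed.

Lemma square_integrableM f g : square_integrable f -> square_integrable g ->
  mu.-integrable setT (EFin \o (fun x => f x * g x)).
Proof.
move=> [mf fi] [mg gi].
apply: (@rintegrable_le _ _ _ mu setT measurableT _ (fun x => f x ^+ 2 + g x ^+ 2)).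
- exact: measurable_funM.
- exact: rintegrableD.
- move=> x _; rewrite ler_norml.
  have := sqr_ge0 (f x + g x); have := sqr_ge0 (f x - g x).
  have := sqr_ge0 (f x); have := sqr_ge0 (g x).
  by move=> ? ? ? ?; apply/andP; split; nra.
Qed.

Lemma square_integrableD f g : square_integrable f -> square_integrable g ->
  square_integrable (fun x => f x + g x).
Proof.
move=> fP gP; have fg := square_integrableM fP gP.
case: fP gP => [mf fi] [mg gi]; split; first exact: measurable_funD.
have -> : (fun x => (f x + g x) ^+ 2) = (fun x => f x ^+ 2 + (2 * (f x * g x) + g x ^+ 2)).
  by apply/funext => x; ring.
by apply: rintegrableD => //; apply: rintegrableD => //; exact: rintegrableZ.
Qed.

Lemma square_integrableB f g : square_integrable f -> square_integrable g ->
  square_integrable (fun x => f x - g x).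
Proof.
move=> fP gP.
have -> : (fun x => f x - g x) = (fun x => f x + (-1) * g x).
  by apply/funext => x; ring.
by apply: square_integrableD => //; exact: square_integrableZ.
Qed.

Lemma geometric_partial_sum (q : R) n : 0 <= q -> q < 1 ->
  \sum_(0 <= i < n) q ^+ i <= (1 - q)^-1.
Proof.
move=> q0 q1; suff -> : \sum_(0 <= i < n) q ^+ i = (1 - q ^+ n) / (1 - q).
  rewrite -[leRHS]mul1r ler_wpM2r ?invr_ge0//; first lra.
  by rewrite gerBl exprn_ge0.
elim: n => [|n ih]; first by rewrite big_nil expr0 subrr mul0r.
by rewrite big_nat_recr//= ih exprS; field; lra.
Qed.

(* By AM-GM [2 |d_n| <= (2/3)^n + (3/2)^n d_n^2] for [d_n = u_n.+1 - u_n], and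
   the right-hand side is summable almost everywhere. *)
Lemma riesz_fischer (u : nat -> T -> R) (C : R) :
  (forall n, square_integrable (u n)) ->
  (forall n m, (n <= m)%N -> \int[mu]_x (u n x - u m x) ^+ 2 <= C * (1 / 2) ^+ n) ->
  exists v, [/\ square_integrable v,
    forall n, \int[mu]_x (u n x - v x) ^+ 2 <= C * (1 / 2) ^+ n
    & {ae mu, forall x, u n x @[n --> \oo] --> v x}].
Proof.
move=> uP uC; pose dd n x := u n.+1 x - u n x.
have ddP n : square_integrable (dd n) by exact: square_integrableB.
(* The weight [(3/2)^n] grows slowly enough for the integrals to be dominated by the summable
   [C (3/4)^n], while its inverse is summable as well. *)
pose w n x : \bar R := ((3 / 2) ^+ n * dd n x ^+ 2)%:E.
have w0 n x : (0 <= w n x)%E.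
  by rewrite lee_fin mulr_ge0 ?sqr_ge0// exprn_ge0//; lra.
have mw n : measurable_fun setT (w n).
  apply/measurable_EFinP/measurable_funM => //; apply: measurable_funX.
  exact: (ddP n).1.
have iw n : (\int[mu]_x w n x <= (C * (3 / 4) ^+ n)%:E)%E.
  have i2 : mu.-integrable setT (EFin \o (fun x => (3 / 2) ^+ n * dd n x ^+ 2)).
    by apply: rintegrableZ => //; exact: (ddP n).2.
  rewrite -[leLHS]fineK ?lee_fin; last exact: (integrable_fin_num measurableT i2).
  rewrite -/(Rintegral _ _ _) RintegralZl//; last exact: (ddP n).2.
  have -> : C * (3 / 4) ^+ n = (3 / 2) ^+ n * (C * (1 / 2) ^+ n).
    by rewrite mulrCA -exprMn; congr (_ * _ ^+ _); field.
  apply: ler_wpM2l; first by apply: exprn_ge0; lra.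
  apply: le_trans (uC n n.+1 (leqnSn n)); rewrite le_eqVlt; apply/orP; left.
  by apply/eqP/eq_Rintegral => x _; rewrite /dd -sqrrN opprB.
have C0 : 0 <= C.
  have := uC 0%N 0%N (leqnn _); rewrite expr0 mulr1; apply: le_trans.
  by apply: Rintegral_ge0 => x _; exact: sqr_ge0.
pose G x := (\sum_(0 <= n <oo) w n x)%E.
have mG : measurable_fun setT G by exact: ge0_emeasurable_sum.
have G0 x : (0 <= G x)%E by apply: nneseries_ge0.
have iG : (\int[mu]_x G x < +oo)%E.
  rewrite integral_nneseries//.
  apply: (@le_lt_trans _ _ (C * 4)%:E); last by rewrite ltry.
  apply: lime_le; first by apply: is_cvg_nneseries => n _ _; apply: integral_ge0.
  near=> n; apply: (@le_trans _ _ (\sum_(0 <= i < n) (C * (3 / 4) ^+ i)%:E)%E).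
    exact: lee_sum.
  rewrite sumEFin lee_fin -mulr_sumr ler_wpM2l//.
  rewrite [leRHS](_ : _ = (1 - 3 / 4)^-1); last by field.
  by apply: geometric_partial_sum; lra.
have aeG : {ae mu, forall x, (G x < +oo)%E}.
  have Gi : mu.-integrable setT G.
    by apply/integrableP; split => //; under eq_integral do rewrite gee0_abs//.
  have := integrable_ae measurableT Gi; apply: filterS => x /(_ I).
  by rewrite fin_num_abs gee0_abs.
pose A := [set x | (G x < +oo)%E].
have mA : measurable A.
  by rewrite -[A]setTI; apply: measurable_lte => //; exact: measurable_cst.
have cu x : A x -> cvgn (fun n => u n x).
  move=> Ax; have GE : G x = (fine (G x))%:E by rewrite fineK// ge0_fin_numE.
  have -> : (fun n => u n x) = (fun n => u 0%N x + series (telescope (fun n => u n x)) n).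
    by apply/funext => n; exact: eq_sum_telescope.
  apply: is_cvgD; first exact: is_cvg_cst.
  apply: normed_cvg; apply: nondecreasing_is_cvgn.
    by apply: nondecreasing_series => n _ _; exact: normr_ge0.
  (* The 3 is the sum of the series of [(2/3)^i]. *)
  exists ((3 + fine (G x)) / 2) => _ [n _ <-].
  rewrite /series /=.
  apply: (@le_trans _ _ (\sum_(0 <= i < n) (((2 / 3) ^+ i + (3 / 2) ^+ i * dd i x ^+ 2) / 2))).
    apply: ler_sum => i _; rewrite /telescope -/(dd i x).
    set y := `|_|; have -> : dd i x ^+ 2 = y ^+ 2 by rewrite real_normK ?num_real.
    have e0 : 0 < (3 / 2 : R) ^+ i by apply: exprn_gt0; lra.
    have -> : (2 / 3 : R) ^+ i = ((3 / 2) ^+ i)^-1.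
      by rewrite -exprVn; congr (_ ^+ _); field.
    move: e0; set e := (_ ^+ i) => e0; rewrite -subr_ge0.
    have -> : (e^-1 + e * y ^+ 2) / 2 - y = e * (y - e^-1) ^+ 2 / 2.
      by field; rewrite gt_eqF.
    by rewrite divr_ge0// mulr_ge0 ?sqr_ge0// ltW.
  rewrite -mulr_suml ler_wpM2r ?invr_ge0// big_split/=; apply: lerD.
    rewrite [leRHS](_ : _ = (1 - 2 / 3)^-1); last by field.
    by apply: geometric_partial_sum; lra.
  by rewrite -lee_fin -GE -sumEFin; apply: nneseries_lim_ge => i _ _; exact: w0.
pose v x := if pselect (A x) then limn (fun n => u n x) else 0.
have vE x : A x -> u n x @[n --> \oo] --> v x.
  by move=> Ax; rewrite /v; case: pselect => [Ax2|//]; exact: cu.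
have mv : measurable_fun setT v.
  apply: (@measurable_fun_cvg _ _ _ _ (fun n => u n \_ A)).
    move=> n; apply/(measurable_restrictT _ mA); apply: measurable_funTS.
    exact: (uP n).1.
  move=> x _; have [Ax|nAx] := pselect (A x).
    have -> : (fun n => (u n \_ A) x) = (fun n => u n x).
      by apply/funext => n; rewrite patchE mem_set.
    exact: vE.
  rewrite /v; case: pselect => [//|nAx2].
  have -> : (fun n => (u n \_ A) x) = (fun=> 0).
    by apply/funext => n; rewrite patchE memNset.
  exact: cvg_cst.
(* Fatou's lemma on the set [A] of full measure, with [u m] tending to [v] and [n] fixed. *)
have bound n : (\int[mu]_x ((u n x - v x) ^+ 2)%:E <= (C * (1 / 2) ^+ n)%:E)%E.
  have mf g : measurable_fun setT g -> measurable_fun setT (fun x => ((u n x - g x) ^+ 2)%:E).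
    move=> mg; apply/measurable_EFinP/measurable_funX/measurable_funB => //.
    exact: (uP n).1.
  have -> : (\int[mu]_x ((u n x - v x) ^+ 2)%:E =
             \int[mu]_(x in A) ((u n x - v x) ^+ 2)%:E)%E.
    rewrite [RHS]integral_mkcond; apply: ge0_ae_eq_integral => //.
    - exact: mf.
    - by apply/(measurable_restrictT _ mA); apply: measurable_funTS; exact: mf.
    - by move=> x _; rewrite lee_fin sqr_ge0.
    - by move=> x _; rewrite patchE; case: ifP => // _; rewrite lee_fin sqr_ge0.
    - by apply: filterS aeG => x Ax _; rewrite patchE mem_set.
  have -> : (\int[mu]_(x in A) ((u n x - v x) ^+ 2)%:E =
     \int[mu]_(x in A) limn_einf (fun m => ((u n x - u m x) ^+ 2)%:E))%E.
    apply: eq_integral => x /set_mem Ax; apply/esym.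
    have c : ((u n x - u m x) ^+ 2)%:E @[m --> \oo] --> ((u n x - v x) ^+ 2)%:E.
      apply: cvg_EFin; first exact: nearW.
      rewrite /comp /=; under eq_fun do rewrite expr2.
      by rewrite expr2; apply: cvgM; apply: cvgB;
        [exact: cvg_cst|exact: vE|exact: cvg_cst|exact: vE].
    by rewrite (cvg_limn_einf_sup c).
  apply: (le_trans (@fatou _ _ _ mu A mA (fun m x => ((u n x - u m x) ^+ 2)%:E) _ _)).
  - by move=> m; apply: measurable_funTS; apply: mf; exact: (uP m).1.
  - by move=> m x _; rewrite lee_fin sqr_ge0.
  rewrite limn_einf_lim; apply: lime_le.
    by apply: ereal_nondecreasing_is_cvgn; exact: nondecreasing_einfs.
  near=> m; apply: ereal_inf_le.
  (* The infimum ranges over indices at least [m]; the maximum with [n] makes the hypothesis [uC]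
     applicable to the pair. *)
  exists (\int[mu]_(x in A) ((u n x - u (maxn n m) x) ^+ 2)%:E)%E.
    by exists (maxn n m) => //=; exact: leq_maxr.
  apply: (@le_trans _ _ (\int[mu]_x ((u n x - u (maxn n m) x) ^+ 2)%:E)%E).
    apply: ge0_subset_integral => //.
    + by apply: mf; exact: (uP _).1.
    + by move=> x _; rewrite lee_fin sqr_ge0.
  have i2 := (square_integrableB (uP n) (uP (maxn n m))).2.
  rewrite -[leLHS]fineK ?lee_fin; last exact: (integrable_fin_num measurableT i2).
  exact: uC (leq_maxl _ _).
have i1 n : square_integrable (fun x => u n x - v x).
  split; first by apply: measurable_funB => //; exact: (uP n).1.
  apply/integrableP; split.
    apply/measurable_EFinP/measurable_funX/measurable_funB => //.
    exact: (uP n).1.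
  apply: (@le_lt_trans _ _ (C * (1 / 2) ^+ n)%:E); last exact: ltry.
  apply: le_trans (bound n); rewrite le_eqVlt; apply/orP; left; apply/eqP.
  by apply: eq_integral => x _; rewrite /= ger0_norm// sqr_ge0.
exists v; split.
  have -> : v = (fun x => u 0%N x - (u 0%N x - v x)).
    by apply/funext => x; ring.
  exact: square_integrableB.
2: by apply: filterS aeG => x; exact: vE.
move=> n; rewrite -lee_fin; apply: le_trans (bound n).
rewrite le_eqVlt; apply/orP; left; apply/eqP.
by rewrite /Rintegral fineK//; exact: (integrable_fin_num measurableT (i1 n).2).
Unshelve. all: by end_near. Qed.

End SquareIntegrable.

(** * Complex-valued square integrable functions and their inner product *)

Section ComplexL2.
Context {R : realType}.
Local Notation mu := (@lebesgue_measure R).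
Local Notation Re := (@complex.Re R).
Local Notation Im := (@complex.Im R).
Implicit Types (f g h u v w : R -> R[i]) (z k : R[i]).

Lemma Re_mul z k : Re (z * k) = Re z * Re k - Im z * Im k.
Proof. by case: z => a b; case: k. Qed.

Lemma Im_mul z k : Im (z * k) = Re z * Im k + Im z * Re k.
Proof. by case: z => a b; case: k. Qed.

Lemma Re_add z k : Re (z + k) = Re z + Re k.
Proof. by case: z => a b; case: k. Qed.

Lemma Im_add z k : Im (z + k) = Im z + Im k.
Proof. by case: z => a b; case: k. Qed.

Lemma Re_opp z : Re (- z) = - Re z.
Proof. by case: z. Qed.

Lemma Im_opp z : Im (- z) = - Im z.
Proof. by case: z. Qed.

Lemma cRe_conj z : Re (conjc z) = Re z.
Proof. by case: z. Qed.

Lemma cIm_conj z : Im (conjc z) = - Im z.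
Proof. by case: z. Qed.

Definition ReImE := (Re_mul, Im_mul, Re_add, Im_add, Re_opp, Im_opp, cRe_conj, cIm_conj).

Lemma complex_ext z k : Re z = Re k -> Im z = Im k -> z = k.
Proof. by case: z => a b; case: k => c d /= -> ->. Qed.

Definition cabs2 z : R := Re z ^+ 2 + Im z ^+ 2.

Lemma normc_sqr z : Normc.normc z ^+ 2 = cabs2 z.
Proof. by case: z => a b; rewrite /Normc.normc sqr_sqrtr// addr_ge0 ?sqr_ge0. Qed.

Lemma cabs2_ge0 z : 0 <= cabs2 z.
Proof. by rewrite addr_ge0 ?sqr_ge0. Qed.

Lemma cabs2M z k : cabs2 (z * k) = cabs2 z * cabs2 k.
Proof. by rewrite /cabs2 !ReImE; ring. Qed.

Lemma cabs2_eq0 z : cabs2 z = 0 -> z = 0.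
Proof.
move=> /eqP; rewrite paddr_eq0 ?sqr_ge0// !sqrf_eq0 => /andP[/eqP rz /eqP iz].
exact: complex_ext.
Qed.

Definition cintegrable f : Prop :=
  mu.-integrable setT (EFin \o (Re \o f)) /\ mu.-integrable setT (EFin \o (Im \o f)).

Lemma CintegralD f g : cintegrable f -> cintegrable g ->
  Cintegral (fun x => f x + g x) = Cintegral f + Cintegral g.
Proof.
move=> [rf If] [rg Ig]; apply: complex_ext; rewrite !ReImE /Cintegral /=.
  by rewrite -RintegralD//; apply: eq_Rintegral => x _; rewrite ReImE.
by rewrite -RintegralD//; apply: eq_Rintegral => x _; rewrite ReImE.
Qed.

Lemma cintegrableD f g : cintegrable f -> cintegrable g ->
  cintegrable (fun x => f x + g x).
Proof.
move=> [rf If] [rg Ig]; split.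
  have := rintegrableD (mu := mu) measurableT rf rg.
  by congr (_.-integrable _ _); apply/funext => x /=; rewrite ReImE.
have := rintegrableD (mu := mu) measurableT If Ig.
by congr (_.-integrable _ _); apply/funext => x /=; rewrite ReImE.
Qed.

Lemma cintegrableZ k f : cintegrable f -> cintegrable (fun x => k * f x).
Proof.
move=> [rf If]; split.
  have := rintegrableB (mu := mu) measurableT
    (rintegrableZ (mu := mu) measurableT (Re k) rf)
    (rintegrableZ (mu := mu) measurableT (Im k) If).
  by congr (_.-integrable _ _); apply/funext => x /=; rewrite ReImE.
have := rintegrableD (mu := mu) measurableT
  (rintegrableZ (mu := mu) measurableT (Re k) If)
  (rintegrableZ (mu := mu) measurableT (Im k) rf).
by congr (_.-integrable _ _); apply/funext => x /=; rewrite ReImE.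
Qed.

Lemma CintegralZ k f : cintegrable f ->
  Cintegral (fun x => k * f x) = k * Cintegral f.
Proof.
move=> [rf If]; apply: complex_ext; rewrite !ReImE /Cintegral /=.
  rewrite -!RintegralZl// -RintegralB//; try exact: rintegrableZ.
  by apply: eq_Rintegral => x _; rewrite ReImE.
rewrite -!RintegralZl// -RintegralD//; try exact: rintegrableZ.
by apply: eq_Rintegral => x _; rewrite ReImE.
Qed.

Lemma Cintegral_conj f : cintegrable f ->
  Cintegral (fun x => conjc (f x)) = conjc (Cintegral f).
Proof.
move=> [rf If]; apply: complex_ext; rewrite !ReImE /Cintegral /=.
  by apply: eq_Rintegral => x _; rewrite ReImE.
rewrite -mulN1r -RintegralZl//.
by apply: eq_Rintegral => x _; rewrite ReImE mulN1r.
Qed.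

Lemma eq_Cintegral f g : f =1 g -> Cintegral f = Cintegral g.
Proof. by move=> fg; congr Cintegral; exact/funext. Qed.

Lemma Cintegral_ae f g : cmeasurable f -> cmeasurable g ->
  {ae mu, forall x, f x = g x} -> Cintegral f = Cintegral g.
Proof.
move=> [rf If] [rg Ig] fg; apply: complex_ext; rewrite /Cintegral /=.
  by apply: Rintegral_ae => //; apply: aeS fg => x ->.
by apply: Rintegral_ae => //; apply: aeS fg => x ->.
Qed.

Lemma cmeasurableD f g : cmeasurable f -> cmeasurable g ->
  cmeasurable (fun x => f x + g x).
Proof.
move=> [rf If] [rg Ig]; split.
  have -> : (fun x => Re (f x + g x)) = (fun x => Re (f x) + Re (g x)).
    by apply/funext => x; rewrite ReImE.
  exact: measurable_funD.
have -> : (fun x => Im (f x + g x)) = (fun x => Im (f x) + Im (g x)).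
  by apply/funext => x; rewrite ReImE.
exact: measurable_funD.
Qed.

Lemma cmeasurableM f g : cmeasurable f -> cmeasurable g ->
  cmeasurable (fun x => f x * g x).
Proof.
move=> [rf If] [rg Ig]; split.
  have -> : (fun x => Re (f x * g x)) = (fun x => Re (f x) * Re (g x) - Im (f x) * Im (g x)).
    by apply/funext => x; rewrite ReImE.
  by apply: measurable_funB; exact: measurable_funM.
have -> : (fun x => Im (f x * g x)) = (fun x => Re (f x) * Im (g x) + Im (f x) * Re (g x)).
  by apply/funext => x; rewrite ReImE.
by apply: measurable_funD; exact: measurable_funM.
Qed.

Lemma cmeasurable_cst k : cmeasurable (cst k).
Proof. by split; exact: measurable_cst. Qed.

Lemma cmeasurable_conj f : cmeasurable f -> cmeasurable (fun x => conjc (f x)).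
Proof.
move=> [rf If]; split.
  by have -> : (fun x => Re (conjc (f x))) = (fun x => Re (f x))
    by apply/funext => x; rewrite ReImE.
have -> : (fun x => Im (conjc (f x))) = (fun x => - Im (f x)).
  by apply/funext => x; rewrite ReImE.
exact: measurableT_comp.
Qed.

Lemma cmeasurable_real (phi : R -> R) : measurable_fun setT phi ->
  cmeasurable (fun x => (phi x)%:C).
Proof. by move=> mphi; split => //; exact: measurable_cst. Qed.

(** The squared norm as a real number: inequalities between such quantities are polynomial and
    involve neither square roots nor extended reals. *)
Definition norm2 f : R := \int[mu]_x cabs2 (f x).

Lemma L2P f : L2 f <-> square_integrable mu (Re \o f) /\ square_integrable mu (Im \o f).
Proof.
have key : cmeasurable f -> (\int[mu]_x `|(Normc.normc (f x))%:E| `^ 2 =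
    \int[mu]_x (cabs2 (f x))%:E)%E.
  move=> _; apply: eq_integral => x _.
  rewrite /= ger0_norm ?powR_mulrn ?normc_sqr//; by case: (f x) => a b; exact: sqrtr_ge0.
have n2 : L2norm f = (L2norm f `^ 2 `^ 2^-1)%E.
  by rewrite -poweRrM mulfV// poweRe1// Lnorm_ge0.
have E : cmeasurable f -> (L2norm f `^ 2 = \int[mu]_x (cabs2 (f x))%:E)%E.
  by move=> mf; rewrite /L2norm poweR_Lnorm// key.
split.
  move=> [mf fy]; have [mr mi] := mf.
  have fin : (\int[mu]_x (cabs2 (f x))%:E < +oo)%E.
    by rewrite -E// poweR_lty.
  have mc : measurable_fun setT (fun x => cabs2 (f x)).
    by apply: measurable_funD; exact: measurable_funX.
  have ic : mu.-integrable setT (EFin \o (fun x => cabs2 (f x))).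
    apply/integrableP; split; first exact/measurable_EFinP.
    apply: le_lt_trans fin; rewrite le_eqVlt; apply/orP; left; apply/eqP.
    by apply: eq_integral => x _; rewrite /= ger0_norm ?cabs2_ge0.
  split; split => //; apply: (rintegrable_le (mu := mu) measurableT _ ic).
  - exact: measurable_funX.
  - by move=> x _; rewrite ger0_norm ?sqr_ge0// /cabs2 lerDl sqr_ge0.
  - exact: measurable_funX.
  - by move=> x _; rewrite ger0_norm ?sqr_ge0// /cabs2 lerDr sqr_ge0.
move=> [[mr ir] [mi ii]]; have mf : cmeasurable f by split.
split => //; rewrite n2 E//; apply: poweR_lty.
have := integrable_lty measurableT (rintegrableD (mu := mu) measurableT ir ii).
by [].
Qed.

Lemma cabs2_integrable f : L2 f -> mu.-integrable setT (EFin \o (fun x => cabs2 (f x))).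
Proof. by move=> /L2P[[_ ir] [_ ii]]; exact: rintegrableD. Qed.

Lemma norm2_ge0 f : 0 <= norm2 f.
Proof. by apply: Rintegral_ge0 => x _; exact: cabs2_ge0. Qed.

Lemma L2normE f : L2 f -> L2norm f = (Num.sqrt (norm2 f))%:E.
Proof.
move=> Lf; have ic := cabs2_integrable Lf.
rewrite /L2norm unlock /=.
have -> : (\int[mu]_x `|(Normc.normc (f x))%:E| `^ 2 = (norm2 f)%:E)%E.
  rewrite /norm2 /Rintegral fineK; last exact: (integrable_fin_num _ ic).
  apply: eq_integral => x _.
  rewrite /= ger0_norm ?powR_mulrn ?normc_sqr//; by case: (f x) => a b; exact: sqrtr_ge0.
by rewrite poweR_EFin powR12_sqrt// norm2_ge0.
Qed.

Lemma L2D f g : L2 f -> L2 g -> L2 (fun x => f x + g x).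
Proof.
move=> /L2P[rf If] /L2P[rg Ig]; apply/L2P; split.
  have -> : Re \o (fun x => f x + g x) = (fun x => Re (f x) + Re (g x)).
    by apply/funext => x; rewrite /= ReImE.
  exact: square_integrableD.
have -> : Im \o (fun x => f x + g x) = (fun x => Im (f x) + Im (g x)).
  by apply/funext => x; rewrite /= ReImE.
exact: square_integrableD.
Qed.

Lemma L2Z k f : L2 f -> L2 (fun x => k * f x).
Proof.
move=> /L2P[rf If]; apply/L2P; split.
  have -> : Re \o (fun x => k * f x) = (fun x => Re k * Re (f x) - Im k * Im (f x)).
    by apply/funext => x; rewrite /= ReImE.
  by apply: square_integrableB; exact: square_integrableZ.
have -> : Im \o (fun x => k * f x) = (fun x => Re k * Im (f x) + Im k * Re (f x)).
  by apply/funext => x; rewrite /= ReImE.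
by apply: square_integrableD; exact: square_integrableZ.
Qed.

Lemma L2N f : L2 f -> L2 (fun x => - f x).
Proof.
move=> /(L2Z (-1)); congr L2; by apply/funext => x; rewrite mulN1r.
Qed.

Lemma L2B f g : L2 f -> L2 g -> L2 (fun x => f x - g x).
Proof. by move=> Lf Lg; apply: L2D => //; exact: L2N. Qed.

Lemma L2conj f : L2 f -> L2 (fun x => conjc (f x)).
Proof.
move=> /L2P[rf If]; apply/L2P; split.
  by have -> : Re \o (fun x => conjc (f x)) = Re \o f
    by apply/funext => x; rewrite /= ReImE.
have -> : Im \o (fun x => conjc (f x)) = (fun x => -1 * Im (f x)).
  by apply/funext => x; rewrite /= ReImE mulN1r.
exact: square_integrableZ.
Qed.

Lemma L2M f g : L2 f -> L2 g -> cintegrable (fun x => f x * g x).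
Proof.
move=> /L2P[rf If] /L2P[rg Ig]; split.
  have := rintegrableB (mu := mu) measurableT (square_integrableM rf rg) (square_integrableM If Ig).
  by congr (_.-integrable _ _); apply/funext => x /=; rewrite ReImE.
have := rintegrableD (mu := mu) measurableT (square_integrableM rf Ig) (square_integrableM If rg).
by congr (_.-integrable _ _); apply/funext => x /=; rewrite ReImE.
Qed.

Lemma L2_ae f g : L2 f -> cmeasurable g -> {ae mu, forall x, f x = g x} -> L2 g.
Proof.
move=> /L2P[[mr ir] [mi ii]] [mgr mgi] fg; apply/L2P; split; split => //.
  apply: (rintegrable_ae measurableT _ _ _ ir); try exact: measurable_funX.
  by apply: aeS fg => x /= ->.
apply: (rintegrable_ae measurableT _ _ _ ii); try exact: measurable_funX.
by apply: aeS fg => x /= ->.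
Qed.

Lemma inner_comb k f g h : L2 f -> L2 g -> L2 h ->
  L2inner (fun x => k * f x + g x) h = k * L2inner f h + L2inner g h.
Proof.
move=> Lf Lg Lh; have i1 := L2M Lf (L2conj Lh); have i2 := L2M Lg (L2conj Lh).
rewrite /L2inner -CintegralZ// -CintegralD//; last exact: cintegrableZ.
by apply: eq_Cintegral => x; rewrite mulrDl mulrA.
Qed.

Lemma inner_sym f g : L2 f -> L2 g -> L2inner f g = conjc (L2inner g f).
Proof.
move=> Lf Lg; rewrite /L2inner -Cintegral_conj; last exact: L2M Lg (L2conj Lf).
by apply: eq_Cintegral => x; rewrite rmorphM/= conjcK mulrC.
Qed.

Lemma inner_comb_r k f g h : L2 f -> L2 g -> L2 h ->
  L2inner h (fun x => k * f x + g x) = conjc k * L2inner h f + L2inner h g.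
Proof.
move=> Lf Lg Lh; rewrite inner_sym//; last by apply: L2D => //; exact: L2Z.
by rewrite inner_comb// rmorphD rmorphM (inner_sym Lh Lf) (inner_sym Lh Lg).
Qed.

Lemma inner_ae f f' g g' : L2 f -> L2 f' -> L2 g -> L2 g' ->
  {ae mu, forall x, f x = f' x} -> {ae mu, forall x, g x = g' x} ->
  L2inner f g = L2inner f' g'.
Proof.
move=> [mf _] [mf' _] [mg _] [mg' _] ff gg; apply: Cintegral_ae.
- by apply: cmeasurableM => //; exact: cmeasurable_conj.
- by apply: cmeasurableM => //; exact: cmeasurable_conj.
- by apply: aeS (aeI ff gg) => x [-> ->].
Qed.

Lemma inner_diag f : L2 f -> L2inner f f = (norm2 f)%:C.
Proof.
move=> Lf; apply: complex_ext; rewrite /= /norm2.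
  by apply: eq_Rintegral => x _; rewrite !ReImE /cabs2; ring.
rewrite -[RHS](mul0r (fine (mu setT))) -Rintegral_cst//.
by apply: eq_Rintegral => x _; rewrite !ReImE; ring.
Qed.

Lemma norm2_eq0 f : L2 f -> norm2 f = 0 -> {ae mu, forall x, f x = 0}.
Proof.
move=> Lf f0; have ic := cabs2_integrable Lf.
have : ae_eq mu setT (EFin \o (fun x => cabs2 (f x))) (cst 0%E).
  apply: (ae_eq_integral_abs mu measurableT (measurable_int _ ic)).1.
  have fE : (\int[mu]_x (cabs2 (f x))%:E = 0)%E.
    rewrite -[LHS]fineK; last exact: (integrable_fin_num _ ic).
    by congr EFin; exact: f0.
  by rewrite -fE; apply: eq_integral => x _; rewrite /= ger0_norm// cabs2_ge0.
move=> h; apply: (aeS _ h) => x hx; apply: cabs2_eq0.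
by have [] : (cabs2 (f x))%:E = 0%:E := hx I.
Qed.

End ComplexL2.

(* Generalizing keeps [ring] from comparing inner products up to conversion. *)
Ltac inner_ring := repeat match goal with
  |- context [L2inner ?f ?g] => generalize (L2inner f g); intro end; ring.

(** * The form domain of the harmonic oscillator *)

Section Sobolev.
Context {R : realType}.
Local Notation mu := (@lebesgue_measure R).
Local Notation Re := (@complex.Re R).
Local Notation Im := (@complex.Im R).
Implicit Types (f g h u v w : R -> R[i]) (z k : R[i]) (phi : R -> R).

Lemma AC_eq (f f2 g g2 : R -> R) : AC f g -> f =1 f2 -> g =1 g2 -> AC f2 g2.
Proof. by move=> + /funext <- /funext <-. Qed.

Definition cAC f g : Prop := AC (Re \o f) (Re \o g) /\ AC (Im \o f) (Im \o g).

Lemma cAC_comb k f f' g g' : cAC f f' -> cAC g g' ->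
  cAC (fun x => k * f x + g x) (fun x => k * f' x + g' x).
Proof.
move=> [rf If] [rg Ig]; split.
  apply: (AC_eq (ACD (ACD (ACZ (Re k) rf) (ACZ (- Im k) If)) rg)) => x /=;
    by rewrite !ReImE; ring.
by apply: (AC_eq (ACD (ACD (ACZ (Re k) If) (ACZ (Im k) rf)) Ig)) => x /=;
  rewrite !ReImE; ring.
Qed.

Lemma cACM f f' g g' : cAC f f' -> cAC g g' ->
  cAC (fun x => f x * g x) (fun x => f' x * g x + f x * g' x).
Proof.
move=> [rf If] [rg Ig]; split.
  by apply: (AC_eq (ACD (ACM rf rg) (ACZ (-1) (ACM If Ig)))) => x /=;
    rewrite !ReImE; ring.
by apply: (AC_eq (ACD (ACM rf Ig) (ACM If rg))) => x /=; rewrite !ReImE; ring.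
Qed.

Lemma cAC_conj f f' : cAC f f' -> cAC (fun x => conjc (f x)) (fun x => conjc (f' x)).
Proof.
move=> [rf If]; split.
  by apply: (AC_eq rf) => x /=; rewrite !ReImE.
by apply: (AC_eq (ACZ (-1) If)) => x /=; rewrite !ReImE mulN1r.
Qed.

Lemma AC_cst (c : R) : AC (cst c) (cst 0).
Proof.
apply: has_derivative_AC; first by move=> x; exact: is_derive_cst.
by move=> x; exact: cvg_cst.
Qed.

Lemma cAC_id : cAC (fun x => x%:C) (cst 1).
Proof. by split; [exact: AC_id|exact: AC_cst]. Qed.

Lemma cAC_Cintegral_eq0 f g : cAC f g -> cintegrable f -> cintegrable g ->
  Cintegral g = 0.
Proof.
move=> [rf If] [irf iIf] [irg iIg]; apply: complex_ext; rewrite /Cintegral /=.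
  exact: AC_Rintegral_eq0 rf irf irg.
exact: AC_Rintegral_eq0 If iIf iIg.
Qed.

Lemma cAC_cmeasurable f g : cAC f g -> cmeasurable f /\ cmeasurable g.
Proof.
move=> [rf If]; split; last by split; [exact: rf.1.1|exact: If.1.1].
by split; apply: continuous_measurable_fun; [exact: AC_continuous rf|exact: AC_continuous If].
Qed.

Lemma cAC_ae f g g' : cAC f g -> cmeasurable g' -> {ae mu, forall x, g x = g' x} ->
  cAC f g'.
Proof.
move=> [rf If] [mr mi] gg; split.
  by apply: AC_ae rf mr _; apply: aeS gg => x /= ->.
by apply: AC_ae If mi _; apply: aeS gg => x /= ->.
Qed.

Lemma square_integrable_locally_summable (f : R -> R) :
  square_integrable mu f -> locally_summable f.
Proof.
move=> [mf fi]; split => // a b.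
apply: (@rintegrable_le _ _ _ mu `[a, b] (measurable_itv _) _ (fun x => 1 + f x ^+ 2)).
- exact: measurable_funTS.
- apply: rintegrableD => //; last exact: integrableS fi.
  by apply: (continuous_locally_summable _).2 => x; exact: cvg_cst.
- move=> x _; rewrite -[f x ^+ 2]real_normK ?num_real//.
  by move: `|f x| => y; nra.
Qed.

Definition clocally_summable f : Prop :=
  locally_summable (Re \o f) /\ locally_summable (Im \o f).

Lemma L2_clocally_summable f : L2 f -> clocally_summable f.
Proof.
by move=> /L2P[rf If]; split; exact: square_integrable_locally_summable.
Qed.

(** Test functions are real-valued, so real and imaginary parts do not mix. *)
Lemma is_weak_derivativeP f g : is_weak_derivative f g <->
  weakly_derives (Re \o f) (Re \o g) /\ weakly_derives (Im \o f) (Im \o g).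
Proof.
have eR h phi : \int[mu]_x Re (h x * (phi x)%:C) = \int[mu]_x ((Re \o h) x * phi x).
  by apply: eq_Rintegral => x _; rewrite !ReImE /= mulr0 subr0.
have eI h phi : \int[mu]_x Im (h x * (phi x)%:C) = \int[mu]_x ((Im \o h) x * phi x).
  by apply: eq_Rintegral => x _; rewrite !ReImE /= mulr0 add0r.
split.
  move=> fg; split=> phi /fg; rewrite /Cintegral !eR !eI => /eqP; rewrite eq_complex/=.
    by case/andP => /eqP.
  by case/andP => _ /eqP.
move=> [wr wi] phi tphi; rewrite /Cintegral !eR !eI.
by apply: complex_ext; rewrite ReImE /=; [exact: wr|exact: wi].
Qed.

Lemma weakly_derives_ae (f f' g : R -> R) : measurable_fun setT f ->
  measurable_fun setT f' -> {ae mu, forall x, f x = f' x} ->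
  weakly_derives f g -> weakly_derives f' g.
Proof.
move=> mf mf' ff' w phi tphi; rewrite -w//.
have [N [_ cphi _ _]] := test_functionP tphi.
have mphi := continuous_measurable_fun cphi.
apply: Rintegral_ae => //; try exact: measurable_funM.
by apply: aeS ff' => x ->.
Qed.

Lemma weak_derivativeP f : W12 f ->
  L2 (weak_derivative f) /\ is_weak_derivative f (weak_derivative f).
Proof. by move=> [_ fW]; exact: (xgetPex (cst 0) fW). Qed.

Lemma weak_derivative_unique f g : W12 f -> L2 g -> is_weak_derivative f g ->
  {ae mu, forall x, weak_derivative f x = g x}.
Proof.
move=> fW Lg fg; have [Ld fd] := weak_derivativeP fW.
have [lr li] := L2_clocally_summable fW.1.
have [lgr lgi] := L2_clocally_summable Lg.
have [ldr ldi] := L2_clocally_summable Ld.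
have [dr di] := (is_weak_derivativeP _ _).1 fd.
have [gr gi] := (is_weak_derivativeP _ _).1 fg.
have ar := weakly_derives_unique lr ldr lgr dr gr.
have ai := weakly_derives_unique li ldi lgi di gi.
by apply: aeS (aeI ar ai) => x [/= xr xi]; exact: complex_ext.
Qed.

(** Local summability, rather than membership in [L^2], is what the construction of the resolvent
    can offer: there [g] involves [mulx u] before that is known to be in [L^2]. *)
Lemma weak_cAC f g : clocally_summable f -> clocally_summable g ->
  is_weak_derivative f g -> exists f0, cAC f0 g /\ {ae mu, forall x, f x = f0 x}.
Proof.
move=> [lr li] [lgr lgi] /is_weak_derivativeP[wr wi].
have [f1 [ac1 e1]] := weakly_derives_AC lr lgr wr.
have [f2 [ac2 e2]] := weakly_derives_AC li lgi wi.
exists (fun x => f1 x +i* f2 x); split; first by split.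
by apply: aeS (aeI e1 e2) => x [/= xr xi]; exact: complex_ext.
Qed.

Lemma W12_cAC f : W12 f -> exists f0,
  cAC f0 (weak_derivative f) /\ {ae mu, forall x, f x = f0 x}.
Proof.
move=> fW; have [Ld fd] := weak_derivativeP fW.
by apply: weak_cAC fd; [exact: L2_clocally_summable fW.1|exact: L2_clocally_summable].
Qed.

Lemma cAC_W12 f f0 g : L2 f -> L2 g -> cAC f0 g -> {ae mu, forall x, f x = f0 x} ->
  W12 f /\ {ae mu, forall x, weak_derivative f x = g x}.
Proof.
move=> Lf Lg ac ff0; have [[mr mi] _] := Lf.
have [[m0r m0i] _] := cAC_cmeasurable ac; have [acr aci] := ac.
have fg : is_weak_derivative f g.
  apply/is_weak_derivativeP; split.
    apply: weakly_derives_ae (AC_weakly_derives acr) => //.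
    by apply: aeS ff0 => x /= ->.
  apply: weakly_derives_ae (AC_weakly_derives aci) => //.
  by apply: aeS ff0 => x /= ->.
have fW : W12 f by split => //; exists g.
by split => //; exact: weak_derivative_unique.
Qed.

Lemma W12_comb k f g : W12 f -> W12 g -> W12 (fun x => k * f x + g x) /\
  {ae mu, forall x, weak_derivative (fun x => k * f x + g x) x =
     k * weak_derivative f x + weak_derivative g x}.
Proof.
move=> fW gW; have [f0 [acf ff]] := W12_cAC fW; have [g0 [acg gg]] := W12_cAC gW.
apply: (cAC_W12 _ _ (cAC_comb k acf acg)).
- by apply: L2D; [exact/L2Z/fW.1|exact: gW.1].
- by apply: L2D; [exact/L2Z/(weak_derivativeP fW).1|exact: (weak_derivativeP gW).1].
- by apply: aeS (aeI ff gg) => x [-> ->].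
Qed.

Lemma W12_conj f : W12 f -> W12 (fun x => conjc (f x)) /\
  {ae mu, forall x, weak_derivative (fun x => conjc (f x)) x = conjc (weak_derivative f x)}.
Proof.
move=> fW; have [f0 [acf ff]] := W12_cAC fW.
apply: (cAC_W12 _ _ (cAC_conj acf)).
- exact: L2conj fW.1.
- exact: L2conj (weak_derivativeP fW).1.
- by apply: aeS ff => x ->.
Qed.

Definition mulx f : R -> R[i] := fun x => x%:C * f x.

Lemma conjc_mul z k : conjc (z * k) = conjc z * conjc k.
Proof. by apply: complex_ext; rewrite !ReImE; ring. Qed.

Lemma conj_mulx f x : conjc (mulx f x) = x%:C * conjc (f x).
Proof. by rewrite /mulx conjc_mul conjc_real. Qed.

Lemma cmeasurable_mulx f : cmeasurable f -> cmeasurable (mulx f).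
Proof.
move=> mf; apply: cmeasurableM => //; apply: cmeasurable_real.
exact: measurable_id.
Qed.

Lemma HO_domP f : HO_dom f <-> W12 f /\ L2 (mulx f).
Proof.
have key : W12 f -> (\int[mu]_x (x ^+ 2 * Normc.normc (f x) ^+ 2)%:E =
    \int[mu]_x (cabs2 (mulx f x))%:E)%E.
  move=> _; apply: eq_integral => x _.
  by rewrite normc_sqr cabs2M /cabs2 /= expr0n addr0.
split.
  move=> [fW]; rewrite key// => fy; split => //.
  have [mr mi] := cmeasurable_mulx fW.1.1.
  have mc : measurable_fun setT (fun x => cabs2 (mulx f x)).
    by apply: measurable_funD; exact: measurable_funX.
  have ic : mu.-integrable setT (EFin \o (fun x => cabs2 (mulx f x))).
    apply/integrableP; split; first exact/measurable_EFinP.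
    apply: le_lt_trans fy; rewrite le_eqVlt; apply/orP; left; apply/eqP.
    by apply: eq_integral => x _; rewrite /= ger0_norm ?cabs2_ge0.
  apply/L2P; split; split => //; apply: (rintegrable_le (mu := mu) measurableT _ ic).
  - exact: measurable_funX.
  - by move=> x _; rewrite ger0_norm ?sqr_ge0// /cabs2 lerDl sqr_ge0.
  - exact: measurable_funX.
  - by move=> x _; rewrite ger0_norm ?sqr_ge0// /cabs2 lerDr sqr_ge0.
move=> [fW Lx]; split => //; rewrite key//.
have := integrable_lty measurableT (cabs2_integrable Lx).
by [].
Qed.

Lemma HO_dom_comb k f g : HO_dom f -> HO_dom g -> HO_dom (fun x => k * f x + g x).
Proof.
move=> /HO_domP[fW Lf] /HO_domP[gW Lg]; apply/HO_domP; split.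
  by have [] := W12_comb k fW gW.
have -> : mulx (fun x => k * f x + g x) = (fun x => k * mulx f x + mulx g x).
  by apply/funext => x; rewrite /mulx; ring.
by apply: L2D => //; exact: L2Z.
Qed.

Lemma HO_dom_conj f : HO_dom f -> HO_dom (fun x => conjc (f x)).
Proof.
move=> /HO_domP[fW Lf]; apply/HO_domP; split; first by have [] := W12_conj fW.
have -> : mulx (fun x => conjc (f x)) = (fun x => conjc (mulx f x)).
  by apply/funext => x; rewrite conj_mulx.
exact: L2conj.
Qed.

Lemma mulx_inner f g : L2inner (mulx f) (mulx g) =
  Cintegral (fun x => (x ^+ 2)%:C * f x * conjc (g x)).
Proof.
by apply: eq_Cintegral => x; rewrite conj_mulx /mulx rmorphXn /=; ring.
Qed.

Lemma inner_mulx_swap f g : L2inner (mulx f) g = L2inner f (mulx g).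
Proof.
by apply: eq_Cintegral => x; rewrite conj_mulx /mulx; ring.
Qed.

(** The integral of [(f conj g)'] vanishes; representatives are changed to absolutely continuous
    ones first. *)
Lemma weak_derivative_skew f g : W12 f -> W12 g ->
  L2inner (weak_derivative f) g + L2inner f (weak_derivative g) = 0.
Proof.
move=> fW gW; have [f0 [acf ff]] := W12_cAC fW; have [g0 [acg gg]] := W12_cAC gW.
have [Lf Lg] := (fW.1, gW.1).
have [Ldf _] := weak_derivativeP fW; have [Ldg _] := weak_derivativeP gW.
have [mf0 _] := cAC_cmeasurable acf; have [mg0 _] := cAC_cmeasurable acg.
have Lf0 := L2_ae Lf mf0 ff; have Lg0 := L2_ae Lg mg0 gg.
rewrite (inner_ae Ldf Ldf Lg Lg0 _ gg); last exact: aeW.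
rewrite (inner_ae Lf Lf0 Ldg Ldg ff); last exact: aeW.
have i1 := L2M Ldf (L2conj Lg0); have i2 := L2M Lf0 (L2conj Ldg).
rewrite /L2inner -CintegralD//.
apply: (cAC_Cintegral_eq0 (cACM acf (cAC_conj acg))); last exact: cintegrableD.
exact: L2M Lf0 (L2conj Lg0).
Qed.

(** The integral of [(x f conj g)'] vanishes. This is the weak form of [[d/dx, x] = 1], the
    commutator responsible for [A B - B A = 2 k]. *)
Lemma weak_derivative_skew_mulx f g : HO_dom f -> HO_dom g ->
  L2inner f g + L2inner (weak_derivative f) (mulx g) +
  L2inner (mulx f) (weak_derivative g) = 0.
Proof.
move=> /HO_domP[fW Lxf] /HO_domP[gW Lxg].
have [f0 [acf ff]] := W12_cAC fW; have [g0 [acg gg]] := W12_cAC gW.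
have [Lf Lg] := (fW.1, gW.1).
have [Ldf _] := weak_derivativeP fW; have [Ldg _] := weak_derivativeP gW.
have [mf0 _] := cAC_cmeasurable acf; have [mg0 _] := cAC_cmeasurable acg.
have Lf0 := L2_ae Lf mf0 ff; have Lg0 := L2_ae Lg mg0 gg.
have xff : {ae mu, forall x, mulx f x = mulx f0 x} by apply: aeS ff => x; rewrite /mulx => ->.
have xgg : {ae mu, forall x, mulx g x = mulx g0 x} by apply: aeS gg => x; rewrite /mulx => ->.
have Lxf0 := L2_ae Lxf (cmeasurable_mulx mf0) xff.
have Lxg0 := L2_ae Lxg (cmeasurable_mulx mg0) xgg.
rewrite (inner_ae Lf Lf0 Lg Lg0 ff gg).
rewrite (inner_ae Ldf Ldf Lxg Lxg0 _ xgg); last exact: aeW.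
rewrite (inner_ae Lxf Lxf0 Ldg Ldg xff); last exact: aeW.
have i0 := L2M Lf0 (L2conj Lg0).
have i1 := L2M Ldf (L2conj Lxg0); have i2 := L2M Lxf0 (L2conj Ldg).
rewrite /L2inner -!CintegralD//; last exact: cintegrableD.
have ac := cACM cAC_id (cACM acf (cAC_conj acg)).
have E : (fun x => f0 x * conjc (g0 x) + weak_derivative f x * conjc (mulx g0 x) +
     mulx f0 x * conjc (weak_derivative g x)) =
   (fun x => cst 1 x * (f0 x * conjc (g0 x)) + x%:C * (weak_derivative f x * conjc (g0 x) +
     f0 x * conjc (weak_derivative g x))).
  by apply/funext => x; rewrite conj_mulx /mulx; ring.
rewrite E; apply: (cAC_Cintegral_eq0 ac).
  have := L2M Lxf0 (L2conj Lg0); congr cintegrable; apply/funext => x.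
  by rewrite /mulx mulrA.
by rewrite -E; apply: cintegrableD => //; exact: cintegrableD.
Qed.

(** Free coefficients let one notation cover the form of [H - z], its shift by [2 k], its rotations
    by a complex factor, and the inner product of the form domain. *)
Definition sesqui (a b k : R[i]) f g : R[i] :=
  a * L2inner (weak_derivative f) (weak_derivative g) +
  b * L2inner (mulx f) (mulx g) + k * L2inner f g.

Lemma HO_formE c z f g : HO_form c f g - z * L2inner f g = sesqui 1 c (- z) f g.
Proof. by rewrite /HO_form /sesqui mul1r mulNr mulx_inner. Qed.

Lemma sesqui_comb a b c k f g h : HO_dom f -> HO_dom g -> HO_dom h ->
  sesqui a b c (fun x => k * f x + g x) h = k * sesqui a b c f h + sesqui a b c g h.
Proof.
move=> /HO_domP[fW Lxf] /HO_domP[gW Lxg] /HO_domP[hW Lxh]; rewrite /sesqui.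
have [Ldf _] := weak_derivativeP fW; have [Ldg _] := weak_derivativeP gW.
have [Ldh _] := weak_derivativeP hW.
have [cW dE] := W12_comb k fW gW; have [Ldc _] := weak_derivativeP cW.
have -> : mulx (fun x => k * f x + g x) = (fun x => k * mulx f x + mulx g x).
  by apply/funext => x; rewrite /mulx; ring.
rewrite (inner_ae Ldc _ Ldh Ldh dE); last 2 first.
- by apply: L2D => //; exact: L2Z.
- exact: aeW.
rewrite (inner_comb k Ldf Ldg Ldh) (inner_comb k Lxf Lxg Lxh).
by rewrite (inner_comb k fW.1 gW.1 hW.1); inner_ring.
Qed.

Lemma inner_conj_swap f g : L2inner f (fun x => conjc (g x)) = L2inner g (fun x => conjc (f x)).
Proof. by apply: eq_Cintegral => x; rewrite !conjcK mulrC. Qed.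

(** The form is complex symmetric: removing the conjugation on the second argument makes it bilinear
    and symmetric. This replaces the study of the adjoint in [resolvent_unique]. *)
Lemma sesqui_conj_swap a b c f g : HO_dom f -> HO_dom g ->
  sesqui a b c f (fun x => conjc (g x)) = sesqui a b c g (fun x => conjc (f x)).
Proof.
move=> /HO_domP[fW Lxf] /HO_domP[gW Lxg]; rewrite /sesqui.
have [Ldf _] := weak_derivativeP fW; have [Ldg _] := weak_derivativeP gW.
have [fcW dfE] := W12_conj fW; have [gcW dgE] := W12_conj gW.
have xc (w : R -> R[i]) : mulx (fun x => conjc (w x)) = (fun x => conjc (mulx w x)).
  by apply/funext => x; rewrite conj_mulx.
rewrite !xc (inner_conj_swap (mulx f)) (inner_conj_swap f).
rewrite (inner_ae Ldf Ldf (weak_derivativeP gcW).1 (L2conj Ldg) _ dgE); last exact: aeW.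
rewrite (inner_ae Ldg Ldg (weak_derivativeP fcW).1 (L2conj Ldf) _ dfE); last exact: aeW.
by rewrite (inner_conj_swap (weak_derivative f)).
Qed.

Lemma Cintegral_real f phi :
  Cintegral (fun x => f x * (phi x)%:C) = L2inner f (fun x => (phi x)%:C).
Proof. by apply: eq_Cintegral => x; rewrite conjc_real. Qed.

End Sobolev.

(** * The form domain as a complete semi-inner product space *)

Section HilbertSpaceOfForms.
Context {R : realType}.
Local Notation mu := (@lebesgue_measure R).
Local Notation Re := (@complex.Re R).
Local Notation Im := (@complex.Im R).
Implicit Types (f g h u v w : R -> R[i]) (z k : R[i]) (phi : R -> R).

(* Otherwise unification unfolds inner products while looking for a match. *)
Local Opaque weak_derivative L2inner.

(** The abstract theory is over the reals, so [L^2] and the form domain are used as real spaces with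
    the real part of the inner product. *)
Definition real_comb (a : R) f g : R -> R[i] := fun x => a%:C * f x + g x.

Lemma Re_real (a : R) : Re a%:C = a.
Proof. by []. Qed.

Lemma Re_real_mul (a : R) z : Re (a%:C * z) = a * Re z.
Proof. by rewrite ReImE /= mul0r subr0. Qed.

Lemma Im_real_mul (a : R) z : Im (a%:C * z) = a * Im z.
Proof. by rewrite ReImE /= mul0r addr0. Qed.

Lemma L2_semi_inner : semi_inner (@L2 R) real_comb (fun f g => Re (L2inner f g)).
Proof.
split.
- by move=> f g Lf Lg; rewrite inner_sym// cRe_conj.
- by move=> g Lg a f h Lf Lh; rewrite inner_comb// Re_add Re_real_mul.
- by move=> f Lf; rewrite inner_diag//= norm2_ge0.
Qed.

(** The real Cauchy-Schwarz inequality is applied to [g] and to ['i * g], which bounds the real and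
    the imaginary part separately; adding the two gives the factor 2. *)
Lemma cabs2_inner_le f g : L2 f -> L2 g ->
  cabs2 (L2inner f g) <= 2 * (norm2 f * norm2 g).
Proof.
move=> Lf Lg.
have comb a u v : L2 u -> L2 v -> L2 (real_comb a u v).
  by move=> Lu Lv; apply: L2D => //; exact: L2Z.
have c1 : Re (L2inner f g) ^+ 2 <= Re (L2inner f f) * Re (L2inner g g) :=
  cauchy_schwarz comb L2_semi_inner Lf Lg.
have Lig : L2 (fun x => 'i * g x) by exact: L2Z.
have c2 : Re (L2inner f (fun x => 'i * g x)) ^+ 2 <= Re (L2inner f f) *
    Re (L2inner (fun x => 'i * g x) (fun x => 'i * g x)) :=
  cauchy_schwarz comb L2_semi_inner Lf Lig.
have E : Re (L2inner f (fun x => 'i * g x)) = Im (L2inner f g).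
  have L0 : L2 (fun x => 0 * g x) by exact: L2Z.
  have -> : (fun x => 'i * g x) = (fun x => 'i * g x + 0 * g x).
    by apply/funext => x; ring.
  rewrite (inner_comb_r 'i Lg L0 Lf).
  have -> : (fun x => 0 * g x) = (fun x => (-1) * g x + g x) by apply/funext => x; ring.
  rewrite (inner_comb_r (-1) Lg Lg Lf) rmorphN1.
  by rewrite !ReImE /=; ring.
have N : norm2 (fun x => 'i * g x) = norm2 g.
  by apply: eq_Rintegral => x _; rewrite cabs2M /cabs2 /=; ring.
by move: c1 c2; rewrite E !inner_diag// N (Re_real (norm2 f)) (Re_real (norm2 g)) /cabs2; lra.
Qed.

Lemma cabs2D z k : cabs2 (z + k) <= 2 * cabs2 z + 2 * cabs2 k.
Proof.
rewrite -subr_ge0.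
have -> : 2 * cabs2 z + 2 * cabs2 k - cabs2 (z + k) = (Re z - Re k) ^+ 2 + (Im z - Im k) ^+ 2.
  by rewrite /cabs2 !ReImE; ring.
by rewrite addr_ge0 ?sqr_ge0.
Qed.

Lemma le_geometric_eq0 (a K : R) : 0 <= a -> (forall n, a <= K * (1 / 2) ^+ n) -> a = 0.
Proof.
move=> a0 aK; apply/eqP; rewrite eq_le a0 andbT.
have cvg : K * (1 / 2 : R) ^+ n @[n --> \oo] --> (0 : R).
  rewrite -(mulr0 K); apply: cvgMr; apply: cvg_expr; rewrite ger0_norm; lra.
rewrite -(cvg_lim (@Rhausdorff R) cvg); apply: limr_ge; first by apply/cvg_ex; exists 0.
by apply: nearW => n; exact: aK.
Qed.

Lemma norm2_ae f g : cmeasurable f -> cmeasurable g -> {ae mu, forall x, f x = g x} ->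
  norm2 f = norm2 g.
Proof.
move=> [mr mi] [mr' mi'] fg; apply: Rintegral_ae => //.
- by apply: measurable_funD; exact: measurable_funX.
- by apply: measurable_funD; exact: measurable_funX.
- by apply: aeS fg => x ->.
Qed.

Lemma complex_riesz_fischer (u : nat -> R -> R[i]) (C : R) : (forall n, L2 (u n)) ->
  (forall n m, (n <= m)%N -> norm2 (fun x => u n x - u m x) <= C * (1 / 2) ^+ n) ->
  exists v, [/\ L2 v, forall n, norm2 (fun x => u n x - v x) <= (2 * C) * (1 / 2) ^+ n,
     {ae mu, forall x, Re (u n x) @[n --> \oo] --> Re (v x)}
     & {ae mu, forall x, Im (u n x) @[n --> \oo] --> Im (v x)}].
Proof.
move=> Lu uC.
have Lr n : square_integrable mu (fun x => Re (u n x)) by have /L2P[] := Lu n.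
have Li n : square_integrable mu (fun x => Im (u n x)) by have /L2P[] := Lu n.
have split_norm2 f g : L2 f -> L2 g -> norm2 (fun x => f x - g x) =
    \int[mu]_x (Re (f x) - Re (g x)) ^+ 2 + \int[mu]_x (Im (f x) - Im (g x)) ^+ 2.
  move=> /L2P[rf If] /L2P[rg Ig].
  have := (square_integrableB rf rg).2; have := (square_integrableB If Ig).2 => i1 i2.
  by rewrite -RintegralD//; apply: eq_Rintegral => x _; rewrite /cabs2 !ReImE.
have sq0 (f : R -> R) : 0 <= \int[mu]_x (f x) ^+ 2.
  by apply: Rintegral_ge0 => x _; exact: sqr_ge0.
have [|v1 [L1 b1 c1]] := riesz_fischer (C := C) Lr.
  move=> n m nm; apply: le_trans (uC n m nm); rewrite split_norm2// lerDl; exact: sq0.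
have [|v2 [L2' b2 c2]] := riesz_fischer (C := C) Li.
  move=> n m nm; apply: le_trans (uC n m nm); rewrite split_norm2// lerDr; exact: sq0.
have Lv : L2 (fun x => v1 x +i* v2 x) by apply/L2P.
exists (fun x => v1 x +i* v2 x); split => // n.
rewrite split_norm2//=; have := b1 n; have := b2 n; lra.
Qed.

Definition form_ip f g : R := Re (sesqui 1 1 1 f g).

Lemma form_ip_sum f g : form_ip f g = Re (L2inner (weak_derivative f) (weak_derivative g)) +
  Re (L2inner (mulx f) (mulx g)) + Re (L2inner f g).
Proof.
rewrite /form_ip /sesqui; move: (L2inner _ _) (L2inner _ _) (L2inner _ _) => a b c.
by rewrite !mul1r !Re_add.
Qed.

Lemma sesqui_diag a b k f : HO_dom f -> sesqui a b k f f =
  a * (norm2 (weak_derivative f))%:C + b * (norm2 (mulx f))%:C + k * (norm2 f)%:C.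
Proof.
move=> /HO_domP[fW Lxf]; rewrite /sesqui (inner_diag (weak_derivativeP fW).1).
by rewrite (inner_diag Lxf) (inner_diag fW.1).
Qed.

Lemma sesqui_comb_r a b c k f g h : HO_dom f -> HO_dom g -> HO_dom h ->
  sesqui a b c h (fun x => k * f x + g x) = conjc k * sesqui a b c h f + sesqui a b c h g.
Proof.
move=> /HO_domP[fW Lxf] /HO_domP[gW Lxg] /HO_domP[hW Lxh]; rewrite /sesqui.
have [Ldf _] := weak_derivativeP fW; have [Ldg _] := weak_derivativeP gW.
have [Ldh _] := weak_derivativeP hW.
have [cW dE] := W12_comb k fW gW; have [Ldc _] := weak_derivativeP cW.
have -> : mulx (fun x => k * f x + g x) = (fun x => k * mulx f x + mulx g x).
  by apply/funext => x; rewrite /mulx; ring.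
rewrite (inner_ae Ldh Ldh Ldc _ _ dE); last 2 first.
- by apply: L2D => //; exact: L2Z.
- exact: aeW.
rewrite (inner_comb_r k Ldf Ldg Ldh) (inner_comb_r k Lxf Lxg Lxh).
by rewrite (inner_comb_r k fW.1 gW.1 hW.1); inner_ring.
Qed.

Lemma form_ipE f : HO_dom f ->
  form_ip f f = norm2 (weak_derivative f) + norm2 (mulx f) + norm2 f.
Proof. by move=> Df; rewrite /form_ip sesqui_diag// !ReImE /= !mul0r !subr0 !mul1r. Qed.

Lemma form_semi_inner : semi_inner (@HO_dom R) real_comb form_ip.
Proof.
split.
- move=> f g /HO_domP[fW Lxf] /HO_domP[gW Lxg].
  rewrite !form_ip_sum (inner_sym (weak_derivativeP fW).1 (weak_derivativeP gW).1).
  by rewrite (inner_sym Lxf Lxg) (inner_sym fW.1 gW.1) !cRe_conj.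
- move=> g Dg a f h Df Dh; rewrite /form_ip sesqui_comb// Re_add Re_real_mul//.
- by move=> f Df; rewrite form_ipE// !addr_ge0 ?norm2_ge0.
Qed.

Lemma HO_dom_real_comb a f g : HO_dom f -> HO_dom g -> HO_dom (real_comb a f g).
Proof. exact: HO_dom_comb. Qed.

Lemma form_sqdist f g : HO_dom f -> HO_dom g -> sqdist real_comb form_ip f g =
  norm2 (fun x => weak_derivative f x - weak_derivative g x) +
  norm2 (fun x => mulx f x - mulx g x) + norm2 (fun x => f x - g x).
Proof.
move=> Df Dg; rewrite /sqdist form_ipE; last exact: HO_dom_comb.
move: Df Dg => /HO_domP[fW Lxf] /HO_domP[gW Lxg].
have [cW dE] := W12_comb (-1) gW fW; have [[mdc _] _] := weak_derivativeP cW.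
have [Ldf _] := weak_derivativeP fW; have [Ldg _] := weak_derivativeP gW.
have [md _] := L2B Ldf Ldg.
have N1 : (-1)%:C = -1 :> R[i] by rewrite rmorphN1.
congr (_ + _ + _).
- rewrite /real_comb N1; apply: norm2_ae => //.
  by apply: aeS dE => x ->; ring.
- by congr norm2; apply/funext => x; rewrite /real_comb /mulx N1; ring.
- by congr norm2; apply/funext => x; rewrite /real_comb N1; ring.
Qed.

Lemma supported_L2 (f : R -> R) (N : R) : continuous f ->
  (forall x, x \notin `[- N, N] -> f x = 0) -> L2 (fun x => (f x)%:C).
Proof.
move=> cf f0; have mf := continuous_measurable_fun cf; apply/L2P; split; split => //.
- apply: (@supported_integrable _ _ (- N) N).
    by apply: continuous_locally_summable => x; apply: cvgM; exact: cf.
  by move=> x /f0 fx; rewrite /= fx expr0n.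
- exact: measurable_cst.
- have -> : (fun x : R => (Im \o (fun x0 => (f x0)%:C)) x ^+ 2) = cst 0.
    by apply/funext => x; rewrite /= expr0n.
  exact: integrable0.
Qed.

Lemma test_function_L2 phi : test_function phi ->
  L2 (fun x => (phi x)%:C) /\ L2 (fun x => (derive1 phi x)%:C).
Proof.
move=> tphi; have [N [dp cdp s0 s1]] := test_functionP tphi.
split; last exact: supported_L2 s1.
by apply: supported_L2 s0; exact: has_derivative_continuous dp.
Qed.

Lemma test_function_HO_dom phi : test_function phi ->
  HO_dom (fun x => (phi x)%:C) /\
  {ae mu, forall x, weak_derivative (fun y => (phi y)%:C) x = (derive1 phi x)%:C}.
Proof.
move=> tphi; have [L0 L1] := test_function_L2 tphi.
have [N [dp cdp s0 s1]] := test_functionP tphi.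
have cp := has_derivative_continuous dp.
have ac : cAC (fun x => (phi x)%:C) (fun x => (derive1 phi x)%:C).
  by split; [exact: has_derivative_AC|exact: AC_cst].
have [W dE] := cAC_W12 L0 L1 ac (aeW _ (fun x => erefl)).
split => //; apply/HO_domP; split => //.
have -> : mulx (fun x => (phi x)%:C) = (fun x => (x * phi x)%:C).
  by apply/funext => x; rewrite /mulx rmorphM.
apply: (@supported_L2 _ N); last by move=> x /s0 ->; rewrite mulr0.
by move=> x; apply: cvgM; [exact: cvg_id|exact: cp].
Qed.

(** The functions, their products with [x] and their derivatives converge separately in [L^2]. The
    limits fit together by almost everywhere convergence for [mulx], and by passing to the limit
    against test functions for the derivative. *)
Lemma form_complete : rapidly_complete (@HO_dom R) real_comb form_ip.
Proof.
move=> u C Du uC.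
have uW n : W12 (u n) by have /HO_domP[] := Du n.
have Lxu n : L2 (mulx (u n)) by have /HO_domP[] := Du n.
have Lu n : L2 (u n) by have [] := uW n.
have Ldu n : L2 (weak_derivative (u n)) by have [] := weak_derivativeP (uW n).
have bound n m : (n <= m)%N -> [/\ norm2 (fun x => u n x - u m x) <= C * (1 / 2) ^+ n,
    norm2 (fun x => mulx (u n) x - mulx (u m) x) <= C * (1 / 2) ^+ n
  & norm2 (fun x => weak_derivative (u n) x - weak_derivative (u m) x) <= C * (1 / 2) ^+ n].
  move=> /uC; rewrite form_sqdist//.
  set a := norm2 _; set b := norm2 _; set c := norm2 _.
  have a0 : 0 <= a by exact: norm2_ge0.
  have b0 : 0 <= b by exact: norm2_ge0.
  have c0 : 0 <= c by exact: norm2_ge0.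
  by move=> abc; split; lra.
have [|v [Lv bv cr ci]] := complex_riesz_fischer (C := C) Lu.
  by move=> n m /bound[].
have [|y [Ly by_ ycr yci]] := complex_riesz_fischer (C := C) Lxu.
  by move=> n m /bound[].
have [|w [Lw bw _ _]] := complex_riesz_fischer (C := C) Ldu.
  by move=> n m /bound[].
have yE : {ae mu, forall x, y x = mulx v x}.
  apply: aeS (aeI (aeI cr ci) (aeI ycr yci)) => x [[c1 c2] [c3 c4]].
  rewrite /mulx; apply: complex_ext; rewrite ?Re_real_mul ?Im_real_mul.
    apply: (cvg_unique (@Rhausdorff R) c3).
    have -> : (fun n => Re (mulx (u n) x)) = (fun n => x * Re (u n x)).
      by apply/funext => n; rewrite /mulx Re_real_mul.
    exact: cvgMr.
  apply: (cvg_unique (@Rhausdorff R) c4).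
  have -> : (fun n => Im (mulx (u n) x)) = (fun n => x * Im (u n x)).
    by apply/funext => n; rewrite /mulx Im_real_mul.
  exact: cvgMr.
have Lxv : L2 (mulx v) by apply: L2_ae Ly (cmeasurable_mulx Lv.1) yE.
have vw : is_weak_derivative v w.
  move=> phi tphi; have [Lp Lp'] := test_function_L2 tphi.
  apply/eqP; rewrite -addr_eq0 !Cintegral_real; apply/eqP/cabs2_eq0.
  (* The 4 is the product of the factors 2 in [cabs2D] and [cabs2_inner_le]; each [2 * C] comes from
     [complex_riesz_fischer]. *)
  pose K := 4 * ((2 * C) * norm2 (fun x => (derive1 phi x)%:C) +
                 (2 * C) * norm2 (fun x => (phi x)%:C)).
  apply: (@le_geometric_eq0 _ K); first exact: cabs2_ge0.
  move=> n; have := (weak_derivativeP (uW n)).2 _ tphi; rewrite !Cintegral_real => un.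
  have L1 := L2B (Lu n) Lv; have L2' := L2B (Ldu n) Lw.
  have E h1 h2 p : L2 h1 -> L2 h2 -> L2 p ->
      L2inner h2 p = L2inner h1 p - L2inner (fun x => h1 x - h2 x) p.
    move=> Lh1 Lh2 Lp1; have -> : (fun x => h1 x - h2 x) = (fun x => (-1) * h2 x + h1 x).
      by apply/funext => x; ring.
    by rewrite (inner_comb (-1) Lh2 Lh1 Lp1); inner_ring.
  rewrite (E _ _ _ (Lu n) Lv Lp') (E _ _ _ (Ldu n) Lw Lp) un.
  set z1 := L2inner (fun x => u n x - v x) _; set z2 := L2inner (fun x => _ - w x) _.
  have -> : - L2inner (weak_derivative (u n)) (fun x => (phi x)%:C) - z1 +
     (L2inner (weak_derivative (u n)) (fun x => (phi x)%:C) - z2) = (- 1) * (z1 + z2).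
    by rewrite /z1 /z2; inner_ring.
  rewrite cabs2M; have -> : cabs2 (-1 : R[i]) = 1 by rewrite /cabs2 /=; ring.
  rewrite mul1r; apply: (le_trans (cabs2D _ _)).
  have i1 := cabs2_inner_le L1 Lp'; have i2 := cabs2_inner_le L2' Lp.
  rewrite -/z1 in i1; rewrite -/z2 in i2.
  have p1 := norm2_ge0 (fun x => (derive1 phi x)%:C).
  have p2 := norm2_ge0 (fun x => (phi x)%:C).
  have q1 := ler_wpM2r p1 (bv n); have q2 := ler_wpM2r p2 (bw n).
  rewrite /K; lra.
have vW : W12 v by split => //; exists w.
have wE := weak_derivative_unique vW Lw vw.
have Dv : HO_dom v by apply/HO_domP.
exists v, (6 * C); split => // n; rewrite form_sqdist//.
have [Ldv _] := weak_derivativeP vW.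
have -> : norm2 (fun x => weak_derivative (u n) x - weak_derivative v x) =
          norm2 (fun x => weak_derivative (u n) x - w x).
  apply: norm2_ae; [exact: (L2B _ _).1|exact: (L2B _ _).1|].
  by apply: aeS wE => x ->.
have -> : norm2 (fun x => mulx (u n) x - mulx v x) = norm2 (fun x => mulx (u n) x - y x).
  apply: norm2_ae; [exact: (L2B _ _).1|exact: (L2B _ _).1|].
  by apply: aeS yE => x ->.
have := bv n; have := by_ n; have := bw n; lra.
Qed.

End HilbertSpaceOfForms.

(** * Solvability of coercive form equations and decay of solutions *)

Section Solvability.
Context {R : realType}.
Local Notation mu := (@lebesgue_measure R).
Local Notation Re := (@complex.Re R).
Local Notation Im := (@complex.Im R).
Implicit Types (f g h u v w : R -> R[i]) (z k : R[i]) (phi : R -> R).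

Local Opaque weak_derivative L2inner.

Lemma HO_dom0 : HO_dom (cst 0 : R -> R[i]).
Proof.
have L0 : L2 (cst 0 : R -> R[i]).
  apply/L2P; split; split; try exact: measurable_cst;
    by under eq_fun do rewrite /= expr0n; exact: integrable0.
have ac : cAC (cst 0 : R -> R[i]) (cst 0) by split; exact: AC_cst.
have [W _] := cAC_W12 L0 L0 ac (aeW _ (fun x => erefl)).
have x0 : mulx (cst 0 : R -> R[i]) = cst 0.
  by apply/funext => x; rewrite /mulx mulr0.
by apply/HO_domP; rewrite x0.
Qed.

(** For [s = -1] and [t = k] this is the pairing of [h' + k x h] with [g], after moving the
    derivative to [g]. It makes sense for [h] merely in [L^2]. *)
Definition antilinear_form s t h g : R[i] :=
  s * L2inner h (weak_derivative g) + t * L2inner h (mulx g).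

Lemma antilinear_form_comb s t h k f g : L2 h -> HO_dom f -> HO_dom g ->
  antilinear_form s t h (fun x => k * f x + g x) =
  conjc k * antilinear_form s t h f + antilinear_form s t h g.
Proof.
move=> Lh /HO_domP[fW Lxf] /HO_domP[gW Lxg]; rewrite /antilinear_form.
have [Ldf _] := weak_derivativeP fW; have [Ldg _] := weak_derivativeP gW.
have [cW dE] := W12_comb k fW gW; have [Ldc _] := weak_derivativeP cW.
have -> : mulx (fun x => k * f x + g x) = (fun x => k * mulx f x + mulx g x).
  by apply/funext => x; rewrite /mulx; ring.
rewrite (inner_ae Lh Lh Ldc _ _ dE); last 2 first.
- by apply: L2D => //; exact: L2Z.
- exact: aeW.
by rewrite (inner_comb_r k Ldf Ldg Lh) (inner_comb_r k Lxf Lxg Lh); inner_ring.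
Qed.

Lemma sqr_Re_le z : Re z ^+ 2 <= cabs2 z.
Proof. by rewrite lerDl sqr_ge0. Qed.

Lemma antilinear_form_bound s t h g : L2 h -> HO_dom g ->
  cabs2 (antilinear_form s t h g) <=
  4 * norm2 h * (cabs2 s * norm2 (weak_derivative g) + cabs2 t * norm2 (mulx g)).
Proof.
move=> Lh /HO_domP[gW Lxg]; have [Ldg _] := weak_derivativeP gW.
apply: (le_trans (cabs2D _ _)); rewrite !cabs2M.
have := ler_wpM2l (cabs2_ge0 s) (cabs2_inner_le Lh Ldg).
have := ler_wpM2l (cabs2_ge0 t) (cabs2_inner_le Lh Lxg).
move: (cabs2 (L2inner _ _)) (cabs2 (L2inner _ _)) => a b; lra.
Qed.

Lemma sesquiZ k a b c f g : sesqui (k * a) (k * b) (k * c) f g = k * sesqui a b c f g.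
Proof. by rewrite /sesqui; inner_ring. Qed.

Lemma sesqui_bound a b c f g : HO_dom f -> HO_dom g ->
  Re (sesqui a b c f g) ^+ 2 <=
  8 * (cabs2 a + cabs2 b + cabs2 c) * (form_ip f f * form_ip g g).
Proof.
move=> Df Dg; rewrite !form_ipE//.
move: Df Dg => /HO_domP[fW Lxf] /HO_domP[gW Lxg].
have [Ldf _] := weak_derivativeP fW; have [Ldg _] := weak_derivativeP gW.
apply: (le_trans (sqr_Re_le _)).
apply: (le_trans (cabs2D _ _)).
have := cabs2D (a * L2inner (weak_derivative f) (weak_derivative g))
  (b * L2inner (mulx f) (mulx g)).
rewrite !cabs2M.
have := ler_wpM2l (cabs2_ge0 a) (cabs2_inner_le Ldf Ldg).
have := ler_wpM2l (cabs2_ge0 b) (cabs2_inner_le Lxf Lxg).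
have := ler_wpM2l (cabs2_ge0 c) (cabs2_inner_le fW.1 gW.1).
move: (cabs2_ge0 a) (cabs2_ge0 b) (cabs2_ge0 c).
move: (cabs2 a) (cabs2 b) (cabs2 c) => A B C A0 B0 C0.
move: (norm2_ge0 (weak_derivative f)) (norm2_ge0 (mulx f)) (norm2_ge0 f).
move: (norm2_ge0 (weak_derivative g)) (norm2_ge0 (mulx g)) (norm2_ge0 g).
move: (norm2 (weak_derivative f)) (norm2 (mulx f)) (norm2 f) => f1 f2 f3.
move: (norm2 (weak_derivative g)) (norm2 (mulx g)) (norm2 g) => g1 g2 g3.
move: (cabs2 (L2inner _ _)) (cabs2 (L2inner _ _)) (cabs2 (L2inner _ _)) => i1 i2 i3.
move: (cabs2 (_ + _)) => i4 g10 g20 g30 f10 f20 f30 h1 h2 h3 h4.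
set F := f1 + f2 + f3; set G := g1 + g2 + g3.
have m1 : f1 * g1 <= F * G by apply: ler_pM => //; rewrite /F /G; lra.
have m2 : f2 * g2 <= F * G by apply: ler_pM => //; rewrite /F /G; lra.
have m3 : f3 * g3 <= F * G by apply: ler_pM => //; rewrite /F /G; lra.
have := ler_wpM2l A0 m1; have := ler_wpM2l B0 m2; have := ler_wpM2l C0 m3.
have : 0 <= C * (F * G) by rewrite mulr_ge0// mulr_ge0// /F /G !addr_ge0.
move: (F * G) => FG; lra.
Qed.

(** Multiplication by [om] rotates all three coefficients into the right half-plane. The real part
    of the rotated form is then coercive, with the least of the three real parts as constant, and
    Lax-Milgram applies. *)
Lemma sesqui_solve b k om s t h : L2 h ->
  0 < Re om -> 0 < Re (om * b) -> 0 < Re (om * k) ->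
  exists2 v, HO_dom v & forall g, HO_dom g -> sesqui 1 b k v g = antilinear_form s t h g.
Proof.
move=> Lh o1 o2 o3.
pose al := Num.min (Re om) (Num.min (Re (om * b)) (Re (om * k))).
have al0 : 0 < al by rewrite !lt_min o1 o2 o3.
pose B f g := Re (om * sesqui 1 b k f g).
have BE f g : B f g = Re (sesqui om (om * b) (om * k) f g).
  by rewrite /B -sesquiZ mulr1.
pose l g := Re (om * antilinear_form s t h g).
pose K := cabs2 om * (4 * norm2 h * (cabs2 s + cabs2 t)).
pose M := 8 * (cabs2 om + cabs2 (om * b) + cabs2 (om * k)).
have K0 : 0 <= K by rewrite !mulr_ge0 ?cabs2_ge0 ?norm2_ge0// addr_ge0 ?cabs2_ge0.
have M0 : 0 <= M.
  apply: mulr_ge0; first exact: ler0n.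
  apply: addr_ge0; last exact: cabs2_ge0.
  by apply: addr_ge0; exact: cabs2_ge0.
have real_conj (a : R) : conjc a%:C = a%:C by exact: conjc_real.
have [||||||v Dv vP] := lax_milgram HO_dom_real_comb (b := B) (l := l)
  form_semi_inner form_complete HO_dom0 al0 K0 M0.
- move=> u Du a f g Df Dg.
  rewrite /B /real_comb sesqui_comb_r// real_conj mulrDr mulrCA.
  by rewrite Re_add Re_real_mul.
- move=> g Dg a f u Df Du; rewrite /B /real_comb sesqui_comb// mulrDr mulrCA.
  by rewrite Re_add Re_real_mul.
- by move=> u g Du Dg; rewrite BE; exact: sesqui_bound.
- move=> u Du; rewrite BE sesqui_diag// form_ipE// !mulrDr !Re_add.
  rewrite ![_ * (norm2 _)%:C]mulrC !Re_real_mul !(mulrC al).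
  have h1 : al <= Re om by rewrite ge_min lexx.
  have h2 : al <= Re (om * b) by rewrite !ge_min lexx orbT.
  have h3 : al <= Re (om * k) by rewrite !ge_min lexx !orbT.
  by rewrite !lerD// ler_wpM2l// norm2_ge0.
- move=> a f g Df Dg; rewrite /l /real_comb antilinear_form_comb//.
  by rewrite real_conj mulrDr mulrCA Re_add Re_real_mul.
- move=> g Dg; apply: (le_trans (sqr_Re_le _)); rewrite cabs2M /K -mulrA.
  rewrite ler_wpM2l ?cabs2_ge0//; apply: (le_trans (antilinear_form_bound s t Lh Dg)).
  rewrite -!mulrA ler_wpM2l// ler_wpM2l ?norm2_ge0// form_ipE//.
  move: (cabs2_ge0 s) (cabs2_ge0 t) (norm2_ge0 (weak_derivative g)).
  move: (norm2_ge0 (mulx g)) (norm2_ge0 g).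
  move: (cabs2 s) (cabs2 t) (norm2 (weak_derivative g)) (norm2 (mulx g)) (norm2 g).
  move=> S T x y w y0 w0 S0 T0 x0; rewrite -subr_ge0.
  have -> : (S + T) * (x + y + w) - (S * x + T * y) = S * y + S * w + T * x + T * w by ring.
  by rewrite !addr_ge0// mulr_ge0.
exists v => // g Dg.
(* Lax-Milgram only yields equality of real parts. Testing also against ['i * g + g] recovers the
   imaginary parts. *)
have Dig : HO_dom (fun x => 'i * g x + g x) by exact: HO_dom_comb.
have := vP _ Dg; have := vP _ Dig; rewrite /B /l.
rewrite sesqui_comb_r// antilinear_form_comb//.
move: (sesqui 1 b k v g) (antilinear_form s t h g) => S L e1 e2.
have : om * S = om * L.
  apply: complex_ext => //; move: e1; rewrite !mulrDr ![om * (_ * _)]mulrCA !Re_add e2.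
  by rewrite !(Re_mul (conjc 'i)) /=; lra.
have /mulfI inj : om != 0 by apply: contraTneq o1 => ->; rewrite ltxx.
exact: inj.
Qed.

(** Fatou's lemma for the truncations of [g] to [[-n, n]]. *)
Lemma bounded_itv_integrable (g : R -> R) K : locally_summable g -> (forall x, 0 <= g x) ->
  (forall n, \int[mu]_(x in `[- n%:R, n%:R]) g x <= K) -> mu.-integrable setT (EFin \o g).
Proof.
move=> [mg gi] g0 gK; apply/integrableP; split; first exact/measurable_EFinP.
apply: (@le_lt_trans _ _ K%:E); last exact: ltry.
pose gn n : R -> \bar R := (EFin \o (g \_ `[- n%:R, n%:R])).
have mgn n : measurable_fun setT (gn n).
  apply/measurable_EFinP/(measurable_restrictT _ (measurable_itv _)).
  exact: measurable_funTS.
have gn0 n x : (0 <= gn n x)%E.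
  by rewrite lee_fin patchE; case: ifP => _; [exact: g0|exact: lexx].
have E : (\int[mu]_x `|(EFin \o g) x| = \int[mu]_x limn_einf (fun n => gn n x))%E.
  apply: eq_integral => x _; rewrite /= ger0_norm//; apply/esym.
  have c : gn n x @[n --> \oo] --> (g x)%:E.
    apply: cvg_near_cst; near=> n; rewrite /gn /= patchE ifT// inE/= in_itv/=.
    by rewrite -ler_norml; near: n; exact: nbhs_infty_ger.
  by rewrite (cvg_limn_einf_sup c).
rewrite E; apply: (le_trans (@fatou _ _ _ mu setT measurableT gn mgn (fun n x _ => gn0 n x))).
rewrite limn_einf_lim; apply: lime_le.
  by apply: ereal_nondecreasing_is_cvgn; exact: nondecreasing_einfs.
near=> n; apply: ereal_inf_le.
exists (\int[mu]_x gn n x)%E; first by exists n => /=.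
have ign : mu.-integrable setT (gn n) by apply: rintegrable_patch => //; exact: gi.
rewrite -[leLHS]fineK; last exact: (integrable_fin_num _ ign).
by rewrite lee_fin; apply: le_trans (gK n); rewrite [leRHS]Rintegral_mkcond.
Unshelve. all: by end_near. Qed.

(* Integrating [(x |u|^2)'] over [[-n, n]] and dropping the nonnegative boundary
   terms bounds [\int x^2 |u|^2] uniformly in [n]. *)
Lemma mulx_L2 k u v : 0 < Re k -> L2 u -> L2 v -> L2 (mulx v) ->
  cAC u (fun x => v x - k * mulx u x) -> L2 (mulx u).
Proof.
move=> k0 Lu Lv Lxv [acr aci].
pose F x := cabs2 (u x).
pose F' x := 2 * (Re (v x) * Re (u x) + Im (v x) * Im (u x)) - 2 * Re k * x * F x.
have acF : AC F F'.
  apply: (AC_eq (ACD (ACM acr acr) (ACM aci aci))) => x /=; rewrite /F' /F /cabs2.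
    by ring.
  by rewrite !ReImE /mulx ?ReImE /=; ring.
have acxF := ACM (@AC_id R) acF.
have iF : mu.-integrable setT (EFin \o F) by exact: cabs2_integrable.
(* The derivative of [x |u|^2] is [|u|^2 + 2 x Re (v conj u) - 2 Re k x^2 |u|^2], and its cross term
   is at most [|u|^2 + x^2 |v|^2]. [G] is the resulting integrable majorant of the first two
   terms. *)
pose G x := F x + (F x + cabs2 (mulx v x)).
have iG : mu.-integrable setT (EFin \o G).
  by apply: rintegrableD => //; apply: rintegrableD => //; exact: cabs2_integrable.
have F0 x : 0 <= F x by exact: cabs2_ge0.
have cF := AC_continuous acF.
have sqE w x : cabs2 (mulx w x) = x ^+ 2 * cabs2 (w x).
  by rewrite /mulx cabs2M {1}/cabs2 /= expr0n addr0.
have lx : locally_summable (fun x => cabs2 (mulx u x)).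
  have -> : (fun x => cabs2 (mulx u x)) = (fun x => x ^+ 2 * F x).
    by apply/funext => x; exact: sqE.
  apply: continuous_locally_summable => x; apply: cvgM; last exact: cF.
  by apply: cvgM; exact: cvg_id.
have bound n : \int[mu]_(x in `[- n%:R, n%:R]) cabs2 (mulx u x) <=
    (2 * Re k)^-1 * \int[mu]_x G x.
  have n0 : 0 <= n%:R :> R by exact: ler0n.
  have nn : - n%:R <= n%:R :> R by lra.
  have i1 := acxF.1.2 (- n%:R) n%:R.
  have i2 := lx.2 (- n%:R) n%:R.
  have i3 : mu.-integrable `[- n%:R, n%:R] (EFin \o G) by exact: integrableS iG.
  have le0 : 0 <= \int[mu]_(x in `[- n%:R, n%:R]) (cst 1 x * F x + x * F' x).
    rewrite -acxF.2// mulNr opprK addr_ge0// mulr_ge0//.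
  have le1 : \int[mu]_(x in `[- n%:R, n%:R]) (cst 1 x * F x + x * F' x) <=
      \int[mu]_(x in `[- n%:R, n%:R]) (G x - 2 * Re k * cabs2 (mulx u x)).
    apply: le_Rintegral => //.
      by apply: rintegrableB => //; exact: rintegrableZ.
    move=> x _; rewrite /G /F' !sqE -subr_ge0 /F.
    have -> : cabs2 (u x) + (cabs2 (u x) + x ^+ 2 * cabs2 (v x)) -
       2 * Re k * (x ^+ 2 * cabs2 (u x)) - (1 * cabs2 (u x) +
       x * (2 * (Re (v x) * Re (u x) + Im (v x) * Im (u x)) - 2 * Re k * x * cabs2 (u x))) =
       (Re (u x) - x * Re (v x)) ^+ 2 + (Im (u x) - x * Im (v x)) ^+ 2.
      by rewrite /cabs2; ring.
    by rewrite addr_ge0 ?sqr_ge0.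
  have := le_trans le0 le1; rewrite RintegralB//; last exact: rintegrableZ.
  rewrite RintegralZl// subr_ge0 => le2.
  rewrite ler_pdivlMl; last lra.
  apply: (le_trans le2); rewrite [leLHS]Rintegral_mkcond; apply: le_Rintegral => //.
    exact: rintegrable_restrict.
  move=> x _; rewrite patchE; case: ifP => _; first exact: lexx.
  by apply: addr_ge0; [exact: F0|apply: addr_ge0; [exact: F0|exact: cabs2_ge0]].
have ix := bounded_itv_integrable lx (fun x => cabs2_ge0 _) bound.
have [mr mi] := cmeasurable_mulx Lu.1.
apply/L2P; split; split => //; apply: (rintegrable_le (mu := mu) measurableT _ ix).
- exact: measurable_funX.
- by move=> x _; rewrite ger0_norm ?sqr_ge0// /cabs2 lerDl sqr_ge0.
- exact: measurable_funX.
- by move=> x _; rewrite ger0_norm ?sqr_ge0// /cabs2 lerDr sqr_ge0.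
Qed.

End Solvability.

(** * The resolvent *)

Section Resolvent.
Context {R : realType}.
Local Notation mu := (@lebesgue_measure R).
Local Notation Re := (@complex.Re R).
Local Notation Im := (@complex.Im R).
Implicit Types (f g h u v w : R -> R[i]) (c z k : R[i]) (phi : R -> R).

Local Opaque weak_derivative L2inner.

(** The spectral parameter moves from the right-hand side into the zeroth-order coefficient of the
    form. *)
Lemma resolventP c z h u : L2 h -> resolvent (HO c) z h u <->
  HO_dom u /\ forall g, HO_dom g -> sesqui 1 c (- z) u g = L2inner h g.
Proof.
move=> Lh; split.
  move=> [Du _ uP]; split => // g Dg; have [[Lu _] [Lg _]] := (Du.1, Dg.1).
  rewrite -HO_formE uP//.
  have -> : (fun x => h x + z * u x) = (fun x => z * u x + h x).
    by apply/funext => x; rewrite addrC.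
  by rewrite (inner_comb z Lu Lh Lg); inner_ring.
move=> [Du uP]; have [Lu _] := Du.1; split => //.
  by apply: L2D => //; exact: L2Z.
move=> g Dg; have [Lg _] := Dg.1; have := uP g Dg; rewrite -HO_formE.
have -> : (fun x => h x + z * u x) = (fun x => z * u x + h x).
  by apply/funext => x; rewrite addrC.
rewrite (inner_comb z Lu Lh Lg) => <-; rewrite addrC subrK//.
Qed.

Section Construction.
Variables (k z : R[i]) (h v : R -> R[i]).
Hypotheses (k0 : 0 < Re k) (kz : k - z != 0) (Lh : L2 h) (Dv : HO_dom v).
(* [v] plays the role of [(d/dx + k x) u]; the hypothesis is the weak form of
   [(H + 2 k - z) v = (d/dx + k x) h]. *)
Hypothesis vP : forall g, HO_dom g ->
  sesqui 1 (k ^+ 2) (2 * k - z) v g = antilinear_form (-1) k h g.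

Let u : R -> R[i] := fun x => (k - z)^-1 * (h x + weak_derivative v x - k * mulx v x).

Let vW : W12 v. Proof. by have /HO_domP[] := Dv. Qed.
Let Lv : L2 v. Proof. by have [] := vW. Qed.
Let Lxv : L2 (mulx v). Proof. by have /HO_domP[] := Dv. Qed.
Let Ldv : L2 (weak_derivative v). Proof. by have [] := weak_derivativeP vW. Qed.

Let Lu : L2 u.
Proof. by apply/L2Z/L2B; [exact: L2D|exact: L2Z]. Qed.

Let inner_u g : L2 g -> (k - z) * L2inner u g =
  L2inner h g + L2inner (weak_derivative v) g - k * L2inner (mulx v) g.
Proof.
move=> Lg.
have E : (fun x => (k - z) * u x + (k * mulx v x + (-1) * weak_derivative v x)) = h.
  by apply/funext => x; rewrite /u mulrA mulfV// mul1r; ring.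
have L1 : L2 (fun x => (-1) * weak_derivative v x) by exact: L2Z.
have L3 : L2 (fun x => k * mulx v x + (-1) * weak_derivative v x).
  by apply: L2D => //; exact: L2Z.
rewrite -[in RHS]E (inner_comb (k - z) Lu L3 Lg) (inner_comb k Lxv L1 Lg).
have L0 : L2 (fun x => 0 * v x) by exact: L2Z.
have -> : (fun x => -1 * weak_derivative v x) =
    (fun x => -2 * weak_derivative v x + weak_derivative v x).
  by apply/funext => x; ring.
by rewrite (inner_comb (-2) Ldv Ldv Lg); inner_ring.
Qed.

(** This is [A u = v], tested. Formally [(k - z) A u = A h - A B v], where [A h = (H + 2 k - z) v]
    by [vP] and [A B v = (H + k) v] by the commutator identity, leaving [(k - z) v]. *)
Let resolvent_weak : is_weak_derivative u (fun x => v x - k * mulx u x).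
Proof.
move=> phi tphi; have [Lp Lp'] := test_function_L2 tphi.
have [Dp dE] := test_function_HO_dom tphi.
have /HO_domP[pW Lxp] := Dp.
rewrite (Cintegral_real u); have [Ldp _] := weak_derivativeP pW.
have eqd f : L2 f -> L2inner f (fun x => (derive1 phi x)%:C) =
    L2inner f (weak_derivative (fun x => (phi x)%:C)).
  move=> Lf; apply: inner_ae => //; first exact: aeW.
  by apply: aeS dE => x ->.
rewrite eqd//.
have -> : Cintegral (fun x => (v x - k * mulx u x) * (phi x)%:C) =
    L2inner v (fun x => (phi x)%:C) - k * L2inner u (mulx (fun x => (phi x)%:C)).
  rewrite -inner_mulx_swap -!Cintegral_real.
  have i1 : cintegrable (fun x => v x * (phi x)%:C) by exact: L2M.
  have i2 : cintegrable (fun x => mulx u x * (phi x)%:C).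
    have := L2M Lu Lxp; congr cintegrable; apply/funext => x.
    by rewrite /mulx mulrCA mulrA.
  rewrite -mulNr -(CintegralZ (- k) i2) -CintegralD//; last exact: cintegrableZ.
  by apply: eq_Cintegral => x; ring.
have E1 := vP Dp; rewrite /sesqui /antilinear_form in E1.
have E2 := weak_derivative_skew_mulx Dv Dp.
have E3 := inner_u Ldp; have E4 := inner_u Lxp.
apply: (mulfI kz); rewrite E3.
move: E1 E2 E4.
move: (L2inner (weak_derivative v) (weak_derivative _)) (L2inner (mulx v) (mulx _)).
move: (L2inner v (fun x => (phi x)%:C)) (L2inner h (weak_derivative _)) (L2inner h (mulx _)).
move: (L2inner (weak_derivative v) (mulx _)) (L2inner (mulx v) (weak_derivative _)).
move: (L2inner u (mulx _)) => ux a1 a2 a3 a4 a5 a6 a7 E1 E2 E4.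
have -> : a6 = -1 * a4 + k * a5 - k ^+ 2 * a7 - (2 * k - z) * a3 by rewrite -E1; ring.
have -> : a2 = - (a3 + a1) by apply/eqP; rewrite -subr_eq0 opprK addrC E2.
have -> : (k - z) * - (a3 - k * ux) = - (k - z) * a3 + k * ((k - z) * ux) by ring.
by rewrite E4; ring.
Qed.

(** So far [mulx u] is only locally summable. The weak equation gives [u] an absolutely continuous
    representative solving [u' + k x u = v], and [mulx_L2] applies to it since [v] and [mulx v] are
    in [L^2]. *)
Let resolvent_dom : HO_dom u /\ {ae mu, forall x, weak_derivative u x = v x - k * mulx u x}.
Proof.
have lu := L2_clocally_summable Lu; have lv := L2_clocally_summable Lv.
have mid : continuous (fun x : R => x) by move=> x; exact: cvg_id.
have lx : clocally_summable (mulx u).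
  split.
    have -> : Re \o mulx u = (fun x => x * (Re \o u) x).
      by apply/funext => x; rewrite /= /mulx Re_real_mul.
    exact: locally_summableM mid lu.1.
  have -> : Im \o mulx u = (fun x => x * (Im \o u) x).
    by apply/funext => x; rewrite /= /mulx Im_real_mul.
  exact: locally_summableM mid lu.2.
have lw : clocally_summable (fun x => v x - k * mulx u x).
  split.
    have -> : Re \o (fun x => v x - k * mulx u x) = (fun x => (Re \o v) x +
      (- Re k * (Re \o mulx u) x + Im k * (Im \o mulx u) x)).
      by apply/funext => x; rewrite /= !Re_add Re_opp Re_mul; ring.
    apply: locally_summableD; first exact: lv.1.
    by apply: locally_summableD; apply: locally_summableZ; [exact: lx.1|exact: lx.2].
  have -> : Im \o (fun x => v x - k * mulx u x) = (fun x => (Im \o v) x +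
    (- Re k * (Im \o mulx u) x + (- Im k) * (Re \o mulx u) x)).
    by apply/funext => x; rewrite /= !Im_add Im_opp Im_mul; ring.
  apply: locally_summableD; first exact: lv.2.
  by apply: locally_summableD; apply: locally_summableZ; [exact: lx.2|exact: lx.1].
have [u0 [ac0 uu0]] := weak_cAC lu lw resolvent_weak.
have [mu0 _] := cAC_cmeasurable ac0.
have Lu0 := L2_ae Lu mu0 uu0.
have xu0 : {ae mu, forall x, mulx u0 x = mulx u x}.
  by apply: aeS uu0 => x; rewrite /mulx => ->.
have ac1 : cAC u0 (fun x => v x - k * mulx u0 x).
  apply: (cAC_ae ac0).
    apply: cmeasurableD; first exact: Lv.1.
    have -> : (fun x => - (k * mulx u0 x)) = (fun x => cst (- k) x * mulx u0 x).
      by apply/funext => x; rewrite /= mulNr.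
    by apply: cmeasurableM; [exact: cmeasurable_cst|exact: cmeasurable_mulx].
  by apply: aeS xu0 => x ->.
have Lxu0 := mulx_L2 k0 Lu0 Lv Lxv ac1.
have Lxu := L2_ae Lxu0 (cmeasurable_mulx Lu.1) xu0.
have Lw : L2 (fun x => v x - k * mulx u x) by apply: L2B => //; exact: L2Z.
have [uW dE] := cAC_W12 Lu Lw ac0 uu0.
by split => //; apply/HO_domP.
Qed.

(** Formally [(H - z) u = B A u + (k - z) u = B v + (h - B v) = h]; both integrations by parts are
    needed to see this in the form. *)
Lemma construction_resolvent : resolvent (HO (k ^+ 2)) z h u.
Proof.
have [Du dE] := resolvent_dom; apply/resolventP => //; split => // g Dg.
have /HO_domP[uW Lxu] := Du; have /HO_domP[gW Lxg] := Dg; have Lg := gW.1.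
have [Ldu _] := weak_derivativeP uW; have [Ldg _] := weak_derivativeP gW.
have Lw : L2 (fun x => v x - k * mulx u x) by apply: L2B => //; exact: L2Z.
have E0 f : L2 f -> L2inner (weak_derivative u) f = L2inner v f - k * L2inner (mulx u) f.
  move=> Lf; rewrite (inner_ae Ldu Lw Lf Lf dE); last exact: aeW.
  have -> : (fun x => v x - k * mulx u x) = (fun x => (- k) * mulx u x + v x).
    by apply/funext => x; ring.
  by rewrite (inner_comb (- k) Lxu Lv Lf); inner_ring.
have E1 := weak_derivative_skew vW gW.
have E2 := weak_derivative_skew_mulx Du Dg.
have E3 := inner_u Lg.
rewrite /sesqui E0//; rewrite E0// in E2; rewrite inner_mulx_swap in E3.
move: E1 E2 E3.
move: (L2inner v (weak_derivative g)) (L2inner (mulx u) (weak_derivative g)).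
move: (L2inner (mulx u) (mulx g)) (L2inner u g) (L2inner h g) (L2inner v (mulx g)).
move: (L2inner (weak_derivative v) g) => a1 a2 a3 a4 a5 a6 a7 E1 E2 E3.
have -> : a6 = - a1 by apply/eqP; rewrite -subr_eq0 opprK addrC E1.
have -> : a4 = (k - z) * a3 - a1 + k * a5 by rewrite E3; ring.
have -> : a7 = - (a3 + (a5 - k * a2)) by apply/eqP; rewrite -subr_eq0 opprK addrC E2.
by ring.
Qed.

Lemma construction_norm2 : cabs2 (k - z) * norm2 u <=
  3 * (norm2 h + norm2 (weak_derivative v) + cabs2 k * norm2 (mulx v)).
Proof.
have ih := cabs2_integrable Lh; have id := cabs2_integrable Ldv.
have ix := cabs2_integrable Lxv; have iu := cabs2_integrable Lu.
rewrite /norm2 -!RintegralZl// -!RintegralD//; last 2 first.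
- exact: rintegrableD.
- exact: rintegrableZ.
rewrite -RintegralZl//; last first.
  by apply: rintegrableD => //; [exact: rintegrableD|exact: rintegrableZ].
apply: le_Rintegral => //.
- exact: rintegrableZ.
- apply: rintegrableZ => //.
  by apply: rintegrableD => //; [exact: rintegrableD|exact: rintegrableZ].
move=> x _; rewrite -cabs2M /u mulrA mulfV// mul1r -cabs2M.
move: (h x) (weak_derivative v x) (k * mulx v x) => a b c.
rewrite -subr_ge0.
have -> : 3 * (cabs2 a + cabs2 b + cabs2 c) - cabs2 (a + b - c) =
    (Re a - Re b) ^+ 2 + (Re a + Re c) ^+ 2 + (Re b + Re c) ^+ 2 +
    ((Im a - Im b) ^+ 2 + (Im a + Im c) ^+ 2 + (Im b + Im c) ^+ 2).
  by rewrite /cabs2 !Re_add !Im_add Re_opp Im_opp; ring.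
by rewrite !addr_ge0 ?sqr_ge0.
Qed.

End Construction.

(** [D], [X] and [N] are the squared norms of [v'], [x v] and [v]. Exposing them as numbers reduces
    the rest of the estimate to plane geometry; the third clause is the equation of [v] tested
    against [v]. *)
Lemma resolvent_exists k z om h : 0 < Re k -> k - z != 0 -> L2 h ->
  0 < Re om -> 0 < Re (om * k ^+ 2) -> 0 < Re (om * (2 * k - z)) ->
  exists u (D X N : R),
  [/\ resolvent (HO (k ^+ 2)) z h u, [/\ 0 <= D, 0 <= X & 0 <= N],
      cabs2 (D%:C + k ^+ 2 * X%:C + (2 * k - z) * N%:C) <=
        4 * norm2 h * (D + cabs2 k * X)
    & cabs2 (k - z) * norm2 u <= 3 * (norm2 h + D + cabs2 k * X)].
Proof.
move=> k0 kz Lh o1 o2 o3.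
have [v Dv vP] := sesqui_solve (-1) k Lh o1 o2 o3.
exists (fun x => (k - z)^-1 * (h x + weak_derivative v x - k * mulx v x)).
exists (norm2 (weak_derivative v)), (norm2 (mulx v)), (norm2 v); split.
- exact: construction_resolvent.
- by split; exact: norm2_ge0.
- have := antilinear_form_bound (-1) k Lh Dv.
  rewrite -vP// sesqui_diag// mul1r.
  have -> : cabs2 (-1 : R[i]) = 1 by rewrite /cabs2 /=; ring.
  by rewrite mul1r.
- exact: construction_norm2.
Qed.

(** For the difference [d] of two solutions, solve [(H - z) w = conj d] and test against [conj d]:
    by complex symmetry the squared norm of [d] is the form at [(d, conj w)], which vanishes. *)
Lemma resolvent_unique c z : (forall h, L2 h -> exists u, resolvent (HO c) z h u) ->
  forall h u v, L2 h -> resolvent (HO c) z h u -> resolvent (HO c) z h v ->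
  {ae mu, forall x, u x = v x}.
Proof.
move=> surj h u v Lh /(resolventP _ _ _ Lh)[Du uP] /(resolventP _ _ _ Lh)[Dv vP].
pose d := fun x => (-1) * v x + u x.
have Dd : HO_dom d by exact: HO_dom_comb.
have Ld : L2 d by have [] := Dd.1.
have dP g : HO_dom g -> sesqui 1 c (- z) d g = 0.
  by move=> Dg; rewrite sesqui_comb// uP// vP//; ring.
have Lcd := L2conj Ld.
have [w /(resolventP _ _ _ Lcd)[Dw wP]] := surj _ Lcd.
have := wP _ (HO_dom_conj Dd).
rewrite -sesqui_conj_swap// dP; last exact: HO_dom_conj.
rewrite (inner_diag Lcd) => /esym /complexI n0.
apply: aeS (norm2_eq0 Lcd n0) => x /(congr1 conjc); rewrite conjcK conjc0 /d => e.
by apply/eqP; rewrite -subr_eq0 -e; apply/eqP; ring.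
Qed.

End Resolvent.

(** * Uniform bounds outside the sector *)

Section UniformBound.
Context {R : realType}.
Local Notation Re := (@complex.Re R).
Local Notation Im := (@complex.Im R).
Local Notation normc := (@Normc.normc R).
Implicit Types (c z k w om : R[i]).

Lemma normc_ge0 z : 0 <= normc z.
Proof. by case: z => a b; exact: sqrtr_ge0. Qed.

Lemma abs_Re_le z : `|Re z| <= normc z.
Proof.
rewrite -(ler_pXn2r (ltn0Sn 1)) ?nnegrE ?normc_ge0//.
by rewrite real_normK ?num_real// normc_sqr /cabs2 lerDl sqr_ge0.
Qed.

Lemma abs_Im_le z : `|Im z| <= normc z.
Proof.
rewrite -(ler_pXn2r (ltn0Sn 1)) ?nnegrE ?normc_ge0//.
by rewrite real_normK ?num_real// normc_sqr /cabs2 lerDr sqr_ge0.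
Qed.

Lemma exists_small (a g : R) : 0 < g -> exists2 t, 0 < t & 0 < t * a + g.
Proof.
move=> g0; have a0 : 0 < `|a| + 1 by rewrite ltr_wpDl.
exists (g / (2 * (`|a| + 1))); first by rewrite divr_gt0// mulr_gt0.
have -> : g / (2 * (`|a| + 1)) * a + g = g / (2 * (`|a| + 1)) * (a + 2 * (`|a| + 1)).
  by field; rewrite gt_eqF.
rewrite mulr_gt0// ?divr_gt0// ?mulr_gt0//.
have := ler_norm (- a); rewrite normrN; have := normr_ge0 a; lra.
Qed.

(** Squaring [S <= e L] and inserting the bound on [e^2] gives [S^2 <= 4 eta S L^2], from which one
    factor [S] cancels. *)
Lemma square_bound (S e eta L : R) : 0 <= eta -> 0 <= S -> S <= e * L -> e ^+ 2 <= 4 * eta * S ->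
  S <= 4 * eta * L ^+ 2.
Proof.
move=> eta0 S0 Se ee; have [->|nz] := eqVneq S 0; last first.
  have pos : 0 < S by rewrite lt_neqAle eq_sym nz.
  rewrite -(ler_pM2r pos); have h : S * S <= (e * L) ^+ 2.
    by rewrite -expr2 ler_pXn2r// nnegrE// (le_trans S0).
  apply: (le_trans h); rewrite exprMn.
  have -> : 4 * eta * L ^+ 2 * S = 4 * eta * S * L ^+ 2 by ring.
  by rewrite ler_wpM2r// sqr_ge0.
by rewrite mulr_ge0 ?sqr_ge0// mulr_ge0.
Qed.

(** The two gaps are signed distances to the boundary lines of the sector, the real axis and the
    line through [k ^+ 2], each positive on the side containing the sector. *)
Definition lower_gap (w : R[i]) : R := Im w.
Definition upper_gap k (w : R[i]) : R := - Im (conjc (k ^+ 2) * w) / cabs2 k.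

(** The imaginary part of [E] bounds [X] and [N], whose coefficients there are positive. The real
    part then bounds [D], as [Im k <= Re k] gives the [X] term the right sign. *)
Lemma energy_lower k (zeta : R[i]) (D X N : R) : 0 < Re k -> 0 < Im k -> Im k <= Re k ->
  0 < lower_gap zeta -> 0 <= D -> 0 <= X -> 0 <= N ->
  D + cabs2 k * X <= normc (D%:C + k ^+ 2 * X%:C + zeta * N%:C) *
    (1 + normc zeta / lower_gap zeta + cabs2 k / (2 * Re k * Im k)).
Proof.
rewrite /lower_gap; move=> p0 q0 qp g0 D0 X0 N0; set E := _ + zeta * _.
have hR := abs_Re_le E; have hI := abs_Im_le E; have hz := abs_Re_le zeta.
have e0 := normc_ge0 E; have K0 := cabs2_ge0 k.
have ER : Re E = D + (Re k ^+ 2 - Im k ^+ 2) * X + Re zeta * N.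
  by rewrite /E expr2 !Re_add !Re_mul Im_mul /=; ring.
have EI : Im E = 2 * Re k * Im k * X + Im zeta * N.
  by rewrite /E expr2 !Im_add !Im_mul Re_mul /=; ring.
have pq0 : 0 < 2 * Re k * Im k by rewrite !mulr_gt0.
move: ER EI hR hI hz e0 K0 p0 q0 qp g0 pq0.
move: (normc E) (normc zeta) (Re E) (Im E) (Re zeta) (Im zeta) (cabs2 k) => e nz er ei zr g K.
move: (Re k) (Im k) => p q ER EI hR hI hz e0 K0 p0 q0 qp g0 pq0.
have ei_le : ei <= e by apply: le_trans hI; exact: ler_norm.
have er_le : er <= e by apply: le_trans hR; exact: ler_norm.
have XN : 0 <= g * N by rewrite mulr_ge0// ltW.
have XX : 0 <= 2 * p * q * X by rewrite mulr_ge0// ltW.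
have hX : X <= e / (2 * p * q) by rewrite ler_pdivlMr//; lra.
have hN : N <= e / g by rewrite ler_pdivlMr//; lra.
have h1 : 0 <= (p ^+ 2 - q ^+ 2) * X.
  by rewrite mulr_ge0// subr_ge0 ler_pXn2r// nnegrE ltW.
have h2 : - zr * N <= nz * (e / g).
  apply: (@le_trans _ _ (`|zr| * N)).
    by rewrite ler_wpM2r//; rewrite -normrN; exact: ler_norm.
  by apply: ler_pM.
have h3 := ler_wpM2l K0 hX.
rewrite !mulrDr mulr1 [e * (K / _)]mulrCA [e * (nz / g)]mulrCA; lra.
Qed.

(** Multiplication by [conj (k^2)] reflects the sector and exchanges the roles of [D] and [X]; the
    argument is then that of [energy_lower]. *)
Lemma energy_upper k (zeta : R[i]) (D X N : R) : 0 < Re k -> 0 < Im k -> Im k <= Re k ->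
  0 < upper_gap k zeta -> 0 <= D -> 0 <= X -> 0 <= N ->
  D + cabs2 k * X <= normc (D%:C + k ^+ 2 * X%:C + zeta * N%:C) *
    (1 + normc zeta / upper_gap k zeta + cabs2 k / (2 * Re k * Im k)).
Proof.
rewrite /upper_gap; move=> p0 q0 qp g0 D0 X0 N0; set E := _ + zeta * _.
have K0 : 0 < cabs2 k by rewrite /cabs2 addr_gt0// exprn_gt0.
have nkk : normc (conjc (k ^+ 2)) = cabs2 k.
  apply/eqP; rewrite -(eqrXn2 (ltn0Sn 1)) ?normc_ge0 ?cabs2_ge0//; apply/eqP.
  by rewrite normc_sqr /cabs2 cRe_conj cIm_conj expr2 Re_mul Im_mul; ring.
have hR := abs_Re_le (conjc (k ^+ 2) * E); have hI := abs_Im_le (conjc (k ^+ 2) * E).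
have hz := abs_Re_le (conjc (k ^+ 2) * zeta).
rewrite !Normc.normcM !nkk in hR hI hz.
have e0 := normc_ge0 E.
have EE : conjc (k ^+ 2) * E = conjc (k ^+ 2) * D%:C + (cabs2 k ^+ 2 * X)%:C +
     conjc (k ^+ 2) * zeta * N%:C.
  rewrite /E !mulrDr !mulrA; congr (_ + _ + _).
  apply: complex_ext; rewrite !(Re_mul, Im_mul, cRe_conj, cIm_conj, expr2) /cabs2 /=; ring.
move: hR hI; rewrite EE.
move: g0 hz; set y := conjc (k ^+ 2) * zeta => g0 hz.
have -> : Re (conjc (k ^+ 2) * D%:C + (cabs2 k ^+ 2 * X)%:C + y * N%:C) =
   (Re k ^+ 2 - Im k ^+ 2) * D + cabs2 k ^+ 2 * X + Re y * N.
  by rewrite expr2 !Re_add !Re_mul cRe_conj cIm_conj Re_mul Im_mul /=; ring.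
have -> : Im (conjc (k ^+ 2) * D%:C + (cabs2 k ^+ 2 * X)%:C + y * N%:C) =
   - (2 * Re k * Im k * D - Im y * N).
  by rewrite expr2 !Im_add !Im_mul cRe_conj cIm_conj Re_mul Im_mul /=; ring.
have pq0 : 0 < 2 * Re k * Im k by rewrite !mulr_gt0.
move: hz g0 e0 K0 p0 q0 qp pq0.
move: (normc E) (normc zeta) (Re y) (Im y) (cabs2 k) (Re k) (Im k) => e nz yr yi K p q.
move=> hz g0 e0 K0 p0 q0 qp pq0 hR hI.
have g1 : 0 < - yi by move: g0; rewrite pmulr_lgt0// invr_gt0.
have DD : 0 <= 2 * p * q * D by rewrite mulr_ge0// ltW.
have NN : 0 <= - yi * N by rewrite mulr_ge0// ltW.
have i1 : 2 * p * q * D - yi * N <= K * e.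
  by apply: le_trans hI; rewrite normrN; exact: ler_norm.
have hD : D <= K * e / (2 * p * q) by rewrite ler_pdivlMr//; lra.
have hN : N <= K * e / (- yi) by rewrite ler_pdivlMr//; lra.
have r1 : (p ^+ 2 - q ^+ 2) * D + K ^+ 2 * X + yr * N <= K * e.
  by apply: le_trans hR; exact: ler_norm.
have h1 : 0 <= (p ^+ 2 - q ^+ 2) * D.
  by rewrite mulr_ge0// subr_ge0 ler_pXn2r// nnegrE ltW.
have h2 : - yr * N <= K * nz * (K * e / (- yi)).
  apply: (@le_trans _ _ (`|yr| * N)).
    by rewrite ler_wpM2r//; rewrite -normrN; exact: ler_norm.
  by apply: ler_pM.
have h3 : K * X <= e + nz * (K * e / (- yi)).
  rewrite -(ler_pM2l K0); move: h2; rewrite -mulrA => h2.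
  have -> : K * (K * X) = K ^+ 2 * X by ring.
  rewrite mulrDr; lra.
have -> : e * (1 + nz / (- yi / K) + K / (2 * p * q)) =
    e + nz * (K * e / (- yi)) + K * e / (2 * p * q).
  have [K1 p1 q1] : [/\ K != 0, p != 0 & q != 0] by split; apply: lt0r_neq0.
  have y1 : yi != 0 by rewrite -oppr_eq0; exact: lt0r_neq0.
  by field; rewrite ?oppr_eq0 ?K1 ?p1 ?q1 ?y1.
lra.
Qed.

(** Multiplication by [-i] turns the positive imaginary parts of [k ^+ 2] and [zeta] into real
    parts. A small positive [t] makes [Re om] positive as well without spoiling [zeta]. *)
Lemma exists_lower_rotation k zeta : 0 < Re k -> 0 < Im k -> Im k <= Re k ->
  0 < lower_gap zeta ->
  exists om, [/\ 0 < Re om, 0 < Re (om * k ^+ 2) & 0 < Re (om * zeta)].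
Proof.
rewrite /lower_gap => p0 q0 qp g0; have [t t0 ht] := exists_small (Re zeta) g0.
exists (t +i* (-1)); split => //.
  rewrite expr2 !Re_mul !Im_mul /=.
  have -> : t * (Re k * Re k - Im k * Im k) - -1 * (Re k * Im k + Im k * Re k) =
    t * (Re k ^+ 2 - Im k ^+ 2) + 2 * Re k * Im k by ring.
  apply: ltr_wpDl; last by rewrite !mulr_gt0.
  by rewrite mulr_ge0 ?(ltW t0)// subr_ge0 ler_pXn2r// nnegrE ltW.
by rewrite Re_mul /=; lra.
Qed.

Lemma exists_upper_rotation k zeta : 0 < Re k -> 0 < Im k -> Im k <= Re k ->
  0 < upper_gap k zeta ->
  exists om, [/\ 0 < Re om, 0 < Re (om * k ^+ 2) & 0 < Re (om * zeta)].
Proof.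
rewrite /upper_gap => p0 q0 qp.
have K0 : 0 < cabs2 k by rewrite /cabs2 addr_gt0// exprn_gt0.
rewrite pmulr_lgt0 ?invr_gt0// => g0.
have [t t0 ht] := exists_small (Re (conjc (k ^+ 2) * zeta)) g0.
(* The factor [conj (k^2)] puts the boundary direction [k ^+ 2] on the real axis; [i] and the tilt
   [t] then play the parts of [-i] and [t] in the lower case. *)
exists ((t +i* 1) * conjc (k ^+ 2)); split.
- rewrite Re_mul cRe_conj cIm_conj expr2 Re_mul Im_mul /=.
  have -> : t * (Re k * Re k - Im k * Im k) - 1 * - (Re k * Im k + Im k * Re k) =
    t * (Re k ^+ 2 - Im k ^+ 2) + 2 * Re k * Im k by ring.
  apply: ltr_wpDl; last by rewrite !mulr_gt0.
  by rewrite mulr_ge0 ?(ltW t0)// subr_ge0 ler_pXn2r// nnegrE ltW.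
- have -> : Re ((t +i* 1) * conjc (k ^+ 2) * k ^+ 2) = t * cabs2 k ^+ 2.
    by rewrite /cabs2 !(Re_mul, Im_mul, cRe_conj, cIm_conj, expr2) /=; ring.
  by rewrite mulr_gt0// exprn_gt0.
- by rewrite -mulrA Re_mul /=; lra.
Qed.

(* [gap] stands for [lower_gap (2 * k - z)] or [upper_gap k (2 * k - z)]; both
   gaps are linear, at most the modulus, and equal to [Im k] at [k], so that the
   first two bounds also give [(1 - delta) * Im k <= normc (k - z)]. *)
Definition admissible k (delta : R) z : Prop := exists gap : R,
  [/\ (2 - delta) * Im k <= gap, gap <= Im k + normc (k - z),
      exists om, [/\ 0 < Re om, 0 < Re (om * k ^+ 2) & 0 < Re (om * (2 * k - z))]
    & forall D X N : R, 0 <= D -> 0 <= X -> 0 <= N ->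
      D + cabs2 k * X <= normc (D%:C + k ^+ 2 * X%:C + (2 * k - z) * N%:C) *
        (1 + normc (2 * k - z) / gap + cabs2 k / (2 * Re k * Im k))].

Lemma admissible_lower k delta z : 0 < Re k -> 0 < Im k -> Im k <= Re k -> delta < 1 ->
  Im (z - delta%:C * k) <= 0 -> admissible k delta z.
Proof.
move=> p0 q0 qp d1 hz.
have E : Im (2 * k - z) = Im k + Im (k - z).
  by rewrite mulr_natl mulr2n !Im_add Im_opp; ring.
have hz2 : Im z <= delta * Im k.
  by move: hz; rewrite Im_add Im_opp Im_mul /=; lra.
have g1 : (2 - delta) * Im k <= Im (2 * k - z) by rewrite E Im_add Im_opp; lra.
have g0 : 0 < lower_gap (2 * k - z).
  by apply: lt_le_trans g1; rewrite mulr_gt0//; lra.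
exists (lower_gap (2 * k - z)); split => //.
- rewrite /lower_gap E lerD2l; apply: le_trans (abs_Im_le _); exact: ler_norm.
- exact: exists_lower_rotation.
- by move=> D X N D0 X0 N0; exact: energy_lower.
Qed.

Lemma admissible_upper k delta z : 0 < Re k -> 0 < Im k -> Im k <= Re k -> delta < 1 ->
  0 <= Im (conjc (k ^+ 2) * (z - delta%:C * k)) -> admissible k delta z.
Proof.
move=> p0 q0 qp d1 hz.
have K0 : 0 < cabs2 k by rewrite /cabs2 addr_gt0// exprn_gt0.
have ckk : conjc (k ^+ 2) * k = (cabs2 k)%:C * conjc k.
  by apply: complex_ext; rewrite /cabs2 !(Re_mul, Im_mul, cRe_conj, cIm_conj, expr2) /=; ring.
have Ik : Im (conjc (k ^+ 2) * k) = - cabs2 k * Im k.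
  by rewrite ckk Im_real_mul cIm_conj; ring.
have E : upper_gap k (2 * k - z) = Im k + upper_gap k (k - z).
  rewrite /upper_gap.
  have -> : conjc (k ^+ 2) * (2 * k - z) = conjc (k ^+ 2) * k + conjc (k ^+ 2) * (k - z) by ring.
  by rewrite Im_add Ik; field; rewrite gt_eqF.
have hz2 : - delta * cabs2 k * Im k <= Im (conjc (k ^+ 2) * z).
  move: hz; have -> : conjc (k ^+ 2) * (z - delta%:C * k) =
    conjc (k ^+ 2) * z + (- delta)%:C * (conjc (k ^+ 2) * k) by rewrite rmorphN; ring.
  rewrite Im_add Im_real_mul Ik; lra.
have g2 : (1 - delta) * Im k <= upper_gap k (k - z).
  rewrite /upper_gap ler_pdivlMr//.
  have -> : conjc (k ^+ 2) * (k - z) = conjc (k ^+ 2) * k + - (conjc (k ^+ 2) * z) by ring.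
  rewrite Im_add Im_opp Ik; lra.
have g1 : (2 - delta) * Im k <= upper_gap k (2 * k - z) by rewrite E; lra.
have g0 : 0 < upper_gap k (2 * k - z).
  by apply: lt_le_trans g1; rewrite mulr_gt0//; lra.
exists (upper_gap k (2 * k - z)); split => //.
- rewrite E lerD2l /upper_gap ler_pdivrMr//.
  have nkk : normc (conjc (k ^+ 2)) = cabs2 k.
    apply/eqP; rewrite -(eqrXn2 (ltn0Sn 1)) ?normc_ge0 ?cabs2_ge0//; apply/eqP.
    by rewrite normc_sqr /cabs2 cRe_conj cIm_conj expr2 Re_mul Im_mul; ring.
  rewrite mulrC -nkk -Normc.normcM; apply: le_trans (abs_Im_le _).
  by rewrite -normrN; exact: ler_norm.
- exact: exists_upper_rotation.
- by move=> D X N D0 X0 N0; exact: energy_upper.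
Qed.

Lemma uniform_resolvent_bound k delta : 0 < Re k -> 0 < Im k -> delta < 1 ->
  exists2 M : R, 0 <= M & forall z, admissible k delta z -> forall h, L2 h ->
    exists u, resolvent (HO (k ^+ 2)) z h u /\ norm2 u <= M * norm2 h.
Proof.
move=> p0 q0 d1.
set q := Im k in q0 *; set p := Re k in p0 *; set n := normc k.
pose A := 1 + n / q + cabs2 k / (2 * p * q).
pose d0 := (1 - delta) * q.
have d00 : 0 < d0 by rewrite mulr_gt0//; lra.
have n0 : 0 <= n by exact: normc_ge0.
have A0 : 0 <= A.
  rewrite !addr_ge0 ?divr_ge0 ?cabs2_ge0 ?(ltW q0)//.
  by rewrite !mulr_ge0 ?(ltW q0) ?(ltW p0).
(* With [L <= A + |k - z| / q], the energy is at most [4 |h|^2 (2 A^2 + 2 |k - z|^2 / q^2)], and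
   [|k - z|^2 |u|^2] at most [3 |h|^2] plus three times this. Dividing by [|k - z|^2 >= d0^2] gives
   the two summands. *)
exists ((3 + 24 * A ^+ 2) / d0 ^+ 2 + 24 / q ^+ 2).
  rewrite addr_ge0// divr_ge0// ?sqr_ge0//.
  by rewrite addr_ge0// mulr_ge0// sqr_ge0.
move=> z [gap [g1 g2 [om [r1 r2 r3]] en]] h Lh.
have dd : d0 <= normc (k - z) by rewrite /d0; lra.
have gq : q <= gap by apply: le_trans g1; rewrite -[leLHS]mul1r ler_wpM2r ?(ltW q0)//; lra.
have g0 : 0 < gap by exact: lt_le_trans gq.
have nz0 : 0 < normc (k - z) by exact: lt_le_trans dd.
have kz : k - z != 0.
  by apply: contraTneq nz0 => ->; rewrite Normc.normc0 ltxx.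
have [u [D [X [N [uP [D0 X0 N0] E1 E2]]]]] := resolvent_exists p0 kz Lh r1 r2 r3.
exists u; split => //.
have eta0 := norm2_ge0 h; have S0 : 0 <= D + cabs2 k * X.
  by rewrite addr_ge0// mulr_ge0// cabs2_ge0.
have := en D X N D0 X0 N0; rewrite -normc_sqr in E1; move=> en1.
have hS := square_bound eta0 S0 en1 E1.
have nzeta : normc (2 * k - z) <= normc (k - z) + n.
  have -> : 2 * k - z = (k - z) + k by ring.
  exact: le_normcD.
rewrite -normc_sqr in E2.
have hL : 1 + normc (2 * k - z) / gap + cabs2 k / (2 * p * q) <= A + normc (k - z) / q.
  rewrite /A; have : normc (2 * k - z) / gap <= (normc (k - z) + n) / q.
    by apply: ler_pM => //; rewrite ?normc_ge0 ?invr_ge0 ?(ltW g0)// lef_pV2.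
  rewrite mulrDl; lra.
have L0 : 0 <= 1 + normc (2 * k - z) / gap + cabs2 k / (2 * p * q).
  rewrite !addr_ge0 ?divr_ge0 ?normc_ge0 ?cabs2_ge0 ?(ltW g0)//.
  by rewrite !mulr_ge0 ?(ltW q0) ?(ltW p0).
have hL2 : (1 + normc (2 * k - z) / gap + cabs2 k / (2 * p * q)) ^+ 2 <=
    2 * A ^+ 2 + 2 * (normc (k - z) / q) ^+ 2.
  apply: (@le_trans _ _ ((A + normc (k - z) / q) ^+ 2)).
    by rewrite ler_pXn2r// nnegrE// (le_trans L0).
  have := sqr_ge0 (A - normc (k - z) / q).
  by move: (normc (k - z) / q) => y; lra.
move: hS hL2; move: (1 + _ + _) => L hS hL2.
have hS2 : D + cabs2 k * X <= 4 * norm2 h * (2 * A ^+ 2 + 2 * (normc (k - z) / q) ^+ 2).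
  by apply: (le_trans hS); rewrite ler_wpM2l// mulr_ge0.
have nsq : 0 < normc (k - z) ^+ 2 by rewrite exprn_gt0.
rewrite -(ler_pM2l nsq); apply: (le_trans E2).
apply: (@le_trans _ _ (norm2 h * (3 + 24 * A ^+ 2) * 1 +
  norm2 h * (24 / q ^+ 2) * normc (k - z) ^+ 2)).
  move: hS2; rewrite exprMn exprVn; move: (normc (k - z) ^+ 2) (q ^- 2) => a b; lra.
have h1 : 1 <= normc (k - z) ^+ 2 / d0 ^+ 2.
  by rewrite ler_pdivlMr ?exprn_gt0// mul1r ler_pXn2r// nnegrE ltW.
have cpos : 0 <= norm2 h * (3 + 24 * A ^+ 2).
  by rewrite mulr_ge0// addr_ge0// mulr_ge0// sqr_ge0.
have := ler_wpM2l cpos h1.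
move: (d0 ^- 2) (normc (k - z) ^+ 2) (q ^- 2) => a b e; lra.
Qed.

End UniformBound.

(** * The complement of the sector as a union of half-planes *)

Section Sector.
Context {R : realType}.
Local Notation Re := (@complex.Re R).
Local Notation Im := (@complex.Im R).
Local Notation normc := (@Normc.normc R).
Implicit Types (c w : R[i]).

(** By contraposition: if [w] is strictly above the real axis and strictly below the line of [c],
    then [Re w > 0], and arguments compare oppositely to their cosines. *)
Lemma notin_sector c w : 0 < Re c -> 0 < Im c -> ~ sector 0 (carg c) w ->
  Im w <= 0 \/ 0 <= Im (conjc c * w).
Proof.
move=> rc ic; apply: contra_notP => /not_orP[/negP + /negP].
rewrite -!ltNge Im_mul cRe_conj cIm_conj => iw cw.
have rw : 0 < Re w.
  by rewrite -(pmulr_rgt0 _ ic); apply: lt_trans (mulr_gt0 rc iw) _; lra.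
have pos z : 0 < Im z -> 0 < normc z.
  by move=> iz; apply: lt_le_trans (abs_Im_le z); rewrite gtr0_norm.
have nc := pos _ ic; have nw := pos _ iw.
have strict z : 0 < Im z -> Re z / normc z < 1.
  move=> iz; rewrite ltr_pdivrMr ?pos// mul1r.
  apply: le_lt_trans (ler_norm _) _.
  rewrite -(ltr_pXn2r (ltn0Sn 1)) ?nnegrE ?normc_ge0//.
  by rewrite real_normK ?num_real// normc_sqr /cabs2 ltrDl exprn_gt0.
have ge0 z : 0 < Re z -> 0 < Im z -> 0 < Re z / normc z.
  by move=> rz iz; rewrite divr_gt0 ?pos.
split; first by apply: contraTneq nw => ->; rewrite Normc.normc0 ltxx.
rewrite /carg (ltW iw) (ltW ic).
(* After cross-multiplication and squaring, the terms [Re^2 Re^2] cancel and the negation of the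
   second half-plane condition remains. *)
have h : Re c / normc c < Re w / normc w.
  rewrite ltr_pdivrMr// mulrAC ltr_pdivlMr//.
  rewrite -(ltr_pXn2r (ltn0Sn 1)) ?nnegrE ?mulr_ge0 ?normc_ge0 ?(ltW rc) ?(ltW rw)//.
  rewrite !exprMn !normc_sqr /cabs2 !mulrDr [Re w ^+ 2 * _]mulrC ltrD2l -!exprMn.
  by rewrite ltr_pXn2r// ?nnegrE ?mulr_ge0 ?ltW//; lra.
have [sw sc] := (strict _ iw, strict _ ic).
have [gw gc] := (ge0 _ rw iw, ge0 _ rc ic).
apply/andP; split.
  by apply: acos_gt0; rewrite sw andbT; lra.
rewrite -ltr_cos ?acosK ?in_itv/= ?acos_ge0 ?acos_lepi//; apply/andP; split; lra.
Qed.

End Sector.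

(** * From the uniform resolvent bound to the pseudospectrum *)

Theorem corollary11 (R : realType) (c : R[i])
  (Re_c : 0 < complex.Re c) (Im_c : 0 < complex.Im c)
  (delta : R) (delta_gt0 : 0 < delta) (delta_lt1 : delta < 1) :
  exists eps : R, 0 < eps /\
    Spec_eps eps (HO c) `<=` translate (sector 0 (carg c)) (delta%:C * sqrtc c).
Proof.
set k := sqrtc c.
have kc : k ^+ 2 = c by exact: sqr_sqrtc.
have Rk : complex.Re c = complex.Re k ^+ 2 - complex.Im k ^+ 2.
  by rewrite -kc expr2 Re_mul; ring.
have Ik : complex.Im c = 2 * complex.Re k * complex.Im k.
  by rewrite -kc expr2 Im_mul; ring.
have p0 : 0 < complex.Re k.
  have : 0 <= complex.Re k by rewrite /k; case: (c) => a b; exact: sqrtr_ge0.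
  rewrite le_eqVlt => /predU1P[h|//].
  by move: Im_c; rewrite Ik -h mulr0 mul0r ltxx.
have q0 : 0 < complex.Im k.
  by move: Im_c; rewrite Ik pmulr_rgt0// mulr_gt0.
(* This is the positivity of [Re c], the real part of [k^2]. *)
have qp : complex.Im k <= complex.Re k.
  by rewrite -(ler_pXn2r (ltn0Sn 1)) ?nnegrE ?(ltW p0) ?(ltW q0)//; lra.
have [M M0 MP] := uniform_resolvent_bound p0 q0 delta_lt1.
have sM := sqrtr_ge0 M.
have in_resolvent z : admissible k delta z -> resolvent_set (HO c) z /\
    forall h u, L2 h -> resolvent (HO c) z h u ->
      (L2norm u <= (Num.sqrt M)%:E * L2norm h)%E.
  move=> /MP; rewrite kc => zP.
  have surj h : L2 h -> exists u, resolvent (HO c) z h u.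
    by move=> /zP[u [uP _]]; exists u.
  have uniq := resolvent_unique surj.
  have bound h u : L2 h -> resolvent (HO c) z h u ->
      (L2norm u <= (Num.sqrt M)%:E * L2norm h)%E.
    move=> Lh uP; have [u' [u'P nu']] := zP h Lh.
    have [Lu Lu'] : L2 u /\ L2 u'.
      by case: uP u'P => [[[Lu _] _] _ _] [[[Lu' _] _] _ _].
    (* The bound is known for one solution only; uniqueness carries it to every representative of
       every solution. *)
    have -> : L2norm u = L2norm u'.
      by rewrite !L2normE//; congr ((Num.sqrt _)%:E); apply: norm2_ae;
        [exact: Lu.1|exact: Lu'.1|exact: uniq uP u'P].
    by rewrite !L2normE// -EFinM lee_fin -sqrtrM// ler_wsqrtr.
  by split => //; split => //; exists (Num.sqrt M).
have adm z : ~ translate (sector 0 (carg c)) (delta%:C * k) z -> admissible k delta z.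
  move=> zn; have [|h|h] := @notin_sector _ c (z - delta%:C * k) Re_c Im_c.
  - by move=> zs; apply: zn; exists (z - delta%:C * k); rewrite ?subrK.
  - exact: admissible_lower.
  - by apply: admissible_upper => //; rewrite kc.
(* The pseudospectrum is closed by a non-strict inequality, so [1 / eps] must strictly exceed the
   uniform bound [Num.sqrt M]. *)
exists (Num.sqrt M + 1)^-1; split; first by rewrite invr_gt0; lra.
move=> z zS; apply: contrapT => /adm /in_resolvent[zr bound].
case: zS => [//|[_]]; rewrite div1r invrK leNgt => /negP; apply.
apply: (@le_lt_trans _ _ (Num.sqrt M)%:E); last by rewrite lte_fin ltrDl.
apply: ge_ereal_sup => _ [h [u [Lh h1 uP ->]]].
apply: (le_trans (bound h u Lh uP)); rewrite -[leRHS]mule1.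
by apply: lee_wpmul2l.
Qed.
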